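(* A Max $(r,2)$-CSP instance whose constraint graph $G$ has order $n$ and average degree $d\ge 2$ can be solved in time $O\!\left(n\, r^{\left(1-\frac{2}{d+1}\right)n}+\mathrm{poly}(n)\right)$.
   Context: An instance of Max $(r,2)$-CSP, for an integer $r\ge 2$, consists of a finite simple graph $G=(V,E)$ (the constraint graph) with $V=\{1,\dots,n\}$, $n\ge 1$, and $m=|E|$ edges, together with real-valued score functions: a constant $s_\emptyset$, a function $s_v:[r]\to\mathbb{R}$ for each vertex $v$, and a function $s_{uv}:[r]^2\to\mathbb{R}$ for each edge $uv$ ($u<v$), where $[r]=\{1,\dots,r\}$. An assignment $\phi:V\to[r]$ has score $s(\phi)=s_\emptyset+\sum_{v}s_v(\phi(v))+\sum_{uv\in E}s_{uv}(\phi(u),\phi(v))$; solving means outputting the maximum score and an assignment attaining it. The average degree is $d=2m/n$. The computational model is a RAM in which arithmetic operations and comparisons on real numbers take time $O(1)$. $\mathrm{poly}(n)$ denotes some fixed polynomial in $n$; the $O$-constant is absolute.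
   Formalization: The time bound proved is O(r^2 (n r^{(1-2/(d+1))n} + poly(n))) with absolute constant and polynomial; without the factor r^2 the claim fails for unbounded r, since a triangle (n=3, d=2) has 3r^2 edge scores to read but the stated bound is O(r). *)

(* Defs.v *)
From HB Require Import structures.
From mathcomp Require Import all_boot all_order all_algebra.
From mathcomp Require Import reals exp.

Set Implicit Arguments.
Unset Strict Implicit.
Unset Printing Implicit Defensive.

Import Order.TTheory GRing.Theory Num.Theory.
Local Open Scope ring_scope.

(* Vertices 1..n and values 1..r are represented by 'I_n and 'I_r, numbered
   from 0.  [s_edge I u v] is meaningful only for edges uv with u < v: it is
   neither scored nor part of the input otherwise. *)
Record csp (R : realType) (r n : nat) : Type := Csp {
  adj : rel 'I_n;
  adj_sym : symmetric adj;
  adj_irr : irreflexive adj;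
  s_empty : R;
  s_vertex : 'I_n -> 'I_r -> R;
  s_edge : 'I_n -> 'I_n -> 'I_r -> 'I_r -> R }.

Section Instance.
Variables (R : realType) (r n : nat) (I : csp R r n).

Definition edges : {set 'I_n * 'I_n} :=
  [set e : 'I_n * 'I_n | (e.1 < e.2)%N && adj I e.1 e.2].

Definition avg_degree : R := 2 * #|edges|%:R / n%:R.

Definition score (phi : {ffun 'I_n -> 'I_r}) : R :=
  s_empty I + \sum_(v < n) s_vertex I v (phi v)
  + \sum_(e in edges) s_edge I e.1 e.2 (phi e.1) (phi e.2).

End Instance.

(* A random access machine with registers and two memories, one of natural
   numbers (which also serve as addresses) and one of exact real numbers.  Every
   instruction takes one unit of time.  Natural numbers can only be added and
   subtracted: unit-cost multiplication of unbounded integers would make the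
   machine unrealistically strong.  On reals the four operations and comparison
   are available, but no rounding.  Program constants are natural numbers, so
   that no information can be hidden in a real constant. *)
Inductive instr : Type :=
| IConst of nat & nat           (* ireg[i] := k                    *)
| IAdd of nat & nat & nat       (* ireg[i] := ireg[j] + ireg[k]    *)
| ISub of nat & nat & nat       (* truncated at 0                  *)
| ILoad of nat & nat            (* ireg[i] := imem[ireg[j]]        *)
| IStore of nat & nat           (* imem[ireg[i]] := ireg[j]        *)
| RConst of nat & nat           (* rreg[i] := k                    *)
| RAdd of nat & nat & nat
| RSub of nat & nat & nat
| RMul of nat & nat & nat
| RDiv of nat & nat & nat       (* x / 0 is 0                      *)
| RLoad of nat & nat            (* rreg[i] := rmem[ireg[j]]        *)
| RStore of nat & nat           (* rmem[ireg[i]] := rreg[j]        *)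
| Jump of nat
| IJumpLe of nat & nat & nat    (* if ireg[i] <= ireg[j] goto l    *)
| RJumpLe of nat & nat & nat.   (* if rreg[i] <= rreg[j] goto l    *)

Definition program := seq instr.

Record config (R : realType) : Type := Config {
  pc : nat;
  ireg : nat -> nat;
  rreg : nat -> R;
  imem : nat -> nat;
  rmem : nat -> R }.

Definition upd (T : Type) (M : nat -> T) (i : nat) (x : T) : nat -> T :=
  fun j => if j == i then x else M j.

Section Semantics.
Variable R : realType.

Definition exec (a : instr) (c : config R) : config R :=
  let: Config q X F M W := c in
  let seti i x := Config q.+1 (upd X i x) F M W in
  let setr i x := Config q.+1 X (upd F i x) M W in
  let goto l := Config l X F M W in
  match a with
  | IConst i k => seti i k
  | IAdd i j k => seti i (X j + X k)%N
  | ISub i j k => seti i (X j - X k)%N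
  | ILoad i j => seti i (M (X j))
  | IStore i j => Config q.+1 X F (upd M (X i) (X j)) W
  | RConst i k => setr i k%:R
  | RAdd i j k => setr i (F j + F k)
  | RSub i j k => setr i (F j - F k)
  | RMul i j k => setr i (F j * F k)
  | RDiv i j k => setr i (F j / F k)
  | RLoad i j => setr i (W (X j))
  | RStore i j => Config q.+1 X F M (upd W (X i) (F j))
  | Jump l => goto l
  | IJumpLe i j l => goto (if (X i <= X j)%N then l else q.+1)
  | RJumpLe i j l => goto (if F i <= F j then l else q.+1)
  end.

Definition halted (P : program) (c : config R) : bool := (size P <= pc c)%N.

Definition step (P : program) (c : config R) : config R :=
  if halted P c then c else exec (nth (Jump 0) P (pc c)) c.

End Semantics.

Section Solving.
Variables (R : realType) (r n : nat) (I : csp R r n).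

(* The input lists n, r, m and the endpoints of the m edges in the integer
   memory, and the score tables, in row-major order and with the edges in the
   same order, in the real memory.  All other cells and all registers are 0. *)
Definition int_input : seq nat :=
  [:: n, r, #|edges I|
    & flatten [seq [:: val e.1; val e.2] | e <- enum (edges I)]].

Definition real_input : seq R :=
  s_empty I ::
  [seq s_vertex I v a | v <- enum 'I_n, a <- enum 'I_r] ++
  flatten [seq [seq s_edge I e.1 e.2 a b | a <- enum 'I_r, b <- enum 'I_r]
          | e <- enum (edges I)].

Definition start : config R :=
  Config 0 (fun=> 0%N) (fun=> 0) (nth 0%N int_input) (nth 0 real_input).

(* The output is an optimal assignment in imem[0..n-1] and its score in
   rmem[0]. *)
Definition correct_output (c : config R) : Prop :=
  exists phi : {ffun 'I_n -> 'I_r},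
    [/\ forall v : 'I_n, imem c v = phi v :> nat,
        rmem c 0 = score I phi
      & forall psi : {ffun 'I_n -> 'I_r}, score I psi <= score I phi].

Definition solves_in_time (P : program) (T : R) : Prop :=
  exists t : nat,
    let c := iter t (step P) start in
    [/\ t%:R <= T, halted P c & correct_output c].

End Solving.

(* Main.v *)
Require Import Defs.
From mathcomp Require Import all_boot all_order all_algebra.
From mathcomp Require Import reals exp.
From mathcomp Require Import zify ring lra.

(* Score functions are eliminated vertex by vertex.  A vertex with at most one
   remaining neighbour can be maximized out at cost O(r^2) (dynamic programming
   on a forest); any other vertex is branched on, at the price of a factor r.  So
   after choosing a set B such that G - B is a forest, r^|B| forests have to be
   solved, each in time O(n r^2).

   A greedy choice of B suffices: delete a vertex of degree at most 1 (it goes to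
   the forest) if there is one, and a vertex of maximum degree (it goes to B)
   otherwise.  With the potential f(G) = sum_v min(1, 2 / (deg v + 1)) of Alon,
   Kahn and Seymour, f plus the number of forest vertices never decreases, so the
   forest has at least f(G) >= 2n / (d + 1) vertices when d >= 2.

   The r-ary tree of partial assignments of B is built breadth first, with one
   score table per node, so that each child costs only O(n r).

   The algorithm is written in a language with arrays whose only loops are
   bounded, hence with a total semantics and an exact cost function, and this
   language is compiled to the random access machine. *)


Set Implicit Arguments.
Unset Strict Implicit.
Unset Printing Implicit Defensive.

Import Order.TTheory GRing.Theory Num.Theory.

(** The machine cannot multiply integers, so the products in addresses are tabulated once, by
    repeated addition, and the tree is numbered so that children get consecutive numbers and the r^k
    leaves come last. The arrays are unbounded and interleaved above the input; the address where
    they begin depends on the input and has to be computed first, by code that uses no array.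

    Conditioning on a branching vertex and maximizing out a forest vertex are both exact identities
    for one functional, [energy]. For this the edge scores are symmetrized into a single matrix on
    literals, and what a deleted vertex contributes is moved to the table of a dummy vertex that is
    never deleted. Tree nodes and forests thus share one table format, and the optimum of a leaf
    ends up as a single entry of its table.

    The factor r^2 in the running time is the price of one forest vertex: r candidate values for
    each of the r values of its parent. Filling the tree costs the same up to a constant: at most
    r^k inner nodes, each with r children whose tables have (n + 1) r entries. *)

(** * A language with arrays and bounded loops, and its exact cost *)

Inductive iexp : Type :=
| ICst of nat
| IVar of nat
| IArr of nat & iexp
| IPlus of iexp & iexp
| IMinus of iexp & iexp.

Inductive rexp : Type :=
| RVar of nat
| RArr of nat & iexp
| RPlus of rexp & rexp.

Inductive cmd : Type :=
| ISet of nat & iexp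
| RSet of nat & rexp
| IPut of nat & iexp & iexp
| RPut of nat & iexp & rexp
| Seq of cmd & cmd
| IfI of iexp & iexp & cmd & cmd
| IfR of rexp & rexp & cmd & cmd
| For of nat & nat & cmd.

(* The registers with smaller numbers hold the variables, the other ones hold
   temporary values. *)
Definition nints := 40.
Definition nreals := 4.
Definition stride := 16.

Section Language.
Variable R : realType.

Record state : Type := State {
  iv : nat -> nat;
  rv : nat -> R;
  ia : nat -> nat -> nat;
  ra : nat -> nat -> R }.

(* Array 0 is the memory below the base address, which is kept in variable 0;
   an index which is out of range is clamped. *)
Definition cell (b j x : nat) : nat := if j is 0 then minn x b.-1 else x.

Definition put (T : Type) (A : nat -> nat -> T) (j x : nat) (v : T) :
  nat -> nat -> T := fun j' => if j' == j then upd (A j) x v else A j'.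

Fixpoint ieval (e : iexp) (s : state) : nat :=
  match e with
  | ICst k => k
  | IVar x => iv s x
  | IArr j e1 => ia s j (cell (iv s 0) j (ieval e1 s))
  | IPlus e1 e2 => ieval e1 s + ieval e2 s
  | IMinus e1 e2 => ieval e1 s - ieval e2 s
  end.

Fixpoint reval (e : rexp) (s : state) : R :=
  match e with
  | RVar x => rv s x
  | RArr j e1 => ra s j (cell (iv s 0) j (ieval e1 s))
  | RPlus e1 e2 => (reval e1 s + reval e2 s)%R
  end.

Definition set_iv (s : state) (x k : nat) : state :=
  State (upd (iv s) x k) (rv s) (ia s) (ra s).

Fixpoint eval (c : cmd) (s : state) : state :=
  match c with
  | ISet x e => set_iv s x (ieval e s)
  | RSet x e => State (iv s) (upd (rv s) x (reval e s)) (ia s) (ra s)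
  | IPut j e1 e2 =>
      State (iv s) (rv s)
        (put (ia s) j (cell (iv s 0) j (ieval e1 s)) (ieval e2 s)) (ra s)
  | RPut j e1 e2 =>
      State (iv s) (rv s) (ia s)
        (put (ra s) j (cell (iv s 0) j (ieval e1 s)) (reval e2 s))
  | Seq c1 c2 => eval c2 (eval c1 s)
  | IfI e1 e2 c1 c2 => if ieval e1 s <= ieval e2 s then eval c1 s else eval c2 s
  | IfR e1 e2 c1 c2 =>
      if (reval e1 s <= reval e2 s)%R then eval c1 s else eval c2 s
  | For x y c1 => iteri (iv s y) (fun k s1 => eval c1 (set_iv s1 x k)) s
  end.

Fixpoint isize (e : iexp) : nat :=
  match e with
  | ICst _ => 1
  | IVar _ => 2
  | IArr j e1 => isize e1 + (if j is 0 then 4 else 7) + 1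
  | IPlus e1 e2 | IMinus e1 e2 => isize e1 + isize e2 + 1
  end.

Fixpoint rsize (e : rexp) : nat :=
  match e with
  | RVar _ => 2
  | RArr j e1 => isize e1 + (if j is 0 then 4 else 7) + 1
  | RPlus e1 e2 => rsize e1 + rsize e2 + 1
  end.

(** Counts machine steps. A loop pays 3 steps of set-up and its last, failing test, then 6 per round
    for the test, the copy of the counter and its increment. The second branch of a conditional pays
    one extra step, the jump over the first. *)
Fixpoint cost (c : cmd) (s : state) : nat :=
  match c with
  | ISet x e => isize e + 2
  | RSet x e => rsize e + 2
  | IPut j e1 e2 => isize e1 + (if j is 0 then 4 else 7) + isize e2 + 1
  | RPut j e1 e2 => isize e1 + (if j is 0 then 4 else 7) + rsize e2 + 1
  | Seq c1 c2 => cost c1 s + cost c2 (eval c1 s)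
  | IfI e1 e2 c1 c2 =>
      isize e1 + isize e2 + 1
      + (if ieval e1 s <= ieval e2 s then cost c1 s else (cost c2 s).+1)
  | IfR e1 e2 c1 c2 =>
      rsize e1 + rsize e2 + 1
      + (if (reval e1 s <= reval e2 s)%R then cost c1 s else (cost c2 s).+1)
  | For x y c1 =>
      4 + \sum_(k < iv s y)
        (6 + cost c1 (set_iv (iteri k (fun k s1 => eval c1 (set_iv s1 x k)) s) x k))
  end.

(** * Compilation to the random access machine *)

(** Multiplication by [stride] = 16 is done by four doublings. For array 0, t - (t + 1 - b) with
    truncated subtraction is min(t, b - 1), so that a stray index cannot reach the other arrays. *)
Definition caddr (j t : nat) : program :=
  if j is j'.+1 then
    [:: IAdd t t t; IAdd t t t; IAdd t t t; IAdd t t t; IAdd t t 0;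
        IConst t.+1 j'; IAdd t t t.+1]
  else [:: IConst t.+1 1; IAdd t.+1 t t.+1; ISub t.+1 t.+1 0; ISub t t t.+1].

(** There is no move instruction: a copy is an addition to a register just set to 0. *)
Fixpoint ccomp (e : iexp) (t : nat) : program :=
  match e with
  | ICst k => [:: IConst t k]
  | IVar x => [:: IConst t 0; IAdd t x t]
  | IArr j e1 => ccomp e1 t ++ caddr j t ++ [:: ILoad t t]
  | IPlus e1 e2 => ccomp e1 t ++ ccomp e2 t.+1 ++ [:: IAdd t t t.+1]
  | IMinus e1 e2 => ccomp e1 t ++ ccomp e2 t.+1 ++ [:: ISub t t t.+1]
  end.

Fixpoint rcomp (e : rexp) (t q : nat) : program :=
  match e with
  | RVar x => [:: RConst q 0; RAdd q x q]
  | RArr j e1 => ccomp e1 t ++ caddr j t ++ [:: RLoad q t]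
  | RPlus e1 e2 => rcomp e1 t q ++ rcomp e2 t q.+1 ++ [:: RAdd q q q.+1]
  end.

Fixpoint csize (c : cmd) : nat :=
  match c with
  | ISet x e => isize e + 2
  | RSet x e => rsize e + 2
  | IPut j e1 e2 => isize e1 + (if j is 0 then 4 else 7) + isize e2 + 1
  | RPut j e1 e2 => isize e1 + (if j is 0 then 4 else 7) + rsize e2 + 1
  | Seq c1 c2 => csize c1 + csize c2
  | IfI e1 e2 c1 c2 => isize e1 + isize e2 + 1 + csize c2 + 1 + csize c1
  | IfR e1 e2 c1 c2 => rsize e1 + rsize e2 + 1 + csize c2 + 1 + csize c1
  | For x y c1 => 6 + csize c1 + 3
  end.

(* Registers from [t] on are free for temporary values; [l] is the address of
   the first instruction. *)
Fixpoint compile (c : cmd) (t l : nat) : program :=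
  match c with
  | ISet x e => ccomp e t ++ [:: IConst t.+1 0; IAdd x t t.+1]
  | RSet x e =>
      rcomp e t nreals ++ [:: RConst nreals.+1 0; RAdd x nreals nreals.+1]
  | IPut j e1 e2 => ccomp e1 t ++ caddr j t ++ ccomp e2 t.+1 ++ [:: IStore t t.+1]
  | RPut j e1 e2 =>
      ccomp e1 t ++ caddr j t ++ rcomp e2 t.+1 nreals ++ [:: RStore t nreals]
  | Seq c1 c2 => compile c1 t l ++ compile c2 t (l + csize c1)
  | IfI e1 e2 c1 c2 =>
      let l2 := l + (isize e1 + isize e2 + 1) in
      let l1 := l2 + csize c2 + 1 in
      ccomp e1 t ++ ccomp e2 t.+1 ++ [:: IJumpLe t t.+1 l1]
      ++ compile c2 t l2 ++ [:: Jump (l1 + csize c1)] ++ compile c1 t l1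
  | IfR e1 e2 c1 c2 =>
      let l2 := l + (rsize e1 + rsize e2 + 1) in
      let l1 := l2 + csize c2 + 1 in
      rcomp e1 t nreals ++ rcomp e2 t nreals.+1
      ++ [:: RJumpLe nreals nreals.+1 l1]
      ++ compile c2 t l2 ++ [:: Jump (l1 + csize c1)] ++ compile c1 t l1
  | For x y c1 =>
      [:: IConst t 0; IConst t.+2 0; IAdd t.+1 y t.+2;
          IJumpLe t.+1 t (l + (6 + csize c1 + 3)); IConst t.+2 0; IAdd x t t.+2]
      ++ compile c1 t.+2 (l + 6)
      ++ [:: IConst t.+2 1; IAdd t t t.+2; Jump (l + 3)]
  end.

Fixpoint iwf (e : iexp) : bool :=
  match e with
  | ICst _ => true
  | IVar x => x < nints
  | IArr j e1 => (j <= stride) && iwf e1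
  | IPlus e1 e2 | IMinus e1 e2 => iwf e1 && iwf e2
  end.

Fixpoint rwf (e : rexp) : bool :=
  match e with
  | RVar x => x < nreals
  | RArr j e1 => (j <= stride) && iwf e1
  | RPlus e1 e2 => rwf e1 && rwf e2
  end.

Fixpoint wf (c : cmd) : bool :=
  match c with
  | ISet x e => (x < nints) && iwf e
  | RSet x e => (x < nreals) && rwf e
  | IPut j e1 e2 => [&& j <= stride, iwf e1 & iwf e2]
  | RPut j e1 e2 => [&& j <= stride, iwf e1 & rwf e2]
  | Seq c1 c2 => wf c1 && wf c2
  | IfI e1 e2 c1 c2 => [&& iwf e1, iwf e2, wf c1 & wf c2]
  | IfR e1 e2 c1 c2 => [&& rwf e1, rwf e2, wf c1 & wf c2]
  | For x y c1 => [&& x < nints, y < nints & wf c1]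
  end.

Fixpoint iarrfree (e : iexp) : bool :=
  match e with
  | ICst _ | IVar _ => true
  | IArr _ _ => false
  | IPlus e1 e2 | IMinus e1 e2 => iarrfree e1 && iarrfree e2
  end.

(** The base address has to be computed before arrays have a location; code of this class is correct
    whatever variable 0 holds. *)
Fixpoint arrfree (c : cmd) : bool :=
  match c with
  | ISet x e => iarrfree e
  | RSet _ _ | IPut _ _ _ | RPut _ _ _ | IfR _ _ _ _ => false
  | Seq c1 c2 => arrfree c1 && arrfree c2
  | IfI e1 e2 c1 c2 => [&& iarrfree e1, iarrfree e2, arrfree c1 & arrfree c2]
  | For x y c1 => arrfree c1
  end.

(* [wiv], [wia] and [wra] list the integer variables, integer arrays and real
   arrays which may be written. *)
Fixpoint wiv (c : cmd) : seq nat :=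
  match c with
  | ISet x _ => [:: x]
  | RSet _ _ | IPut _ _ _ | RPut _ _ _ => [::]
  | Seq c1 c2 | IfI _ _ c1 c2 | IfR _ _ c1 c2 => wiv c1 ++ wiv c2
  | For x _ c1 => x :: wiv c1
  end.

Fixpoint wia (c : cmd) : seq nat :=
  match c with
  | IPut j _ _ => [:: j]
  | ISet _ _ | RSet _ _ | RPut _ _ _ => [::]
  | Seq c1 c2 | IfI _ _ c1 c2 | IfR _ _ c1 c2 => wia c1 ++ wia c2
  | For _ _ c1 => wia c1
  end.

Fixpoint wra (c : cmd) : seq nat :=
  match c with
  | RPut j _ _ => [:: j]
  | ISet _ _ | RSet _ _ | IPut _ _ _ => [::]
  | Seq c1 c2 | IfI _ _ c1 c2 | IfR _ _ c1 c2 => wra c1 ++ wra c2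
  | For _ _ c1 => wra c1
  end.

Lemma iteri_ind (T : Type) (Inv : nat -> T -> Prop) (f : nat -> T -> T) (N : nat)
    (x : T) :
  Inv 0 x -> (forall k y, k < N -> Inv k y -> Inv k.+1 (f k y)) ->
  Inv N (iteri N f x).
Proof.
move=> I0 IS; suff: forall k, k <= N -> Inv k (iteri k f x) by apply.
elim=> [//|k IHk] kN /=; apply: IS => //; exact/IHk/ltnW.
Qed.

Lemma eval_iv c s x : x \notin wiv c -> iv (eval c s) x = iv s x.
Proof.
elim: c s => //=.
- by move=> y e s; rewrite inE /upd => /negPf ->.
- by move=> c1 IH1 c2 IH2 s; rewrite mem_cat negb_or => /andP[h1 h2]; rewrite IH2 ?IH1.
- move=> e1 e2 c1 IH1 c2 IH2 s; rewrite mem_cat negb_or => /andP[h1 h2].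
  by case: ifP => _; rewrite ?IH2 ?IH1.
- move=> e1 e2 c1 IH1 c2 IH2 s; rewrite mem_cat negb_or => /andP[h1 h2].
  by case: ifP => _; rewrite ?IH2 ?IH1.
- move=> y z c IH s; rewrite inE negb_or => /andP[xy h].
  apply: (@iteri_ind _ (fun _ s' => iv s' x = iv s x)) => // k s' _ <-.
  by rewrite IH //= /upd (negPf xy).
Qed.

Lemma eval_ia c s j : j \notin wia c -> ia (eval c s) j = ia s j.
Proof.
elim: c s => //=.
- by move=> y e1 e2 s; rewrite inE /put => /negPf ->.
- by move=> c1 IH1 c2 IH2 s; rewrite mem_cat negb_or => /andP[h1 h2]; rewrite IH2 ?IH1.
- move=> e1 e2 c1 IH1 c2 IH2 s; rewrite mem_cat negb_or => /andP[h1 h2].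
  by case: ifP => _; rewrite ?IH2 ?IH1.
- move=> e1 e2 c1 IH1 c2 IH2 s; rewrite mem_cat negb_or => /andP[h1 h2].
  by case: ifP => _; rewrite ?IH2 ?IH1.
- move=> y z c IH s h.
  apply: (@iteri_ind _ (fun _ s' => ia s' j = ia s j)) => // k s' _ <-.
  by rewrite IH.
Qed.

Lemma eval_ra c s j : j \notin wra c -> ra (eval c s) j = ra s j.
Proof.
elim: c s => //=.
- by move=> y e1 e2 s; rewrite inE /put => /negPf ->.
- by move=> c1 IH1 c2 IH2 s; rewrite mem_cat negb_or => /andP[h1 h2]; rewrite IH2 ?IH1.
- move=> e1 e2 c1 IH1 c2 IH2 s; rewrite mem_cat negb_or => /andP[h1 h2].
  by case: ifP => _; rewrite ?IH2 ?IH1.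
- move=> e1 e2 c1 IH1 c2 IH2 s; rewrite mem_cat negb_or => /andP[h1 h2].
  by case: ifP => _; rewrite ?IH2 ?IH1.
- move=> y z c IH s h.
  apply: (@iteri_ind _ (fun _ s' => ra s' j = ra s j)) => // k s' _ <-.
  by rewrite IH.
Qed.

(* The bounds of all loops are read off one environment [V], which is legitimate
   when no loop bound is ever modified. *)
Fixpoint scost (c : cmd) (V : nat -> nat) : nat :=
  match c with
  | ISet x e => isize e + 2
  | RSet x e => rsize e + 2
  | IPut j e1 e2 => isize e1 + (if j is 0 then 4 else 7) + isize e2 + 1
  | RPut j e1 e2 => isize e1 + (if j is 0 then 4 else 7) + rsize e2 + 1
  | Seq c1 c2 => scost c1 V + scost c2 V
  | IfI e1 e2 c1 c2 => isize e1 + isize e2 + 2 + scost c1 V + scost c2 V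
  | IfR e1 e2 c1 c2 => rsize e1 + rsize e2 + 2 + scost c1 V + scost c2 V
  | For x y c1 => 4 + V y * (6 + scost c1 V)
  end.

Fixpoint bounds (c : cmd) : seq nat :=
  match c with
  | ISet _ _ | RSet _ _ | IPut _ _ _ | RPut _ _ _ => [::]
  | Seq c1 c2 | IfI _ _ c1 c2 | IfR _ _ c1 c2 => bounds c1 ++ bounds c2
  | For _ y c1 => y :: bounds c1
  end.

(** A bound that is never written has its value in [V] each time its loop is entered, however deeply
    nested. Conditionals are charged for both branches. *)
Lemma cost_scost_gen c s V :
  {in bounds c, iv s =1 V} -> ~~ has (mem (wiv c)) (bounds c) ->
  cost c s <= scost c V.
Proof.
have aux c1 c2 s' : {in bounds (Seq c1 c2), iv s' =1 V} ->
    ~~ has (mem (wiv (Seq c1 c2))) (bounds (Seq c1 c2)) ->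
    [/\ {in bounds c1, iv s' =1 V}, ~~ has (mem (wiv c1)) (bounds c1),
     {in bounds c2, iv s' =1 V} & ~~ has (mem (wiv c2)) (bounds c2)] /\
     {in bounds c2, iv (eval c1 s') =1 V}.
  move=> /= h /hasPn g.
  have h2 : {in bounds c2, iv s' =1 V}.
    by move=> x xb; apply: h; rewrite mem_cat xb orbT.
  split; first split=> //.
  - by move=> x xb; apply: h; rewrite mem_cat xb.
  - apply/hasPn => x xb; apply/negP => /= xw.
    by move: (g x); rewrite /= !mem_cat xb xw => /(_ isT).
  - apply/hasPn => x xb; apply/negP => /= xw.
    by move: (g x); rewrite /= !mem_cat xb xw !orbT => /(_ isT).
  move=> x xb; rewrite eval_iv ?h2 //; apply/negP => xw.
  by move: (g x); rewrite /= !mem_cat xb xw !orbT => /(_ isT).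
elim: c s => //=.
- move=> c1 IH1 c2 IH2 s h g.
  have [[h1 g1 _ g2] h3] := aux c1 c2 s h g.
  by apply: leq_add; [exact: IH1|exact: IH2].
- move=> e1 e2 c1 IH1 c2 IH2 s h g.
  have [[h1 g1 h2 g2] _] := aux c1 c2 s h g.
  by move: (IH1 s h1 g1) (IH2 s h2 g2); case: ifP; lia.
- move=> e1 e2 c1 IH1 c2 IH2 s h g.
  have [[h1 g1 h2 g2] _] := aux c1 c2 s h g.
  by move: (IH1 s h1 g1) (IH2 s h2 g2); case: ifP; lia.
move=> x y c IH s h.
rewrite inE => /norP[/norP[yx yc] /hasPn g].
rewrite -(h y) ?inE ?eqxx //.
rewrite leq_add2l (leq_trans (leq_sum _ (_ : forall k, true -> _ <= 6 + scost c V))) //; last first.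
  by rewrite sum_nat_const card_ord.
move=> k _; rewrite leq_add2l; apply: IH; last first.
  by apply/hasPn => z /g /=; rewrite inE negb_or => /andP[].
move=> z zb; have := g z zb; rewrite /= inE negb_or => /andP[zx zw].
rewrite /upd (negPf zx) -(h z) ?inE ?zb ?orbT //.
apply: (@iteri_ind _ (fun _ s' => iv s' z = iv s z)) => // i s' _ <-.
by rewrite eval_iv //= /upd (negPf zx).
Qed.

Lemma cost_scost c s : ~~ has (mem (wiv c)) (bounds c) -> cost c s <= scost c (iv s).
Proof. exact: cost_scost_gen. Qed.

End Language.

Section Compilation.
Variable R : realType.
Implicit Types (s : state R) (P : program) (c : cmd).

Fixpoint code_at P (l : nat) (code : program) : Prop :=
  if code is a :: code' then
    [/\ l < size P, nth (Jump 0) P l = a & code_at P l.+1 code']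
  else True.

Lemma code_at_cat P l code1 code2 :
  code_at P l (code1 ++ code2) <->
  code_at P l code1 /\ code_at P (l + size code1) code2.
Proof.
elim: code1 l => [|a code1 IH] l /=; first by rewrite addn0; split=> // -[].
rewrite addnS -addSn; split; first by case=> h1 h2 /IH[].
by case=> -[h1 h2 h3] h4; split=> //; apply/IH.
Qed.

Lemma code_at_self P1 code P2 : code_at (P1 ++ code ++ P2) (size P1) code.
Proof.
elim: code P1 => [//|a code IH] P1 /=; split.
- by rewrite !size_cat /=; lia.
- by rewrite nth_cat ltnn subnn.
- by have := IH (rcons P1 a); rewrite size_rcons cat_rcons.
Qed.

Definition straight (a : instr) : bool :=
  match a with Jump _ | IJumpLe _ _ _ | RJumpLe _ _ _ => false | _ => true end.

Definition run (cf : config R) (code : program) : config R :=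
  foldl (fun cf a => exec a cf) cf code.

Lemma run_cat cf code1 code2 : run cf (code1 ++ code2) = run (run cf code1) code2.
Proof. exact: foldl_cat. Qed.

Lemma step_at P (cf : config R) a code :
  code_at P (pc cf) (a :: code) -> step P cf = exec a cf.
Proof. by case=> h1 h2 _; rewrite /step /halted leqNgt h1 h2. Qed.

Lemma iter_run P (cf : config R) code :
  all straight code -> code_at P (pc cf) code ->
  iter (size code) (step P) cf = run cf code.
Proof.
elim: code cf => [//|a code IH] cf /= /andP[sa sc] h.
rewrite -iterS iterSr (step_at (a := a) (code := code)) // IH //.
case: h => _ _; suff -> : pc (exec a cf) = (pc cf).+1 by [].
by case: cf; case: a sa.
Qed.

Lemma iter_run_at P code l l' X F M (W : nat -> R) cf :
  all straight code -> code_at P l code -> l' = l ->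
  run (Config l X F M W) code = cf ->
  iter (size code) (step P) (Config l' X F M W) = cf.
Proof. by move=> h1 h2 -> <-; rewrite iter_run. Qed.

Lemma size_caddr j t : size (caddr j t) = if j is 0 then 4 else 7.
Proof. by case: j. Qed.

Lemma size_ccomp e t : size (ccomp e t) = isize e.
Proof.
elim: e t => //= [j e IH|e1 IH1 e2 IH2|e1 IH1 e2 IH2] t.
- by rewrite !size_cat size_caddr IH /= addnA.
- by rewrite !size_cat IH1 IH2 /= addnA.
- by rewrite !size_cat IH1 IH2 /= addnA.
Qed.

Lemma size_rcomp e t q : size (rcomp e t q) = rsize e.
Proof.
elim: e t q => //= [j e|e1 IH1 e2 IH2] t q.
- by rewrite !size_cat size_caddr size_ccomp /= addnA.
- by rewrite !size_cat IH1 IH2 /= addnA.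
Qed.

Lemma size_comp c t l : size (compile c t l) = csize c.
Proof.
elim: c t l => //=.
- by move=> x e t _; rewrite size_cat size_ccomp.
- by move=> x e t _; rewrite size_cat size_rcomp.
- by move=> j e1 e2 t _; rewrite !size_cat !size_ccomp size_caddr /=; lia.
- by move=> j e1 e2 t _; rewrite !size_cat size_ccomp size_rcomp size_caddr /=; lia.
- by move=> c1 IH1 c2 IH2 t l; rewrite size_cat IH1 IH2.
- move=> e1 e2 c1 IH1 c2 IH2 t l.
  by rewrite !size_cat /= !size_cat /= !size_ccomp IH1 IH2; lia.
- move=> e1 e2 c1 IH1 c2 IH2 t l.
  by rewrite !size_cat /= !size_cat /= !size_rcomp IH1 IH2; lia.
- by move=> x y c IH t l; rewrite size_cat IH /=; lia.
Qed.

Lemma straight_caddr j t : all straight (caddr j t).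
Proof. by case: j. Qed.

Lemma straight_ccomp e t : all straight (ccomp e t).
Proof.
elim: e t => //= [j e IH|e1 IH1 e2 IH2|e1 IH1 e2 IH2] t.
- by rewrite !all_cat IH straight_caddr.
- by rewrite !all_cat IH1 IH2.
- by rewrite !all_cat IH1 IH2.
Qed.

Lemma straight_rcomp e t q : all straight (rcomp e t q).
Proof.
elim: e t q => //= [j e|e1 IH1 e2 IH2] t q.
- by rewrite !all_cat straight_ccomp straight_caddr.
- by rewrite !all_cat IH1 IH2.
Qed.

(** The arrays other than 0 are interleaved from [b] on, so none of them needs a size: the distance
    from [b] modulo [stride] tells the array, the quotient tells the index. *)
Definition addr (b j x : nat) : nat :=
  if j is j'.+1 then b + x * stride + j' else minn x b.-1.

Definition mem_ok (T : Type) (b : nat) (A : nat -> nat -> T) (M : nat -> T) :=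
  (forall x, x < b -> M x = A 0 x) /\
  (forall j x, j < stride -> M (b + x * stride + j) = A j.+1 x).

Lemma mem_ok_load (T : Type) b (A : nat -> nat -> T) M j x :
  mem_ok b A M -> 0 < b -> j <= stride -> M (addr b j x) = A j (cell b j x).
Proof.
case=> h0 h1 b_gt0; case: j => [|j] jP /=; last exact: h1.
by apply: h0; rewrite -[X in _ < X](prednK b_gt0) ltnS geq_minr.
Qed.

Lemma mem_ok_store (T : Type) b (A : nat -> nat -> T) M j x v :
  mem_ok b A M -> 0 < b -> j <= stride ->
  mem_ok b (put A j (cell b j x) v) (upd M (addr b j x) v).
Proof.
rewrite /mem_ok /addr /stride => -[h0 h1] b_gt0 jP; split=> [y yb|i y iP].
  rewrite /upd /put; case: j jP => [|j] jP /=.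
    by rewrite /upd; case: eqP => // _; exact: h0.
  by rewrite ifN ?h0 //; lia.
rewrite /upd /put; case: j jP => [|j] jP /=.
  by rewrite ifN ?h1 //; lia.
rewrite eqSS /upd; case: (eqVneq i j) => [->|ij].
  by case: (eqVneq y x) => [->|yx]; [rewrite eqxx|rewrite ifN ?h1 ?(negPf yx) //; lia].
by rewrite ifN ?h1 //; apply/eqP => h; have: i %% 16 = j %% 16; lia.
Qed.

Lemma caddr_ok j t q X F M (W : nat -> R) b :
  0 < t -> X 0 = b ->
  exists X', [/\ run (Config q X F M W) (caddr j t)
                 = Config (q + size (caddr j t)) X' F M W,
    X' t = addr b j (X t) & forall i, i < t -> X' i = X i].
Proof.
move=> t_gt0 Xb; case: j => [|j].
  eexists; split; [by rewrite /= addnS addnS addnS addnS addn0; reflexivity| |].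
    by rewrite /upd /= eqxx; repeat (case: eqP => //= ?; try lia).
  by move=> i it; rewrite /upd; repeat (case: eqP => //= ?; try lia).
eexists; split; [by rewrite /= !addnS addn0; reflexivity| |].
  rewrite /upd /= eqxx /stride.
  by repeat (case: eqP => //= ?; try lia).
by move=> i it; rewrite /upd; repeat (case: eqP => //= ?; try lia).
Qed.

(** Registers below [t] survive, which is why the second operand can be evaluated in [t.+1] while
    the first one waits in [t]. *)
Lemma ccomp_ok e t q X F M (W : nat -> R) s b :
  iwf e -> nints <= t -> 0 < b -> iarrfree e || (iv s 0 == b) ->
  (forall i, i < nints -> X i = iv s i) -> mem_ok b (ia s) M ->
  exists X', [/\ run (Config q X F M W) (ccomp e t)
                 = Config (q + isize e) X' F M W,
    X' t = ieval e s & forall i, i < t -> X' i = X i].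
Proof.
elim: e t q X => [k|x|j e IH|e1 IH1 e2 IH2|e1 IH1 e2 IH2] t q X /= we tP b_gt0 hb hX hM.
- exists (upd X t k); split; first by rewrite addn1.
    by rewrite /upd eqxx.
  by move=> i it; rewrite /upd; case: eqP => // ?; lia.
- exists (upd (upd X t 0) t (X x)); split.
  + rewrite addnS addn1; congr Config.
    by rewrite /upd eqxx addn0; case: eqP => // ?; lia.
  + by rewrite /upd eqxx hX.
  + by move=> i it; rewrite /upd; case: eqP => // ?; lia.
- move/andP: we => [jP we].
  have [|X1 [E1 V1 P1]] := IH t q X we tP b_gt0 _ hX hM; first by rewrite hb orbT.
  have X1b : X1 0 = b by rewrite P1 ?hX //; [exact/eqP|rewrite /nints in tP; lia].
  have [|X2 [E2 V2 P2]] := @caddr_ok j t (q + isize e) X1 F M W b _ X1b.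
    by rewrite /nints in tP; lia.
  exists (upd X2 t (M (X2 t))); split.
  + rewrite !run_cat E1 E2 /= size_caddr; congr Config; lia.
  + by rewrite /upd eqxx V2 V1 (mem_ok_load _ hM) // (eqP hb).
  + by move=> i it; rewrite /upd; case: eqP => [|_]; [lia|rewrite P2 // P1].
- move/andP: we => [we1 we2].
  have [|X1 [E1 V1 P1]] := IH1 t q X we1 tP b_gt0 _ hX hM.
    by case/orP: hb => [/andP[->]//|->]; rewrite orbT.
  have [|||X2 [E2 V2 P2]] := IH2 t.+1 (q + isize e1) X1 we2 _ b_gt0 _ _ hM.
  + by lia.
  + by case/orP: hb => [/andP[? ->]//|->]; rewrite orbT.
  + by move=> i ih; rewrite P1 ?hX //; lia.
  exists (upd X2 t (X2 t + X2 t.+1)); split.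
  + rewrite !run_cat E1 E2 /=; congr Config; lia.
  + by rewrite /upd eqxx V2 P2 // V1.
  + by move=> i it; rewrite /upd; case: eqP => [|_]; [lia|rewrite P2 ?P1 //; lia].
- move/andP: we => [we1 we2].
  have [|X1 [E1 V1 P1]] := IH1 t q X we1 tP b_gt0 _ hX hM.
    by case/orP: hb => [/andP[->]//|->]; rewrite orbT.
  have [|||X2 [E2 V2 P2]] := IH2 t.+1 (q + isize e1) X1 we2 _ b_gt0 _ _ hM.
  + by lia.
  + by case/orP: hb => [/andP[? ->]//|->]; rewrite orbT.
  + by move=> i ih; rewrite P1 ?hX //; lia.
  exists (upd X2 t (X2 t - X2 t.+1)); split.
  + rewrite !run_cat E1 E2 /=; congr Config; lia.
  + by rewrite /upd eqxx V2 P2 // V1.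
  + by move=> i it; rewrite /upd; case: eqP => [|_]; [lia|rewrite P2 ?P1 //; lia].
Qed.

Lemma rcomp_ok e t p q X F M (W : nat -> R) s b :
  rwf e -> nints <= t -> nreals <= p -> 0 < b -> iv s 0 = b ->
  (forall i, i < nints -> X i = iv s i) ->
  (forall i, i < nreals -> F i = rv s i) ->
  mem_ok b (ia s) M -> mem_ok b (ra s) W ->
  exists X' F', [/\ run (Config q X F M W) (rcomp e t p)
                    = Config (q + rsize e) X' F' M W,
    F' p = reval e s, (forall i, i < t -> X' i = X i) &
    forall i, i < p -> F' i = F i].
Proof.
elim: e p q X F => [x|j e|e1 IH1 e2 IH2] p q X F /= we tP pP b_gt0 hb hX hF hM hW.
- exists X, (upd (upd F p 0%R) p (F x)); split=> //.
  + rewrite addnS addn1; congr Config.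
    by rewrite /upd eqxx addr0; case: eqP => // ?; lia.
  + by rewrite /upd eqxx hF.
  + by move=> i ip; rewrite /upd; case: eqP => // ?; lia.
- move/andP: we => [jP we].
  have [|X1 [E1 V1 P1]] := @ccomp_ok e t q X F M W s b we tP b_gt0 _ hX hM.
    by rewrite hb eqxx orbT.
  have X1b : X1 0 = b by rewrite P1 ?hX //; rewrite /nints in tP; lia.
  have [|X2 [E2 V2 P2]] := @caddr_ok j t (q + isize e) X1 F M W b _ X1b.
    by rewrite /nints in tP; lia.
  exists X2, (upd F p (W (X2 t))); split.
  + rewrite !run_cat E1 E2 /= size_caddr; congr Config; lia.
  + by rewrite /upd eqxx V2 V1 (mem_ok_load _ hW) // hb.
  + by move=> i it; rewrite P2 // P1.
  + by move=> i ip; rewrite /upd; case: eqP => // ?; lia.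
- move/andP: we => [we1 we2].
  have [X1 [F1 [E1 V1 P1 Q1]]] := IH1 p q X F we1 tP pP b_gt0 hb hX hF hM hW.
  have [|||X2 [F2 [E2 V2 P2 Q2]]] :=
    IH2 p.+1 (q + rsize e1) X1 F1 we2 tP _ b_gt0 hb _ _ hM hW.
  + by lia.
  + by move=> i ih; rewrite P1 ?hX //; lia.
  + by move=> i ih; rewrite Q1 ?hF //; lia.
  exists X2, (upd F2 p (F2 p + F2 p.+1)%R); split.
  + rewrite !run_cat E1 E2 /=; congr Config; lia.
  + by rewrite /upd eqxx V2 Q2 // V1.
  + by move=> i it; rewrite P2 ?P1.
  + by move=> i ip; rewrite /upd; case: eqP => [|_]; [lia|rewrite Q2 ?Q1 //; lia].
Qed.

Definition rep (b : nat) s (X : nat -> nat) (F : nat -> R) M (W : nat -> R) :=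
  [/\ forall i, i < nints -> X i = iv s i, forall i, i < nreals -> F i = rv s i,
      mem_ok b (ia s) M & mem_ok b (ra s) W].

Lemma rep_tmp b s X F M W t X' :
  rep b s X F M W -> nints <= t -> (forall i, i < t -> X' i = X i) ->
  rep b s X' F M W.
Proof. by case=> hX hF hM hW tP h; split=> // i ih; rewrite h ?hX //; lia. Qed.

Lemma rep_rtmp b s X F M W F' :
  rep b s X F M W -> (forall i, i < nreals -> F' i = F i) -> rep b s X F' M W.
Proof. by case=> hX hF hM hW h; split=> // i ih; rewrite h ?hF. Qed.

Lemma iter_trans (T : Type) (f : T -> T) k1 k2 k x y z :
  iter k1 f x = y -> iter k2 f y = z -> k = k2 + k1 -> iter k f x = z.
Proof. by move=> h1 h2 ->; rewrite iterD h1 h2. Qed.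

(** Here [b] is a parameter rather than the current value of variable 0. For array-free code it may
    be the base address that the code is about to compute; all other code must find it in variable 0
    and leave it there. *)
Theorem comp_ok P c t l s b X F M W :
  wf c -> arrfree c || (iv s 0 == b) && (0 \notin wiv c) ->
  nints <= t -> code_at P l (compile c t l) -> 0 < b -> rep b s X F M W ->
  exists X' F' M' W',
    [/\ iter (cost c s) (step P) (Config l X F M W)
        = Config (l + csize c) X' F' M' W',
        rep b (eval c s) X' F' M' W' &
        forall i, nints <= i < t -> X' i = X i].
Proof.
elim: c t l s X F M W.
- move=> x e t l s X F M W /= /andP[xP we] hb tP hP b_gt0 hrep; have [hX hF hM hW] := hrep.
  have [|X1 [E1 V1 P1]] := @ccomp_ok e t l X F M W s b we tP b_gt0 _ hX hM.
    by case/orP: hb => [->//|/andP[->]]; rewrite orbT.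
  exists (upd (upd X1 t.+1 0) x (X1 t)), F, M, W; split.
  + have <- : size (ccomp e t ++ [:: IConst t.+1 0; IAdd x t t.+1]) = isize e + 2.
      by rewrite size_cat size_ccomp.
    apply: (iter_run_at (l := l)); rewrite ?all_cat ?straight_ccomp //.
    rewrite run_cat E1 size_cat size_ccomp /= !addnS addn0; congr Config.
    by rewrite /upd eqxx addn0; case: eqP => // ?; lia.
  + split=> // i ih; rewrite /= /upd V1; case: eqP => // _.
    by case: eqP => [|_]; [lia|rewrite P1 ?hX //; lia].
  + move=> i ih; rewrite /upd; case: eqP => [|_]; first lia.
    by case: eqP => [|_]; [lia|rewrite P1 //; lia].
- move=> x e t l s X F M W /= /andP[xP we] /andP[/eqP hb _] tP hP b_gt0 hrep.
  have [hX hF hM hW] := hrep.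
  have [X1 [F1 [E1 V1 P1 Q1]]] :=
    @rcomp_ok e t nreals l X F M W s b we tP (leqnn _) b_gt0 hb hX hF hM hW.
  exists X1, (upd (upd F1 nreals.+1 0%R) x (F1 nreals)), M, W; split.
  + have <- : size (rcomp e t nreals ++ [:: RConst nreals.+1 0; RAdd x nreals nreals.+1])
        = rsize e + 2 by rewrite size_cat size_rcomp.
    apply: (iter_run_at (l := l)); rewrite ?all_cat ?straight_rcomp //.
    rewrite run_cat E1 size_cat size_rcomp /= !addnS addn0; congr Config.
    by rewrite /upd eqxx addr0.
  + split=> // i ih; first by rewrite P1 ?hX //; lia.
    rewrite /= /upd V1; case: eqP => // _.
    by case: eqP => [|_]; [lia|rewrite Q1 ?hF //; lia].
  + by move=> i ih; rewrite P1 //; lia.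
- move=> j e1 e2 t l s X F M W /= /and3P[jP we1 we2] /andP[/eqP hb _] tP hP b_gt0 hrep.
  have [hX hF hM hW] := hrep.
  have [|X1 [E1 V1 P1]] := @ccomp_ok e1 t l X F M W s b we1 tP b_gt0 _ hX hM.
    by rewrite hb eqxx orbT.
  have X1b : X1 0 = b by rewrite P1 ?hX //; rewrite /nints in tP; lia.
  have [|X2 [E2 V2 P2]] := @caddr_ok j t (l + isize e1) X1 F M W b _ X1b.
    by rewrite /nints in tP; lia.
  have [|||X3 [E3 V3 P3]] := @ccomp_ok e2 t.+1
    (l + isize e1 + size (caddr j t)) X2 F M W s b we2 _ b_gt0 _ _ hM.
  + lia.
  + by rewrite hb eqxx orbT.
  + by move=> i ih; rewrite P2 ?P1 ?hX //; lia.
  exists X3, F, (upd M (X3 t) (X3 t.+1)), W; split.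
  + have <- : size (ccomp e1 t ++ caddr j t ++ ccomp e2 t.+1 ++ [:: IStore t t.+1]) =
        isize e1 + (if j is 0 then 4 else 7) + isize e2 + 1.
      by rewrite !size_cat !size_ccomp size_caddr /= !addnA.
    apply: (iter_run_at (l := l)) => //.
      by rewrite !all_cat !straight_ccomp straight_caddr.
    rewrite !run_cat E1 E2 E3 !size_cat !size_ccomp size_caddr /= -!addnS !addnA.
    by congr Config; lia.
  + split=> //; first by move=> i ih; rewrite P3 ?P2 ?P1 ?hX //; lia.
    by rewrite /= P3 // V2 V3 V1 hb; exact: mem_ok_store.
  + by move=> i ih; rewrite P3 ?P2 ?P1 //; lia.
- move=> j e1 e2 t l s X F M W /= /and3P[jP we1 we2] /andP[/eqP hb _] tP hP b_gt0 hrep.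
  have [hX hF hM hW] := hrep.
  have [|X1 [E1 V1 P1]] := @ccomp_ok e1 t l X F M W s b we1 tP b_gt0 _ hX hM.
    by rewrite hb eqxx orbT.
  have X1b : X1 0 = b by rewrite P1 ?hX //; rewrite /nints in tP; lia.
  have [|X2 [E2 V2 P2]] := @caddr_ok j t (l + isize e1) X1 F M W b _ X1b.
    by rewrite /nints in tP; lia.
  have [||X3 [F3 [E3 V3 P3 Q3]]] := @rcomp_ok e2 t.+1 nreals
    (l + isize e1 + size (caddr j t)) X2 F M W s b we2 _ (leqnn _) b_gt0 hb _ hF hM hW.
  + lia.
  + by move=> i ih; rewrite P2 ?P1 ?hX //; lia.
  exists X3, F3, M, (upd W (X3 t) (F3 nreals)); split.
  + have <- : size (ccomp e1 t ++ caddr j t ++ rcomp e2 t.+1 nreals ++ [:: RStore t nreals]) =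
        isize e1 + (if j is 0 then 4 else 7) + rsize e2 + 1.
      by rewrite !size_cat size_ccomp size_rcomp size_caddr /= !addnA.
    apply: (iter_run_at (l := l)) => //.
      by rewrite !all_cat straight_ccomp straight_rcomp straight_caddr.
    rewrite !run_cat E1 E2 E3 !size_cat size_ccomp size_rcomp size_caddr /= -!addnS !addnA.
    by congr Config; lia.
  + split=> //.
    * by move=> i ih; rewrite P3 ?P2 ?P1 ?hX //; lia.
    * by move=> i ih; rewrite Q3 ?hF.
    * by rewrite /= P3 // V2 V3 V1 hb; exact: mem_ok_store.
  + by move=> i ih; rewrite P3 ?P2 ?P1 //; lia.
- move=> c1 IH1 c2 IH2 t l s X F M W /= /andP[w1 w2] hb tP.
  move/code_at_cat => -[h1]; rewrite size_comp => h2 b_gt0 hrep.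
  have [|X1 [F1 [M1 [W1 [E1 R1 P1]]]]] := IH1 t l s X F M W w1 _ tP h1 b_gt0 hrep.
    case/orP: hb => [/andP[->]//|/andP[->]].
    by rewrite mem_cat negb_or => /andP[-> _]; rewrite orbT.
  have [|X2 [F2 [M2 [W2 [E2 R2 P2]]]]] :=
    IH2 t (l + csize c1) (eval c1 s) X1 F1 M1 W1 w2 _ tP h2 b_gt0 R1.
    case/orP: hb => [/andP[_ ->]//|/andP[/eqP hb]].
    rewrite mem_cat negb_or => /andP[hw1 ->]; rewrite eval_iv //.
    by rewrite hb eqxx orbT.
  exists X2, F2, M2, W2; split=> //.
  + by rewrite addnA; apply: (iter_trans E1 E2); rewrite addnC.
  + by move=> i ih; rewrite P2 ?P1.
- move=> e1 e2 c1 IH1 c2 IH2 t l s X F M W /= /and4P[we1 we2 w1 w2] hb tP.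
  set l2 := l + _; set l1 := l2 + _ + 1.
  rewrite catA => /code_at_cat[hc] [g1 g2] /code_at_cat[].
  have sz : size (ccomp e1 t ++ ccomp e2 t.+1) = isize e1 + isize e2.
    by rewrite size_cat !size_ccomp.
  have l2E : l + (isize e1 + isize e2) + 1 = l2 by rewrite /l2; lia.
  move: g1 g2; rewrite sz => g1 g2; rewrite -addn1 l2E size_comp /= -(addn1 (l2 + _)) -/l1.
  move=> h2 [k1 k2 h1] b_gt0 hrep.
  have [hX hF hM hW] := hrep.
  have hb1 : iarrfree e1 || (iv s 0 == b).
    by case/orP: hb => [/and4P[->]//|/andP[-> _]]; rewrite orbT.
  have hb2 : iarrfree e2 || (iv s 0 == b).
    by case/orP: hb => [/and4P[_ ->]//|/andP[-> _]]; rewrite orbT.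
  have [X1 [E1 V1 P1]] := @ccomp_ok e1 t l X F M W s b we1 tP b_gt0 hb1 hX hM.
  have [||X2 [E2 V2 P2]] := @ccomp_ok e2 t.+1 (l + isize e1) X1 F M W s b we2 _ b_gt0 hb2 _ hM.
  + lia.
  + by move=> i ih; rewrite P1 ?hX //; lia.
  have E12 : iter (isize e1 + isize e2) (step P) (Config l X F M W)
      = Config (l + (isize e1 + isize e2)) X2 F M W.
    rewrite -sz; apply: (iter_run_at (l := l)) => //.
      by rewrite all_cat !straight_ccomp.
    by rewrite run_cat E1 E2 -addnA size_cat !size_ccomp.
  have R2 : rep b s X2 F M W.
    by apply: (rep_tmp hrep tP) => i ih; rewrite P2 ?P1 //; lia.
  have P12 i : nints <= i < t -> X2 i = X i by move=> ih; rewrite P2 ?P1 //; lia.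
  have EJ : step P (Config (l + (isize e1 + isize e2)) X2 F M W)
      = Config (if ieval e1 s <= ieval e2 s then l1 else l2) X2 F M W.
    rewrite (@step_at _ _ (IJumpLe t t.+1 l1) [::]) //=.
    by rewrite P2 // V1 V2 -addn1 l2E.
  have E3 : iter (isize e1 + isize e2 + 1) (step P) (Config l X F M W)
      = Config (if ieval e1 s <= ieval e2 s then l1 else l2) X2 F M W.
    by apply: (iter_trans E12 (k2 := 1)); [exact: EJ|rewrite addnC].
  case: ifP E3 => cmp E3.
    have [|X3 [F3 [M3 [W3 [E4 R4 P4]]]]] := IH1 t l1 s X2 F M W w1 _ tP h1 b_gt0 R2.
      case/orP: hb => [/and4P[_ _ -> _]//|/andP[->]].
      by rewrite mem_cat negb_or => /andP[-> _]; rewrite orbT.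
    exists X3, F3, M3, W3; split=> //.
    + have <- : l1 + csize c1 = l + (isize e1 + isize e2 + 1 + csize c2 + 1 + csize c1).
        by rewrite /l1 /l2; lia.
      by apply: (iter_trans E3 E4); rewrite addnC.
    + by move=> i ih; rewrite P4 ?P12.
  have [|X3 [F3 [M3 [W3 [E4 R4 P4]]]]] := IH2 t l2 s X2 F M W w2 _ tP h2 b_gt0 R2.
    case/orP: hb => [/and4P[_ _ _ ->]//|/andP[->]].
    by rewrite mem_cat negb_or => /andP[_ ->]; rewrite orbT.
  exists X3, F3, M3, W3; split=> //.
  + have E5 : iter (cost c2 s).+1 (step P) (Config l2 X2 F M W)
        = Config (l1 + csize c1) X3 F3 M3 W3.
      by rewrite iterS E4 (@step_at _ _ (Jump (l1 + csize c1)) [::]) //; split=> //; move: k1; rewrite /l1 addn1.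
    have <- : l1 + csize c1 = l + (isize e1 + isize e2 + 1 + csize c2 + 1 + csize c1).
      by rewrite /l1 /l2; lia.
    by apply: (iter_trans E3 E5); rewrite addnC.
  + by move=> i ih; rewrite P4 ?P12.
- move=> e1 e2 c1 IH1 c2 IH2 t l s X F M W /= /and4P[we1 we2 w1 w2] /andP[/eqP hb hw] tP.
  set l2 := l + _; set l1 := l2 + _ + 1.
  rewrite catA => /code_at_cat[hc] [g1 g2] /code_at_cat[].
  have sz : size (rcomp e1 t nreals ++ rcomp e2 t nreals.+1) = rsize e1 + rsize e2.
    by rewrite size_cat !size_rcomp.
  have l2E : l + (rsize e1 + rsize e2) + 1 = l2 by rewrite /l2; lia.
  move: g1 g2; rewrite sz => g1 g2; rewrite -addn1 l2E size_comp /= -(addn1 (l2 + _)) -/l1.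
  move=> h2 [k1 k2 h1] b_gt0 hrep.
  move: hw; rewrite mem_cat negb_or => /andP[hw1 hw2].
  have [hX hF hM hW] := hrep.
  have [X1 [F1 [E1 V1 P1 Q1]]] :=
    @rcomp_ok e1 t nreals l X F M W s b we1 tP (leqnn _) b_gt0 hb hX hF hM hW.
  have [||X2 [F2 [E2 V2 P2 Q2]]] :=
    @rcomp_ok e2 t nreals.+1 (l + rsize e1) X1 F1 M W s b we2 tP (leqnSn _) b_gt0 hb _ _ hM hW.
  + by move=> i ih; rewrite P1 ?hX //; lia.
  + by move=> i ih; rewrite Q1 ?hF //; lia.
  have E12 : iter (rsize e1 + rsize e2) (step P) (Config l X F M W)
      = Config (l + (rsize e1 + rsize e2)) X2 F2 M W.
    rewrite -sz; apply: (iter_run_at (l := l)) => //.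
      by rewrite all_cat !straight_rcomp.
    by rewrite run_cat E1 E2 -addnA size_cat !size_rcomp.
  have R2 : rep b s X2 F2 M W.
    apply: (@rep_rtmp _ _ _ F).
      by apply: (rep_tmp hrep tP) => i ih; rewrite P2 ?P1 //; lia.
    by move=> i ih; rewrite Q2 ?Q1 //; lia.
  have P12 i : nints <= i < t -> X2 i = X i by move=> ih; rewrite P2 ?P1 //; lia.
  have EJ : step P (Config (l + (rsize e1 + rsize e2)) X2 F2 M W)
      = Config (if (reval e1 s <= reval e2 s)%R then l1 else l2) X2 F2 M W.
    rewrite (@step_at _ _ (RJumpLe nreals nreals.+1 l1) [::]) //.
    by rewrite /exec Q2 // V1 V2 -addn1 l2E.
  have E3 : iter (rsize e1 + rsize e2 + 1) (step P) (Config l X F M W)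
      = Config (if (reval e1 s <= reval e2 s)%R then l1 else l2) X2 F2 M W.
    by apply: (iter_trans E12 (k2 := 1)); [exact: EJ|rewrite addnC].
  case: ifP E3 => cmp E3.
    have [|X3 [F3 [M3 [W3 [E4 R4 P4]]]]] := IH1 t l1 s X2 F2 M W w1 _ tP h1 b_gt0 R2.
      by rewrite hb eqxx hw1 orbT.
    exists X3, F3, M3, W3; split=> //.
    + have <- : l1 + csize c1 = l + (rsize e1 + rsize e2 + 1 + csize c2 + 1 + csize c1).
        by rewrite /l1 /l2; lia.
      by apply: (iter_trans E3 E4); rewrite addnC.
    + by move=> i ih; rewrite P4 ?P12.
  have [|X3 [F3 [M3 [W3 [E4 R4 P4]]]]] := IH2 t l2 s X2 F2 M W w2 _ tP h2 b_gt0 R2.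
    by rewrite hb eqxx hw2 orbT.
  exists X3, F3, M3, W3; split=> //.
  + have E5 : iter (cost c2 s).+1 (step P) (Config l2 X2 F2 M W)
        = Config (l1 + csize c1) X3 F3 M3 W3.
      by rewrite iterS E4 (@step_at _ _ (Jump (l1 + csize c1)) [::]) //; split=> //; move: k1; rewrite /l1 addn1.
    have <- : l1 + csize c1 = l + (rsize e1 + rsize e2 + 1 + csize c2 + 1 + csize c1).
      by rewrite /l1 /l2; lia.
    by apply: (iter_trans E3 E5); rewrite addnC.
  + by move=> i ih; rewrite P4 ?P12.
- move=> x y c IH t l s X F M W /= /and3P[xP yP wc] hb tP hP b_gt0 hrep.
  have [hX hF hM hW] := hrep.
  case: hP => g0 e0 [g1 e1 [g2 e2 [g3 e3 [g4 e4 [g5 e5]]]]].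
  have l6 : l.+1.+1.+1.+1.+1.+1 = l + 6 by rewrite !addnS addn0.
  move/code_at_cat => -[]; rewrite size_comp l6 => hc [g6 e6 [g7 e7 [g8 e8 _]]].
  have st l' a Y (G : nat -> R) N U : l' < size P -> nth (Jump 0) P l' = a ->
      step P (Config l' Y G N U) = exec a (Config l' Y G N U).
    by move=> h1 h2; rewrite /step /halted leqNgt /= h1 h2.
  pose f k s1 := eval c (set_iv s1 x k).
  (* [K k] is the time of the test that opens round [k]. Counter and bound are kept in [t] and
     [t.+1], out of reach of the body, which is compiled from [t.+2] on; hence the bound is read
     only once, as in [iteri]. *)
  pose K k := 3 + \sum_(i < k) (6 + cost c (set_iv (iteri i f s) x i)).
  have hbk k : arrfree c || (iv (set_iv (iteri k f s) x k) 0 == b) && (0 \notin wiv c).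
    case/orP: hb => [->//|/andP[/eqP hb]].
    rewrite inE negb_or => /andP[x0 cw]; rewrite cw /= /upd (negPf x0).
    suff -> : iv (iteri k f s) 0 = b by rewrite eqxx orbT.
    by elim: k => [//|k IHk] /=; rewrite eval_iv //= /upd (negPf x0).
  have loop k : k <= iv s y -> exists X' F' M' W',
    [/\ iter (K k) (step P) (Config l X F M W) = Config (l + 3) X' F' M' W',
        rep b (iteri k f s) X' F' M' W', X' t = k, X' t.+1 = iv s y &
        forall i, nints <= i < t -> X' i = X i].
    elim: k => [_|k IHk kN].
      rewrite /K big_ord0 addn0 /=.
      eexists _, F, M, W; split.
      + by rewrite (st _ _ _ _ _ _ g0 e0) /= (st _ _ _ _ _ _ g1 e1) /= (st _ _ _ _ _ _ g2 e2) /= -addn3; reflexivity.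
      + apply: (rep_tmp hrep tP) => i it; rewrite /upd.
        by repeat (case: eqP => [|_]; first lia).
      + by rewrite /upd; repeat (case: eqP => //= ?; try lia).
      + rewrite /upd eqxx -hX //.
        by repeat (case: eqP => //= ?; try lia).
      + by move=> i ih; rewrite /upd; repeat (case: eqP => [|_]; first lia).
    have [X1 [F1 [M1 [W1 [E1 R1 Vt Vn P1]]]]] := IHk (ltnW kN).
    set s1 := iteri k f s in R1 *.
    pose X2 := upd (upd X1 t.+2 0) x k.
    have E2 : iter 3 (step P) (Config (l + 3) X1 F1 M1 W1) = Config (l + 6) X2 F1 M1 W1.
      rewrite /= (addn3 l) (st _ _ _ _ _ _ g3 e3) /= Vt Vn leqNgt kN /=.
      rewrite (st _ _ _ _ _ _ g4 e4) /= (st _ _ _ _ _ _ g5 e5) /= l6; congr Config.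
      rewrite /X2 /upd eqxx addn0.
      by case: (t =P t.+2) => [|_]; [lia|rewrite Vt].
    have R2 : rep b (set_iv s1 x k) X2 F1 M1 W1.
      have [hX1 hF1 hM1 hW1] := R1; split=> // i ih.
      rewrite /= /X2 /upd; case: eqP => // _.
      by case: eqP => [|_]; [lia|exact: hX1].
    have [||X3 [F3 [M3 [W3 [E3 R3 P3]]]]] :=
        IH t.+2 (l + 6) (set_iv s1 x k) X2 F1 M1 W1 wc _ _ hc b_gt0 R2.
    + exact: hbk.
    + lia.
    exists (upd (upd X3 t.+2 1) t k.+1), F3, M3, W3; split.
    + have E4 : iter 3 (step P) (Config (l + 6 + csize c) X3 F3 M3 W3)
          = Config (l + 3) (upd (upd X3 t.+2 1) t k.+1) F3 M3 W3.
        rewrite /= (st _ _ _ _ _ _ g6 e6) /= (st _ _ _ _ _ _ g7 e7) /=.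
        rewrite (st _ _ _ _ _ _ g8 e8) /=; congr Config.
        have X3t : X3 t = k.
          rewrite P3; last lia.
          by rewrite /X2 /upd; repeat (case: eqP => [|_]; first lia).
        rewrite /upd eqxx; case: (t =P t.+2) => [|_]; first lia.
        by rewrite X3t addn1.
      apply: (iter_trans E1 (iter_trans (iter_trans E2 E3 erefl) E4 erefl)).
      by rewrite /K big_ord_recr /= -/s1; lia.
    + apply: (rep_tmp R3 tP) => i it; rewrite /upd.
      by repeat (case: eqP => [|_]; first lia).
    + by rewrite /upd eqxx.
    + rewrite /upd; do 2 (case: eqP => [|_]; first lia).
      rewrite P3; last lia.
      by rewrite /X2 /upd; repeat (case: eqP => [|_]; first lia).
    + move=> i ih; rewrite /upd; do 2 (case: eqP => [|_]; first lia).
      rewrite P3; last lia.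
      rewrite /X2 /upd; do 2 (case: eqP => [|_]; first lia).
      exact: P1.
  have [X1 [F1 [M1 [W1 [E1 R1 Vt Vn P1]]]]] := loop _ (leqnn (iv s y)).
  exists X1, F1, M1, W1; split=> //.
  change (iter (cost (For x y c) s) (step P) (Config l X F M W)
    = Config (l + csize (For x y c)) X1 F1 M1 W1).
  apply: (iter_trans E1 (k2 := 1)); last by rewrite /K /= -/f; lia.
  by rewrite /= (addn3 l) (st _ _ _ _ _ _ g3 e3) /= Vt Vn leqnn.
Qed.

End Compilation.

(** * Large induced forests *)

Section InducedForest.
Variables (R : realType) (adj : rel nat).
Hypotheses (adj_sym : symmetric adj) (adj_irr : irreflexive adj).
Local Open Scope ring_scope.

Definition degree (L : seq nat) (v : nat) : nat := count (adj v) L.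

Definition weight (x : nat) : R := if (x <= 1)%N then 1 else 2 / (x.+1)%:R.

Definition potential (L : seq nat) : R := \sum_(v <- L) weight (degree L v).

Lemma weight_le1 x : weight x <= 1.
Proof.
rewrite /weight; case: leqP => // x1.
by rewrite ler_pdivrMr ?ltr0n // mul1r ler_nat ltnW.
Qed.

Lemma weight_anti x y : (x <= y)%N -> weight y <= weight x.
Proof.
move=> xy; rewrite {2}/weight; case: leqP => x1; first exact: weight_le1.
rewrite /weight leqNgt (leq_trans x1 xy) /=.
by rewrite ler_pM2l // lef_pV2 ?posrE ?ltr0n // ler_nat.
Qed.

(** From degree 1 on the weight is 2 / (y + 1), so the gain is exactly 2 / (x (x + 1)), which is
    smallest at the maximum degree. *)
Lemma weight_pred x D : (2 <= x)%N -> (x <= D)%N ->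
  weight x + 2 / (D%:R * D.+1%:R) <= weight x.-1.
Proof.
move=> x2 xD.
have -> : weight x.-1 = 2 / x%:R.
  rewrite /weight; case: leqP => h; last by rewrite prednK //; lia.
  have -> : x = 2 by lia.
  by rewrite divff ?pnatr_eq0.
have -> : weight x = 2 / x.+1%:R by rewrite /weight leqNgt x2.
have x0 : (0 : R) < x%:R by rewrite ltr0n; lia.
have x0' : x%:R != 0 :> R by rewrite gt_eqF.
have x10 : (0 : R) < x.+1%:R by rewrite ltr0n.
have -> : 2 / x%:R = 2 / x.+1%:R + 2 / (x%:R * x.+1%:R) :> R.
  rewrite -natr1; rewrite -natr1 in x10; field.
  by rewrite x0' gt_eqF //; lra.
rewrite lerD2l ler_pM2l // lef_pV2 ?posrE ?mulr_gt0 ?ltr0n //; try lia.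
by rewrite -!natrM ler_nat; apply: leq_mul.
Qed.

Lemma degree_perm L L' v : perm_eq L L' -> degree L v = degree L' v.
Proof. by rewrite /degree => /permP ->. Qed.

Lemma potential_perm L L' : perm_eq L L' -> potential L = potential L'.
Proof.
move=> h; rewrite /potential (perm_big _ h) /=.
by apply: eq_bigr => v _; rewrite (degree_perm _ h).
Qed.

(** The deleted vertex weighs at most 1, and the others can only lose a neighbour, which does not
    lower their weights. *)
Lemma potential_low L v : potential (v :: L) <= 1 + potential L.
Proof.
rewrite /potential big_cons lerD ?weight_le1 //.
apply: ler_sum => u _; apply: weight_anti; exact: leq_addl.
Qed.

(* The lost weight 2 / (D + 1) of the deleted vertex is recovered from its D
   neighbours, each of which gains at least 2 / (D (D + 1)). *)
Lemma potential_high L v :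
  {in v :: L, forall u, (2 <= degree (v :: L) u <= degree (v :: L) v)%N} ->
  potential (v :: L) <= potential L.
Proof.
move=> h; set D := degree (v :: L) v in h *.
have D2 : (2 <= D)%N by case/andP: (h v (mem_head _ _)).
have DE : D = degree L v by rewrite /D /degree /= adj_irr.
rewrite /potential big_cons -/D.
set c : R := 2 / (D%:R * D.+1%:R).
have -> : weight D = \sum_(u <- L) (adj v u)%:R * c.
  rewrite -mulr_suml -natr_sum.
  have -> : (\sum_(u <- L) adj v u = D)%N.
    by rewrite DE /degree -sum1_count [RHS]big_mkcond /=; apply: eq_bigr => u _; case: adj.
  have D0 : (0 : R) < D%:R by rewrite ltr0n; lia.
  rewrite /weight leqNgt D2 /= /c -natr1; field.
  by rewrite !gt_eqF //; lra.
rewrite -big_split /= [leLHS]big_seq [leRHS]big_seq; apply: ler_sum => u uL.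
have /andP[u2 uD] : (2 <= degree (v :: L) u <= D)%N by apply: h; rewrite inE uL orbT.
have := weight_pred u2 uD; rewrite -/c adj_sym.
rewrite /degree /=; case: (adj u v) => /=; first by rewrite mul1r addrC.
by rewrite mul0r !add0r.
Qed.

(* A line below all the weights which is at 2 / (d + 1) in d.  The tangent of
   2 / (x + 1) in d exceeds the weight 1 of x = 0 if d is close to 2; for d <= 3
   the line through (0, 1), (2, 2 / 3) and (3, 1 / 2) is used instead. *)
Lemma weight_line (d : R) : 2 <= d ->
  exists l : R, forall x : nat, 2 / (d + 1) - l * (x%:R - d) <= weight x.
Proof.
move=> d2; have d1 : 0 < d + 1 by lra.
have [d3|d3] := lerP d 3.
  (* The line is compared with 1 - x / 6. The product (x - 2)(x - 3) is nonnegative for integers,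
     which puts 1 - x / 6 below the weights, and nonpositive for d in [2, 3], which puts it above 2
     / (d + 1) at d. *)
  exists (1 / 6) => x.
  apply: (@le_trans _ _ (1 - x%:R / 6)).
    suff : 2 / (d + 1) <= 1 - d / 6 by lra.
    by rewrite ler_pdivrMr //; nra.
  rewrite /weight; case: leqP => x1; first by have : (0 : R) <= x%:R by []; lra.
  have x0 : (0 : R) < x%:R + 1 by have : (0 : R) <= x%:R by []; lra.
  rewrite -[x.+1%:R]natr1 ler_pdivlMr //.
  have : (0 : R) <= (x%:R - 2) * (x%:R - 3).
    have [->|x3] : x = 2 \/ (3 <= x)%N by lia.
      by rewrite subrr mul0r.
    have : (3%:R : R) <= x%:R by rewrite ler_nat.
    by move=> ?; apply: mulr_ge0; lra.
  move: (x%:R : R) => y hy.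
  have -> : (1 - y / 6) * (y + 1) = 2 - (y - 2) * (y - 3) / 6 by field.
  by lra.
(* The tangent. For x >= 2 the claim reduces to (x - d)^2 >= 0; for x <= 1 it is d^2 - 2 d - 1 + 2 x
   >= 0, which holds as d > 3. *)
exists (2 / (d + 1) ^+ 2) => x.
have d10 : d + 1 != 0 by rewrite gt_eqF.
have -> : 2 / (d + 1) - 2 / (d + 1) ^+ 2 * (x%:R - d)
    = (4 * d + 2 - 2 * x%:R) / (d + 1) ^+ 2 by field.
have sq : 0 < (d + 1) ^+ 2 by rewrite exprn_gt0.
rewrite ler_pdivrMr // /weight.
have x0 : (0 : R) <= x%:R by [].
case: leqP => x1; first by nra.
rewrite -[x.+1%:R]natr1 mulrAC ler_pdivlMr; last lra.
have := sqr_ge0 (x%:R - d); nra.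
Qed.

(** The supporting line is summed over the vertices: as d is the average degree, the deviations from
    d cancel and every vertex contributes 2 / (d + 1). *)
Lemma potential_ge L (d : R) : 2 <= d ->
  (\sum_(v <- L) degree L v)%:R = d * (size L)%:R ->
  2 * (size L)%:R / (d + 1) <= potential L.
Proof.
move=> d2 hd; have [l hl] := weight_line d2.
apply: (@le_trans _ _ (\sum_(v <- L) (2 / (d + 1) - l * ((degree L v)%:R - d)))).
  rewrite big_split /= sumrN -[X in _ - X]mulr_sumr big_split /= sumrN.
  rewrite -natr_sum hd !big_const_seq !count_predT !iter_addr_0.
  by rewrite -[d *+ _]mulr_natr subrr mulr0 subr0 -[leRHS]mulr_natr mulrAC.
by apply: ler_sum => v _.
Qed.

(* [bs] and [fs] list the vertices that have been deleted so far, for branching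
   and for the forest, and [L] the remaining ones. *)
Definition greedy_inv (V bs fs L : seq nat) :=
  [/\ perm_eq V (bs ++ fs ++ L),
      potential V <= (size fs)%:R + potential L &
      forall j, (j < size fs)%N ->
        (count (adj (nth 0 fs j)) (drop j.+1 fs ++ L) <= 1)%N].

Lemma greedy_low V bs fs L L' v : greedy_inv V bs fs L -> perm_eq L (v :: L') ->
  (degree L v <= 1)%N -> greedy_inv V bs (rcons fs v) L'.
Proof.
case=> h1 h2 h3 hL dv; split.
- apply: (perm_trans h1); rewrite perm_cat2l cat_rcons perm_cat2l.
  exact: hL.
- apply: (le_trans h2); rewrite (potential_perm hL) size_rcons -natr1 -addrA lerD2l.
  exact: potential_low.
move=> j; rewrite size_rcons ltnS leq_eqVlt => /orP[/eqP ->|jf].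
  rewrite nth_rcons ltnn eqxx drop_oversize ?size_rcons //=.
  by move: dv; rewrite (degree_perm _ hL) /degree /= adj_irr.
rewrite nth_rcons jf drop_rcons // cat_rcons.
rewrite (_ : count _ _ = count (adj (nth 0 fs j)) (drop j.+1 fs ++ L)) ?h3 //.
by rewrite !count_cat (permP hL).
Qed.

Lemma greedy_high V bs fs L L' v : greedy_inv V bs fs L -> perm_eq L (v :: L') ->
  {in L, forall u, 2 <= degree L u <= degree L v}%N ->
  greedy_inv V (rcons bs v) fs L'.
Proof.
case=> h1 h2 h3 hL dv; split.
- apply: (perm_trans h1); rewrite cat_rcons perm_cat2l.
  rewrite (perm_trans (_ : perm_eq _ (fs ++ v :: L'))) ?perm_cat2l //.
  by rewrite perm_catC /= perm_cons perm_catC.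
- apply: (le_trans h2); rewrite (potential_perm hL) lerD2l.
  apply: potential_high => u; rewrite -(perm_mem hL) -!(degree_perm _ hL); exact: dv.
move=> j jf; apply: leq_trans (h3 j jf).
by rewrite !count_cat (permP hL) leq_add2l leq_addl.
Qed.

(** With no vertex left the remaining potential is 0, so the forest alone has at least [potential V]
    vertices. *)
Lemma greedy_branching V bs fs (d : R) : greedy_inv V bs fs [::] -> 2 <= d ->
  (\sum_(v <- V) degree V v)%:R = d * (size V)%:R ->
  (size bs)%:R <= (1 - 2 / (d + 1)) * (size V)%:R.
Proof.
case=> h1 h2 _ d2 hd; have := potential_ge d2 hd.
move: h2; rewrite {2}/potential big_nil addr0.
have -> : size V = (size bs + size fs)%N.
  by rewrite (perm_size h1) cats0 size_cat.
rewrite natrD; lra.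
Qed.

End InducedForest.

Lemma sum_if_eq (R : nmodType) (L : seq nat) (a : nat) (F : nat -> R) :
  uniq L -> a \in L -> (\sum_(v <- L) (if v == a then F v else 0) = F a)%R.
Proof.
move=> uL aL; rewrite (bigD1_seq a) //= eqxx big1 ?addr0 // => v /negPf va.
by rewrite va.
Qed.

(** * Vertex elimination *)

Section Elimination.
Variables (R : realType) (r n : nat) (S : nat -> nat -> R).
Hypothesis S_sym : forall p x, S p x = S x p.
Hypothesis S_diag : forall v a b, a < r -> b < r -> S (v * r + a) (v * r + b) = 0%R.
Local Open Scope ring_scope.

(* The literal [v * r + a] stands for "vertex v has value a".  Vertex [n] is a
   dummy of value 0, whose table accumulates the score of deleted vertices. *)
Definition energy (T : nat -> R) (L : seq nat) (phi : nat -> nat) : R :=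
  \sum_(v <- L) T (v * r + phi v)%N
  + 2^-1 * \sum_(v <- L) \sum_(u <- L) S (v * r + phi v)%N (u * r + phi u)%N.

Definition valid (phi : nat -> nat) := (forall v, phi v < r)%N /\ phi n = 0.

Lemma energy_perm T L L' phi : perm_eq L L' -> energy T L phi = energy T L' phi.
Proof.
move=> h; rewrite /energy (perm_big _ h) /=; congr (_ + _ * _).
rewrite (perm_big _ h) /=; apply: eq_bigr => v _; exact: perm_big.
Qed.

(** The double sum meets each pair in both orders, hence the factor 1/2 in [energy]. Symmetry merges
    the row and the column of [v], and the diagonal entry is 0. *)
Lemma energy_cons T v L phi : valid phi ->
  energy T (v :: L) phi = T (v * r + phi v)%N
    + \sum_(u <- L) S (v * r + phi v)%N (u * r + phi u)%N + energy T L phi.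
Proof.
case=> hphi _; rewrite /energy !big_cons S_diag // add0r.
under [X in _ + _ * (_ + X)]eq_bigr => u _ do rewrite big_cons S_sym.
rewrite big_split /= -addrA -[RHS]addrA; congr (_ + _).
set A := \sum_(_ <- _) S _ _; set B := \sum_(_ <- _) T _.
set C := \sum_(_ <- _) _.
have -> : 2^-1 * (A + (A + C)) = A + 2^-1 * C by field.
by ring.
Qed.

(** Once [v] is fixed, its pairwise scores become unary scores of the other vertices, and its own
    score goes to the dummy. The dummy also receives its entry of the row of [S], so that the
    program can add the whole row uniformly. *)
Lemma energy_branch T T' v L phi : valid phi -> uniq L -> n \in L ->
  {in L, forall u, u <= n}%N ->
  (forall u b, (u < n)%N -> (b < r)%N ->
    T' (u * r + b)%N = T (u * r + b)%N + S (v * r + phi v)%N (u * r + b)%N) ->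
  T' (n * r)%N = T (n * r)%N + S (v * r + phi v)%N (n * r)%N + T (v * r + phi v)%N ->
  energy T (v :: L) phi = energy T' L phi.
Proof.
move=> hphi uL nL leL h1 h2; rewrite energy_cons // /energy addrA.
congr (_ + _); have [hr phin] := hphi.
rewrite [RHS](bigD1_seq n) //= phin addn0 h2.
rewrite [in RHS]big_seq_cond [in RHS](eq_bigr (fun u =>
    T (u * r + phi u)%N + S (v * r + phi v)%N (u * r + phi u)%N)); last first.
  by move=> u /andP[uL' un]; rewrite h1 // ltn_neqAle un leL.
rewrite -[in RHS]big_seq_cond big_split /= -addrA.
rewrite [X in _ + (X + _)](bigD1_seq n) //= [X in _ + (_ + X)](bigD1_seq n) //=.
by rewrite phin addn0; ring.
Qed.

(** [w] is the only remaining vertex that interacts with [v]. [M] is left free: when it is the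
    maximum of the last summand over the values of [v], this one identity yields both the upper
    bound for all assignments and equality for a best value. *)
Lemma energy_forest T T' v w L phi (M : R) : valid phi -> uniq L -> w \in L ->
  {in L, forall u, u != w -> S (v * r + phi v)%N (u * r + phi u)%N = 0} ->
  {in L, forall u, T' (u * r + phi u)%N
                   = T (u * r + phi u)%N + (if u == w then M else 0)} ->
  energy T (v :: L) phi + M
  = energy T' L phi + (T (v * r + phi v)%N + S (v * r + phi v)%N (w * r + phi w)%N).
Proof.
move=> hphi uL wL h1 h2; rewrite energy_cons // /energy.
rewrite (bigD1_seq w) //= big_seq_cond big1 ?addr0; last first.
  by move=> u /andP[uL' uw]; exact: h1.
rewrite [in RHS](eq_big_seq _ h2) big_split /= (sum_if_eq (fun=> M)) //.
by ring.
Qed.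

End Elimination.

(** * The symmetric score matrix on literals *)

Section ScoreMatrix.
Variables (R : realType) (r : nat) (el : seq (nat * nat)).
Variable E : nat -> nat -> nat -> R.
Hypothesis r_gt0 : 0 < r.
Hypothesis el_uniq : uniq el.
Hypothesis el_lt : {in el, forall e, e.1 < e.2}.

Definition edge (k : nat) := nth (0, 0) el k.

(** The recursion on [k] follows the order in which the program writes the edges, so that
    [score_matrix k] is the content of the memory after [k] edges. *)
Fixpoint score_matrix (k p x : nat) : R :=
  if k is k'.+1 then
    if (p %/ r, x %/ r) == edge k' then E k' (p %% r) (x %% r)
    else if (x %/ r, p %/ r) == edge k' then E k' (x %% r) (p %% r)
    else score_matrix k' p x
  else 0%R.

Lemma divn_lit v a : a < r -> (v * r + a) %/ r = v.
Proof. by move=> h; rewrite divnMDl // divn_small // addn0. Qed.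

Lemma modn_lit v a : a < r -> (v * r + a) %% r = a.
Proof. by move=> h; rewrite modnMDl modn_small. Qed.

Lemma edge_lt k : k < size el -> (edge k).1 < (edge k).2.
Proof. by move=> h; apply/el_lt/mem_nth. Qed.

Lemma score_matrix_sym k p x : k <= size el ->
  score_matrix k p x = score_matrix k x p.
Proof.
elim: k => [//|k IH] h /=; rewrite IH 1?ltnW //.
case: eqP => [e1|//]; case: eqP => [e2|//].
by have := edge_lt h; rewrite -{1}e1 -e2 /= ltnn.
Qed.

Lemma score_matrix0 k p x : k <= size el -> (p %/ r, x %/ r) \notin take k el ->
  (x %/ r, p %/ r) \notin take k el -> score_matrix k p x = 0%R.
Proof.
elim: k => [//|k IH] h; rewrite (take_nth (0, 0)) // !mem_rcons !inE !negb_or /=.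
case/andP=> /negPf n1 m1 /andP[/negPf n2 m2].
by rewrite /edge n1 n2 IH // ltnW.
Qed.

(** Edges are distinct and increasing, so neither orientation of edge [k] occurs earlier: the
    entries that it overwrites are 0 and overwriting is adding. Each edge is met in two ordered
    pairs, which gives the factor 2 that the half in [energy] cancels. *)
Lemma score_matrix_sum k (L : seq nat) (phi : nat -> nat) : k <= size el ->
  uniq L -> (forall v, phi v < r) -> {in el, forall e, e.1 \in L /\ e.2 \in L} ->
  (\sum_(v <- L) \sum_(u <- L) score_matrix k (v * r + phi v) (u * r + phi u)
  = 2 * \sum_(i < k) E i (phi (edge i).1) (phi (edge i).2))%R.
Proof.
move=> + uL hphi hel; elim: k => [|k IH] h.
  by rewrite big_ord0 mulr0 big1 // => v _; rewrite big1.
have [e1L e2L] := hel _ (mem_nth (0, 0) h).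
rewrite -/(edge k) in e1L e2L.
have elt := edge_lt h.
have ekN : edge k \notin take k el.
  have := el_uniq; rewrite -{1}(cat_take_drop k el) (drop_nth (0, 0) h) cat_uniq /=.
  by case/and3P=> _ /norP[].
have ekN' : ((edge k).2, (edge k).1) \notin take k el.
  by apply/negP => /mem_take /el_lt /=; rewrite ltnNge ltnW.
set c := E k (phi (edge k).1) (phi (edge k).2).
rewrite big_ord_recr /= -/c mulrDr -IH 1?ltnW //.
have -> : (2 * c = \sum_(v <- L) \sum_(u <- L)
    ((if v == (edge k).1 then if u == (edge k).2 then c else 0 else 0)
     + (if v == (edge k).2 then if u == (edge k).1 then c else 0 else 0)))%R.
  under eq_bigr => v _ do rewrite big_split /=.
  have aux a b : a \in L -> b \in L -> (\sum_(v <- L) \sum_(u <- L)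
     (if v == a then if u == b then c else 0 else 0) = c)%R.
    move=> aL bL; rewrite -[RHS](sum_if_eq (fun=> c) uL aL).
    apply: eq_bigr => v _; case: eqP => _; last by rewrite big1.
    by rewrite (sum_if_eq (fun=> c) uL bL).
  by rewrite big_split /= !aux // mulr_natl.
rewrite -big_split /=; apply: eq_bigr => v _; rewrite -big_split /=.
apply: eq_bigr => u _; rewrite !divn_lit // !modn_lit //.
have vuE a b : ((v, u) == (a, b)) = (v == a) && (u == b) by [].
have uvE a b : ((u, v) == (a, b)) = (v == b) && (u == a) by rewrite andbC.
rewrite [edge k]surjective_pairing vuE uvE /=.
case: (eqVneq v (edge k).1) => [v1|v1] /=.
  have v2 : (v == (edge k).2) = false by rewrite v1; apply/eqP; lia.
  rewrite v2 /=; case: (eqVneq u (edge k).2) => [u2|u2] /=; last by rewrite !addr0.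
  rewrite score_matrix0 ?add0r ?addr0 ?divn_lit // 1?ltnW //.
  - by rewrite v1 u2.
  - by rewrite v1 u2 -surjective_pairing.
  - by rewrite v1 u2.
case: (eqVneq v (edge k).2) => [v2|v2] /=; last by rewrite !addr0.
case: (eqVneq u (edge k).1) => [u1|u1] /=; last by rewrite !addr0.
rewrite score_matrix0 ?add0r ?addr0 ?divn_lit // 1?ltnW //.
- by rewrite v2 u1.
- by rewrite v2 u1.
- by rewrite v2 u1 -surjective_pairing.
Qed.

End ScoreMatrix.

(** * Breadth-first numbering of the r-ary tree *)

Section Heap.
Variable r : nat.
Hypothesis r_gt0 : 0 < r.

(* The nodes of the complete r-ary tree are numbered in breadth-first order. *)
Definition node (w : seq nat) : nat := foldl (fun q a => q * r + a.+1) 0 w.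

(** The number of the first node of depth [i], which is also the number of nodes above it: 1 + r +
    ... + r^(i-1), in Horner form. *)
Fixpoint level (i : nat) : nat := if i is i'.+1 then (level i' * r).+1 else 0.

Lemma node_rcons w a : node (rcons w a) = node w * r + a.+1.
Proof. by rewrite /node -cats1 foldl_cat. Qed.

Lemma levelS i : level i.+1 = level i + r ^ i.
Proof.
elim: i => [//|i IH]; change ((level i.+1 * r).+1 = level i.+1 + r ^ i.+1).
by rewrite {1}IH expnSr mulnDl /=; lia.
Qed.

Lemma level_mono i j : i <= j -> level i <= level j.
Proof.
elim: j => [|j IH]; first by rewrite leqn0 => /eqP ->.
rewrite leq_eqVlt => /orP[/eqP -> //|/IH h]; apply: (leq_trans h).
by rewrite levelS leq_addr.
Qed.

Lemma node_range w : all (gtn r) w -> level (size w) <= node w < level (size w).+1.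
Proof.
elim/last_ind: w => [//|w a IH]; rewrite all_rcons => /andP[/= ar /IH /andP[h1 h2]].
rewrite size_rcons node_rcons; apply/andP; split.
  by rewrite /= addnS ltnS (leq_trans _ (leq_addr _ _)) // leq_mul2r h1 orbT.
change (node w * r + a.+1 < (level (size w).+1 * r).+1).
rewrite ltnS (@leq_trans ((node w).+1 * r)) ?leq_mul2r ?h2 ?orbT //.
by rewrite mulSn addnC leq_add2r.
Qed.

Lemma node_inj w w' : all (gtn r) w -> all (gtn r) w' -> node w = node w' -> w = w'.
Proof.
elim/last_ind: w w' => [|w a IH] w'; elim/last_ind: w' => [|w' b _] //.
- by move=> _ _; rewrite node_rcons addnS.
- by move=> _ _; rewrite node_rcons addnS.
rewrite !all_rcons !node_rcons !addnS => /andP[/= ar hw] /andP[/= br hw'] [h].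
have ab : a = b by rewrite -(modn_lit (node w) ar) h modn_lit.
congr rcons => //; apply: IH => //.
by rewrite -(divn_lit r_gt0 (node w) ar) h divn_lit.
Qed.

(** This is bijective base-r numeration, with digits 1 to r: a nonzero number q + 1 has the parent q
    / r and the last letter q mod r. *)
Lemma node_surj q : exists2 w, all (gtn r) w & node w = q.
Proof.
elim/ltn_ind: q => -[|q] IH; first by exists [::].
have [|w hw E] := IH (q %/ r); first by rewrite ltnS leq_div.
exists (rcons w (q %% r)); first by rewrite all_rcons /= ltn_mod r_gt0.
by rewrite node_rcons E addnS -divn_eq.
Qed.

End Heap.

Notation "c1 ;; c2" := (Seq c1 c2) (at level 70, right associativity).
Notation "''' x" := (IVar x) (at level 0, x at level 0, format "''' x").
Notation "# k" := (ICst k) (at level 0, k at level 0, format "# k").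
Notation "e1 .+ e2" := (IPlus e1 e2) (at level 50, left associativity).
Notation "e1 .- e2" := (IMinus e1 e2) (at level 50, left associativity).
Notation "A ! e" := (IArr A e) (at level 40, e at level 40, right associativity).
Notation "A !! e" := (RArr A e) (at level 40, e at level 40, right associativity).

(** * The program *)

Notation v_base := 0 (only parsing).
Notation v_n := 1 (only parsing).
Notation v_r := 2 (only parsing).
Notation v_m := 3 (only parsing).
Notation v_n1 := 4 (only parsing).
Notation v_rr := 5 (only parsing).
Notation v_D := 6 (only parsing).
Notation v_k := 7 (only parsing).
Notation v_l := 8 (only parsing).
Notation v_Q := 9 (only parsing).
Notation v_QT := 10 (only parsing).
Notation v_NL := 11 (only parsing).
Notation v_best := 12 (only parsing).
Notation v_a := 13 (only parsing).
Notation v_b := 14 (only parsing).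
Notation v_c := 15 (only parsing).
Notation v_e := 16 (only parsing).
Notation v_j := 17 (only parsing).
Notation v_p := 18 (only parsing).
Notation v_q := 19 (only parsing).
Notation v_t := 20 (only parsing).
Notation v_u := 21 (only parsing).
Notation v_v := 22 (only parsing).
Notation v_w := 23 (only parsing).
Notation v_x := 24 (only parsing).
Notation v_y := 25 (only parsing).
Notation v_z := 26 (only parsing).
Notation v_lo := 27 (only parsing).
Notation v_hi := 28 (only parsing).
Notation v_deg := 29 (only parsing).
Notation v_max := 30 (only parsing).
Notation v_arg := 31 (only parsing).
Notation v_nop := 32 (only parsing).

(* The machine does not multiply natural numbers: [MUL_r], [MUL_D] and [OFF] hold
   the multiples of r and of D = (n + 1) r.  The latter is the number of literals
   "vertex v has value a", encoded as v r + a, and the size of a score table. *)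
Notation a_raw := 0 (only parsing).
Notation MUL_r := 1 (only parsing).
Notation MUL_D := 2 (only parsing).
Notation OFF := 3 (only parsing).
Notation ADJ := 4 (only parsing).
Notation DEAD := 5 (only parsing).
Notation FOR := 6 (only parsing).
Notation BRA := 7 (only parsing).
Notation RANK := 8 (only parsing).
Notation PAR := 9 (only parsing).
Notation LEV := 10 (only parsing).
Notation PHI := 11 (only parsing).
Notation ARG := 12 (only parsing).

Notation MAT := 1 (only parsing).
Notation TAB := 2 (only parsing).

Definition nop := ISet v_nop #0.

(** The base exceeds the lengths 3 + 2 m and 1 + n r + m r^2 of the two input lists, and also the
    index D up to which [root_table] reads. *)
Definition prologue : cmd :=
  ISet v_n1 ('v_n .+ #1) ;;
  ISet v_rr #0 ;;
  For v_x v_r (ISet v_rr ('v_rr .+ 'v_r)) ;;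
  ISet v_D #0 ;;
  For v_x v_n1 (ISet v_D ('v_D .+ 'v_r)) ;;
  ISet v_y #0 ;;
  For v_x v_m (ISet v_y ('v_y .+ 'v_rr)) ;;
  ISet v_base ('v_D .+ 'v_y .+ 'v_m .+ 'v_m .+ #4).

Definition tables : cmd :=
  ISet v_y #0 ;;
  ISet v_z #0 ;;
  For v_x v_D (
    IPut MUL_r 'v_x 'v_y ;;
    IPut MUL_D 'v_x 'v_z ;;
    ISet v_y ('v_y .+ 'v_r) ;;
    ISet v_z ('v_z .+ 'v_D)).

Definition matrix_entry : cmd :=
  ISet v_x (MUL_r ! 'v_u .+ 'v_a) ;;
  ISet v_y (MUL_r ! 'v_v .+ 'v_b) ;;
  RPut MAT (MUL_D ! 'v_x .+ 'v_y) (a_raw !! 'v_p) ;;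
  RPut MAT (MUL_D ! 'v_y .+ 'v_x) (a_raw !! 'v_p) ;;
  ISet v_p ('v_p .+ #1).

Definition matrix : cmd :=
  ISet v_p (MUL_r ! 'v_n .+ #1) ;;
  For v_e v_m (
    ISet v_u (a_raw ! ('v_e .+ 'v_e .+ #3)) ;;
    ISet v_v (a_raw ! ('v_e .+ 'v_e .+ #4)) ;;
    IPut ADJ (MUL_D ! 'v_u .+ 'v_v) #1 ;;
    IPut ADJ (MUL_D ! 'v_v .+ 'v_u) #1 ;;
    For v_a v_r (For v_b v_r matrix_entry)).

(** The loop fills the block of the dummy with whatever follows the vertex scores. The entry for its
    value 0, the only one that a valid assignment reads, is then overwritten by the constant
    score. *)
Definition root_table : cmd :=
  For v_x v_D (RPut TAB 'v_x (a_raw !! ('v_x .+ #1))) ;;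
  RPut TAB (MUL_r ! 'v_n) (a_raw !! #0).

(** On flags, truncated subtraction means: adjacent and not dead. *)
Definition vertex_degree : cmd :=
  ISet v_deg #0 ;;
  For v_u v_n (ISet v_deg ('v_deg .+ (ADJ ! (MUL_D ! 'v_v .+ 'v_u) .- DEAD ! 'v_u))).

(** [n] in [v_lo] signals that no vertex of degree at most 1 was found. The comparison with [v_max]
    is not strict, so that the first living vertex is recorded even if its degree is 0. *)
Definition scan : cmd :=
  ISet v_lo 'v_n ;;
  ISet v_hi 'v_n ;;
  ISet v_max #0 ;;
  For v_v v_n (
    IfI (DEAD ! 'v_v) #0 (
      vertex_degree ;;
      IfI 'v_deg #1 (ISet v_lo 'v_v) nop ;;
      IfI 'v_max 'v_deg (ISet v_max 'v_deg ;; ISet v_hi 'v_v) nop)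
    nop).

Definition greedy : cmd :=
  ISet v_k #0 ;;
  ISet v_l #0 ;;
  For v_t v_n (
    scan ;;
    IfI 'v_n 'v_lo (
      IPut BRA 'v_k 'v_hi ;;
      ISet v_k ('v_k .+ #1) ;;
      IPut DEAD 'v_hi #1)
    (IPut FOR 'v_l 'v_lo ;;
      ISet v_l ('v_l .+ #1) ;;
      IPut RANK 'v_lo 'v_l ;;
      IPut DEAD 'v_lo #1)).

(** [RANK] is the position in the forest order plus one, and 0 for branching vertices; a rank of at
    least j + 2 thus selects the forest vertices after position j. *)
Definition parents : cmd :=
  For v_j v_l (
    ISet v_v (FOR ! 'v_j) ;;
    ISet v_w 'v_n ;;
    For v_u v_n (
      IfI ('v_j .+ #2) (RANK ! 'v_u)
        (IfI #1 (ADJ ! (MUL_D ! 'v_v .+ 'v_u)) (ISet v_w 'v_u) nop) nop) ;;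
    IPut PAR 'v_j 'v_w).

Definition heap_size : cmd :=
  ISet v_Q #0 ;;
  For v_t v_k (
    ISet v_y #0 ;;
    For v_a v_r (ISet v_y ('v_y .+ 'v_Q)) ;;
    ISet v_Q ('v_y .+ #1)) ;;
  ISet v_y #0 ;;
  For v_a v_r (ISet v_y ('v_y .+ 'v_Q)) ;;
  ISet v_QT ('v_y .+ #1) ;;
  ISet v_NL ('v_QT .- 'v_Q).

Definition offsets : cmd :=
  ISet v_z #0 ;;
  For v_q v_QT (
    IPut OFF 'v_q 'v_z ;;
    ISet v_z ('v_z .+ 'v_D)).

(** Children are created in the order of their numbers, so the counter [v_c] replaces the product in
    q r + a + 1. *)
Definition child : cmd :=
  ISet v_c ('v_c .+ #1) ;;
  ISet v_v (BRA ! LEV ! 'v_q) ;;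
  IPut LEV 'v_c (LEV ! 'v_q .+ #1) ;;
  ISet v_x (MUL_D ! (MUL_r ! 'v_v .+ 'v_a)) ;;
  For v_y v_D
    (RPut TAB (OFF ! 'v_c .+ 'v_y)
      (RPlus (TAB !! (OFF ! 'v_q .+ 'v_y)) (MAT !! ('v_x .+ 'v_y)))) ;;
  RPut TAB (OFF ! 'v_c .+ MUL_r ! 'v_n)
    (RPlus (TAB !! (OFF ! 'v_c .+ MUL_r ! 'v_n))
      (TAB !! (OFF ! 'v_q .+ MUL_r ! 'v_v .+ 'v_a))) ;;
  For v_u v_D (IPut PHI (OFF ! 'v_c .+ 'v_u) (PHI ! (OFF ! 'v_q .+ 'v_u))) ;;
  IPut PHI (OFF ! 'v_c .+ 'v_v) 'v_a.

Definition branch : cmd :=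
  ISet v_c #0 ;;
  For v_q v_Q (For v_a v_r child).

Definition best_value : cmd :=
  ISet v_arg #0 ;;
  RSet 0 (RPlus (TAB !! ('v_z .+ MUL_r ! 'v_v))
    (MAT !! (MUL_D ! MUL_r ! 'v_v .+ MUL_r ! 'v_u .+ 'v_b))) ;;
  For v_a v_r (
    RSet 1 (RPlus (TAB !! ('v_z .+ MUL_r ! 'v_v .+ 'v_a))
      (MAT !! (MUL_D ! (MUL_r ! 'v_v .+ 'v_a) .+ MUL_r ! 'v_u .+ 'v_b))) ;;
    IfR (RVar 1) (RVar 0) nop (RSet 0 (RVar 1) ;; ISet v_arg 'v_a)).

Definition eliminate : cmd :=
  ISet v_v (FOR ! 'v_j) ;;
  ISet v_u (PAR ! 'v_j) ;;
  For v_b v_r (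
    best_value ;;
    IPut ARG (MUL_r ! 'v_v .+ 'v_b) 'v_arg ;;
    RPut TAB ('v_z .+ MUL_r ! 'v_u .+ 'v_b)
      (RPlus (TAB !! ('v_z .+ MUL_r ! 'v_u .+ 'v_b)) (RVar 0))).

(** Runs against the elimination order: the parent of a vertex is eliminated later, so its value is
    already final. *)
Definition traceback : cmd :=
  For v_j v_l (
    ISet v_x ('v_l .- ('v_j .+ #1)) ;;
    ISet v_v (FOR ! 'v_x) ;;
    IPut PHI ('v_z .+ 'v_v)
      (ARG ! (MUL_r ! 'v_v .+ PHI ! ('v_z .+ PAR ! 'v_x)))).

(** [ARG] is shared by all leaves, hence each assignment is traced back before the next leaf is
    treated. Elimination overwrites the table of the leaf itself, which no other node needs. *)
Definition leaves : cmd :=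
  ISet v_best 'v_Q ;;
  For v_t v_NL (
    ISet v_q ('v_Q .+ 'v_t) ;;
    ISet v_z (OFF ! 'v_q) ;;
    For v_j v_l eliminate ;;
    traceback ;;
    IfR (TAB !! (OFF ! 'v_best .+ MUL_r ! 'v_n)) (TAB !! ('v_z .+ MUL_r ! 'v_n))
      (ISet v_best 'v_q) nop).

Definition output : cmd :=
  ISet v_z (OFF ! 'v_best) ;;
  For v_v v_n (IPut a_raw 'v_v (PHI ! ('v_z .+ 'v_v))) ;;
  RPut a_raw #0 (TAB !! ('v_z .+ MUL_r ! 'v_n)).

Definition solver : cmd :=
  tables ;; matrix ;; root_table ;; greedy ;; parents ;; heap_size ;; offsets ;;
  branch ;; leaves ;; output.

Arguments upd {T} M i x j /.
Arguments put {T} A j x v j' /.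

(** * Correctness of the program *)

Section Hoare.
Variable R : realType.
Implicit Types (c : cmd) (s : state R).

(** The conditions are on the syntax of [c], so for concrete commands they are decided by
    computation; this is what the many [isT] below stand for. *)
Record frame c s s' : Prop := Frame {
  frame_iv : forall x, x \notin wiv c -> iv s' x = iv s x;
  frame_ia : forall j, j \notin wia c -> ia s' j = ia s j;
  frame_ra : forall j, j \notin wra c -> ra s' j = ra s j }.

Lemma eval_frame c s : frame c s (eval c s).
Proof.
split=> x xc; [exact: eval_iv|exact: eval_ia|exact: eval_ra].
Qed.

Lemma eval_seq c1 c2 s : eval (c1 ;; c2) s = eval c2 (eval c1 s).
Proof. by []. Qed.

Lemma eval_ifi e1 e2 c1 c2 s : eval (IfI e1 e2 c1 c2) s
  = if ieval e1 s <= ieval e2 s then eval c1 s else eval c2 s.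
Proof. by []. Qed.

(* The frame property of the loop comes for free, so that invariants only have to
   describe what is modified. *)
Lemma for_rule (Inv : nat -> state R -> Prop) x y c s : Inv 0 s ->
  (forall k s', k < iv s y -> frame (For x y c) s s' -> Inv k s' ->
    Inv k.+1 (eval c (set_iv s' x k))) ->
  Inv (iv s y) (eval (For x y c) s).
Proof.
move=> I0 IS.
suff [] : Inv (iv s y) (eval (For x y c) s) /\ frame (For x y c) s (eval (For x y c) s) by [].
apply: (@iteri_ind _ (fun k s' => Inv k s' /\ frame (For x y c) s s')) => //.
move=> k s' kN [Ik [f1 f2 f3]]; split; first exact: IS.
split=> z /=; rewrite ?inE.
- rewrite negb_or => /andP[zx zc]; rewrite eval_iv // /= (negPf zx).
  by rewrite f1 //= inE negb_or zx.
- by move=> zc; rewrite eval_ia //= f2.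
- by move=> zc; rewrite eval_ra //= f3.
Qed.

End Hoare.

Section Prologue.
Variable R : realType.
Implicit Types (s : state R).

Lemma sum_loop s x y z w :
  z != w -> z != x -> w != x ->
  iv (eval (For x y (ISet z ('z .+ 'w))) s) z = iv s z + iv s y * iv s w.
Proof.
move=> zw zx wx.
apply: (@for_rule _ (fun k s' => iv s' z = iv s z + k * iv s w)); first by rewrite addn0.
move=> k s' _ F IH; rewrite /= eqxx (negPf zx) (negPf wx) IH.
rewrite (frame_iv F) /=; first by rewrite mulSn; lia.
by rewrite !inE negb_or wx eq_sym zw.
Qed.

Lemma prologue_ok s n r m : iv s v_n = n -> iv s v_r = r -> iv s v_m = m ->
  let s' := eval prologue s in
  [/\ iv s' v_D = n.+1 * r, iv s' v_rr = r * r &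
      iv s' v_base = n.+1 * r + m * (r * r) + m + m + 4].
Proof.
move=> hn hr hm; rewrite /prologue !eval_seq.
set s1 := eval (ISet v_n1 _) s; set s2 := eval (ISet v_rr _) s1.
set s3 := eval (For _ _ _) s2; set s4 := eval (ISet v_D _) s3.
set s5 := eval (For _ _ _) s4; set s6 := eval (ISet v_y _) s5.
set s7 := eval (For _ _ _) s6.
have h3 : iv s3 v_rr = r * r by rewrite /s3 sum_loop // /= hr.
have r3 : iv s3 v_r = r by rewrite /s3 eval_iv.
have n3 : iv s3 v_n1 = n.+1 by rewrite /s3 eval_iv //= hn addn1.
have h5 : iv s5 v_D = n.+1 * r by rewrite /s5 sum_loop // /= r3 n3.
have h5' : iv s5 v_rr = r * r by rewrite /s5 eval_iv //= h3.
have m5 : iv s5 v_m = m by rewrite /s5 eval_iv //= /s3 eval_iv.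
have h7 : iv s7 v_y = m * (r * r) by rewrite /s7 sum_loop // /= h5' m5.
have D7 : iv s7 v_D = n.+1 * r by rewrite /s7 eval_iv //= h5.
have r7 : iv s7 v_rr = r * r by rewrite /s7 eval_iv //= h5'.
have m7 : iv s7 v_m = m by rewrite /s7 eval_iv //= m5.
by rewrite /= h7 D7 r7 m7.
Qed.

End Prologue.

(** * Bounds on the cost of the phases *)

Section Cost.
Variable V : nat -> nat.

(** All bounds have the shape y * X, where y is a product of loop lengths and X a numeral assembled
    by unification along the syntax; in the end X <= 1000 is checked by computation. *)
Lemma bnd_seq c1 c2 y X1 X2 : scost c1 V <= y * X1 -> scost c2 V <= y * X2 ->
  scost (c1 ;; c2) V <= y * (X1 + X2).
Proof. by move=> h1 h2; rewrite mulnDr; exact: leq_add. Qed.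

(** 10 = 4 + 6, the overhead of a loop and that of one round. *)
Lemma bnd_for N' y' x v c X : V v <= N' -> 0 < N' -> 0 < y' ->
  scost c V <= y' * X -> scost (For x v c) V <= N' * y' * (10 + X).
Proof.
move=> h1 h2 h3 h4 /=; have := leq_mul h1 h4.
have : V v * 6 <= N' * y' * 6 by rewrite leq_mul2r (leq_trans h1) ?leq_pmulr ?orbT.
have : 4 <= N' * y' * 4 by rewrite leq_pmull // muln_gt0 h2.
by rewrite !mulnDr mulnA; lia.
Qed.

Lemma bnd_if e1 e2 c1 c2 y X1 X2 : 0 < y -> scost c1 V <= y * X1 -> scost c2 V <= y * X2 ->
  scost (IfI e1 e2 c1 c2) V <= y * (isize e1 + isize e2 + 2 + X1 + X2).
Proof.
move=> h0 h1 h2 /=; rewrite 2!mulnDr !leq_add //; exact: leq_pmull.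
Qed.

Lemma bnd_le c y X Z : scost c V <= y * X -> X <= Z -> scost c V <= y * Z.
Proof. by move=> h1 h2; rewrite (leq_trans h1) // leq_mul2l h2 orbT. Qed.

Lemma bnd_const c y X : scost c V <= X -> 0 < y -> scost c V <= y * X.
Proof. by move=> h1 h2; rewrite (leq_trans h1) // leq_pmull. Qed.



(** With Y the last factor, eight phases cost at most 1000 Y each, and [offsets] and [branch] at
    most 2000 Y each, whence 12. *)
Lemma phases_cost : forall n r m k, 0 < n -> 1 < r -> m <= n * n -> k <= n ->
  V v_n = n -> V v_r = r -> V v_m = m -> V v_D = n.+1 * r -> V v_k = k -> V v_l <= n ->
  V v_Q <= r ^ k -> V v_NL = r ^ k -> V v_QT <= r ^ k * r * 2 ->
  \sum_(c <- [:: tables; matrix; root_table; greedy; parents; heap_size; offsets;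
     branch; leaves; output]) scost c V <= 12 * 1000 * (r ^ 2 * (n * r ^ k + n.+1 ^ 3)).
Proof.
move=> n r m k n_gt0 r_gt1 m_le k_le Vn Vr Vm VD Vk Vl VQ VNL VQT.
have r_gt0 : 0 < r by apply: ltnW.
have K_gt0 : 0 < r ^ k by rewrite expn_gt0 r_gt0.
set K := r ^ k in VQ VNL VQT K_gt0 *.
have nn_gt0 : 0 < n * n by rewrite muln_gt0 n_gt0.
have n1r : 0 < n.+1 * r by rewrite muln_gt0 r_gt0.
set Y := r ^ 2 * (n * K + n.+1 ^ 3).
have y1 : n.+1 * r * 1 <= Y by rewrite /Y; nia.
have y2 : n * n * (r * (r * 1)) <= Y by rewrite /Y; nia.
have y3 : n * (n * (n * 1)) <= Y by rewrite /Y; nia.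
have y4 : n * (n * 1) <= Y by rewrite /Y; nia.
have y5 : n * (r * 1) <= Y by rewrite /Y; nia.
have y6 : K * r * 2 * 1 <= 2 * Y by rewrite /Y; nia.
have y7 : K * (r * (n.+1 * r * 1)) <= 2 * Y by rewrite /Y; nia.
have y8 : K * (n * (r * (r * 1))) <= Y by rewrite /Y; nia.
have y9 : n * 1 <= Y by rewrite /Y; nia.
have D_gt0 : 0 < n.+1 * r * 1 by rewrite muln1.
have r2 : 0 < r * (r * 1) by rewrite muln1 muln_gt0 r_gt0.
have nr2 : 0 < n * (r * (r * 1)) by rewrite muln_gt0 n_gt0.
have rD : 0 < r * (n.+1 * r * 1) by rewrite muln_gt0 r_gt0.
have n10 : 0 < n * 1 by rewrite muln1.
have n20 : 0 < n * (n * 1) by rewrite muln_gt0 n_gt0.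
have r10 : 0 < r * 1 by rewrite muln1.
have B1 : scost tables V <= (n.+1 * r * 1) * 1000.
  apply: bnd_le.
  - do 2 (apply: bnd_seq; first by apply: bnd_const (leqnn _) _).
    by apply: (@bnd_for (n.+1 * r) 1) => //; [rewrite VD|exact: bnd_const (leqnn _) _].
  - by [].
have B2 : scost matrix V <= (n * n * (r * (r * 1))) * 1000.
  apply: bnd_le.
  - apply: bnd_seq; first by apply: bnd_const (leqnn _) _; rewrite muln_gt0 nn_gt0.
    apply: bnd_for; rewrite ?Vm //.
    do 4 (apply: bnd_seq; first by apply: bnd_const (leqnn _) _).
    apply: bnd_for; rewrite ?Vr //.
    by apply: bnd_for; rewrite ?Vr //; exact: bnd_const (leqnn _) _.
  - by [].
have B3 : scost root_table V <= (n.+1 * r * 1) * 1000.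
  apply: bnd_le.
  - apply: bnd_seq; last by apply: bnd_const (leqnn _) _.
    by apply: bnd_for; rewrite ?VD //; exact: bnd_const (leqnn _) _.
  - by [].
have B4 : scost greedy V <= (n * (n * (n * 1))) * 1000.
  apply: bnd_le.
  - do 2 (apply: bnd_seq; first by apply: bnd_const (leqnn _) _; rewrite muln_gt0 n_gt0).
    apply: bnd_for; rewrite ?Vn //.
    apply: bnd_seq; last by apply: bnd_const (leqnn _) _.
    do 3 (apply: bnd_seq; first by apply: bnd_const (leqnn _) _).
    apply: bnd_for; rewrite ?Vn //.
    apply: bnd_if => //; last by apply: bnd_const (leqnn _) _.
    apply: bnd_seq; last by apply: bnd_const (leqnn _) _.
    apply: bnd_seq; first by apply: bnd_const (leqnn _) _.
    by apply: bnd_for; rewrite ?Vn //; exact: bnd_const (leqnn _) _.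
  - by [].
have B5 : scost parents V <= (n * (n * 1)) * 1000.
  apply: bnd_le.
  - apply: bnd_for => //.
    do 2 (apply: bnd_seq; first by apply: bnd_const (leqnn _) _).
    apply: bnd_seq; last by apply: bnd_const (leqnn _) _.
    by apply: bnd_for; rewrite ?Vn //; exact: bnd_const (leqnn _) _.
  - by [].
have B6 : scost heap_size V <= (n * (r * 1)) * 1000.
  apply: bnd_le.
  - have nr0 : 0 < n * (r * 1) by rewrite muln_gt0 n_gt0.
    apply: bnd_seq; first by apply: bnd_const (leqnn _) _.
    apply: bnd_seq.
      apply: bnd_for; rewrite ?Vk //.
      apply: bnd_seq; first by apply: bnd_const (leqnn _) _.
      apply: bnd_seq; last by apply: bnd_const (leqnn _) _.
      by apply: bnd_for; rewrite ?Vr //; exact: bnd_const (leqnn _) _.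
    apply: bnd_seq; first by apply: bnd_const (leqnn _) _.
    apply: bnd_seq; last by apply: bnd_const (leqnn _) _.
    rewrite muln1 (mulnC n); apply: bnd_for; rewrite ?Vr //.
    by apply: bnd_const (leqnn _) _.
  - by [].
have B7 : scost offsets V <= (K * r * 2 * 1) * 1000.
  apply: bnd_le.
  - have Kr : 0 < K * r * 2 by rewrite !muln_gt0 K_gt0 r_gt0.
    apply: bnd_seq; first by apply: bnd_const (leqnn _) _; rewrite muln1.
    by apply: bnd_for => //; exact: bnd_const (leqnn _) _.
  - by [].
have B8 : scost branch V <= (K * (r * (n.+1 * r * 1))) * 1000.
  apply: bnd_le.
  - apply: bnd_seq; first by apply: bnd_const (leqnn _) _; rewrite muln_gt0 K_gt0.
    apply: bnd_for => //.
    apply: bnd_for; rewrite ?Vr //.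
    do 4 (apply: bnd_seq; first by apply: bnd_const (leqnn _) _).
    apply: bnd_seq.
      by apply: bnd_for; rewrite ?VD //; exact: bnd_const (leqnn _) _.
    apply: bnd_seq; first by apply: bnd_const (leqnn _) _.
    apply: bnd_seq; last by apply: bnd_const (leqnn _) _.
    by apply: bnd_for; rewrite ?VD //; exact: bnd_const (leqnn _) _.
  - by [].
have B9 : scost leaves V <= (K * (n * (r * (r * 1)))) * 1000.
  apply: bnd_le.
  - apply: bnd_seq; first by apply: bnd_const (leqnn _) _; rewrite muln_gt0 K_gt0.
    apply: bnd_for; rewrite ?VNL //.
    do 2 (apply: bnd_seq; first by apply: bnd_const (leqnn _) _).
    apply: bnd_seq.
      apply: bnd_for => //.
      do 2 (apply: bnd_seq; first by apply: bnd_const (leqnn _) _).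
      apply: bnd_for; rewrite ?Vr //.
      apply: bnd_seq; last by apply: bnd_const (leqnn _) _.
      do 2 (apply: bnd_seq; first by apply: bnd_const (leqnn _) _).
      by apply: bnd_for; rewrite ?Vr //; exact: bnd_const (leqnn _) _.
    apply: bnd_seq; last by apply: bnd_const (leqnn _) _.
    by apply: bnd_for => //; exact: bnd_const (leqnn _) _.
  - by [].
have B10 : scost output V <= (n * 1) * 1000.
  apply: bnd_le.
  - apply: bnd_seq; first by apply: bnd_const (leqnn _) _.
    apply: bnd_seq; last by apply: bnd_const (leqnn _) _.
    by apply: bnd_for; rewrite ?Vn //; exact: bnd_const (leqnn _) _.
  - by [].
rewrite !big_cons big_nil addn0.
move: Y y1 y2 y3 y4 y5 y6 y7 y8 y9 B1 B2 B3 B4 B5 B6 B7 B8 B9 B10 => Y.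
move: (K * (r * (n.+1 * r * 1))) (K * (n * (r * (r * 1)))) (K * r * 2 * 1).
move: (n * n * (r * (r * 1))) (n * (n * (n * 1))) (n * (n * 1)) (n * (r * 1)) (n * 1).
move: (n.+1 * r * 1) => *.
lia.
Qed.

End Cost.

(** * Tables, score matrix and greedy order computed by the program *)

Section Solver.
Variables (R : realType) (n r m b : nat) (el : seq (nat * nat)).
Variables (raw_i : nat -> nat) (raw_r : nat -> R).
Let D := n.+1 * r.
Hypothesis r_gt1 : 1 < r.
Hypothesis n_gt0 : 0 < n.
Hypothesis size_el : size el = m.
Hypothesis el_uniq : uniq el.
Hypothesis el_lt : {in el, forall e, e.1 < e.2}.
Hypothesis el_n : {in el, forall e, e.2 < n}.
Hypothesis b_def : b = D + m * (r * r) + m + m + 4.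
Hypothesis raw_i1 : forall e, e < m -> raw_i (e + e + 3) = (edge el e).1.
Hypothesis raw_i2 : forall e, e < m -> raw_i (e + e + 4) = (edge el e).2.
Implicit Types (s : state R).

Let r_gt0 : 0 < r. Proof. exact: ltnW. Qed.
Let D_gt : n * r < D. Proof. rewrite /D mulSn; lia. Qed.

Lemma lit_lt v a : v <= n -> a < r -> v * r + a < D.
Proof. by rewrite /D => *; nia. Qed.

Lemma vtx_lt v : v <= n -> v < D.
Proof. by rewrite /D => *; nia. Qed.

Lemma pair_inj d p x p' x' : x < d -> x' < d ->
  (p * d + x == p' * d + x') = (p == p') && (x == x').
Proof.
move=> xd xd'; apply/eqP/andP => [h|[/eqP-> /eqP->]//].
have d0 : 0 < d by apply: leq_ltn_trans xd.
have -> : p = p' by rewrite -[LHS](divn_lit d0 p xd) h divn_lit.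
by have -> : x = x' by rewrite -[LHS](modn_lit p xd) h modn_lit.
Qed.

Record env1 s : Prop := Env1 {
  env_b : iv s v_base = b;
  env_n : iv s v_n = n;
  env_r : iv s v_r = r;
  env_m : iv s v_m = m;
  env_D : iv s v_D = D;
  env_rawi : ia s a_raw =1 raw_i;
  env_rawr : ra s a_raw =1 raw_r }.

Lemma env1_frame c s s' :
  frame c s s' ->
  [&& all [predC wiv c] [:: v_base; v_n; v_r; v_m; v_D], a_raw \notin wia c
    & a_raw \notin wra c] ->
  env1 s -> env1 s'.
Proof.
move=> F /and3P[/= /and5P[? ? ? ? /andP[? _]] ? ?] [? ? ? ? ? ? ?].
by split; rewrite ?(frame_iv F) ?(frame_ia F) ?(frame_ra F).
Qed.

Record env2 s : Prop := Env2 {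
  env21 :> env1 s;
  env_mulr : forall x, x < D -> ia s MUL_r x = x * r;
  env_mulD : forall x, x < D -> ia s MUL_D x = x * D }.

Lemma env2_frame c s s' :
  frame c s s' ->
  [&& all [predC wiv c] [:: v_base; v_n; v_r; v_m; v_D], a_raw \notin wia c
    & a_raw \notin wra c] && all [predC wia c] [:: MUL_r; MUL_D] ->
  env2 s -> env2 s'.
Proof.
move=> F /andP[h1 /= /and3P[? ? _]] [e1 e2 e3]; split; first exact: env1_frame F h1 e1.
  by move=> x xD; rewrite (frame_ia F) ?e2.
by move=> x xD; rewrite (frame_ia F) ?e3.
Qed.

Lemma env1_set s x k : x \notin [:: v_base; v_n; v_r; v_m; v_D] ->
  env1 s -> env1 (set_iv s x k).
Proof.
rewrite !inE !negb_or => /and5P[? ? ? ? ?] [? ? ? ? ? ? ?].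
by split=> //; rewrite /= ifN // eq_sym.
Qed.

Lemma env2_set s x k : x \notin [:: v_base; v_n; v_r; v_m; v_D] ->
  env2 s -> env2 (set_iv s x k).
Proof. by move=> xP [e1 e2 e3]; split=> //; exact: env1_set. Qed.

Lemma tables_ok s : env1 s -> env2 (eval tables s).
Proof.
move=> E; have E' : env1 (eval tables s).
  by exact: (env1_frame (eval_frame tables s) isT E).
split=> //; move: E'; rewrite /tables !eval_seq => E'.
all: set s1 := eval (ISet v_z _) _.
all: have [hD hr] : iv s1 v_D = D /\ iv s1 v_r = r by case: E => *; split.
all: have := @for_rule R (fun k s' => [/\ iv s' v_y = k * r, iv s' v_z = k * D,
  forall x, x < k -> ia s' MUL_r x = x * r & forall x, x < k -> ia s' MUL_D x = x * D])
  v_x v_D (IPut MUL_r 'v_x 'v_y ;; IPut MUL_D 'v_x 'v_z ;;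
    ISet v_y ('v_y .+ 'v_r) ;; ISet v_z ('v_z .+ 'v_D)) s1.
all: rewrite hD; case=> //.
all: move=> k s' kD F [I1 I2 I3 I4]; rewrite /=.
all: rewrite I1 I2 !(frame_iv F) // hD hr.
all: by split; [lia|lia|move=> x|move=> x]; rewrite ltnS; case: eqP => [->//|xk xk'];
  rewrite ?I3 ?I4 //; lia.
Qed.

Lemma cell_raw s x : env1 s -> x < b -> cell (iv s v_base) a_raw x = x.
Proof. by move=> E xb; rewrite (env_b E) /=; apply/minn_idPl; lia. Qed.

Definition edge_score k v w := raw_r (n * r + 1 + k * (r * r) + (v * r + w)).

Let E := edge_score.
Let S := score_matrix r el E.

Lemma lit_eq p v a : a < r -> (p == v * r + a) = (p %/ r == v) && (p %% r == a).
Proof. by move=> ar; rewrite {1}(divn_eq p r) pair_inj ?ltn_mod. Qed.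

(* The score matrix when [j] of the score pairs of edge [e] have been copied. *)
Definition partial_matrix e j p x :=
  if ((p %/ r, x %/ r) == edge el e) && (p %% r * r + x %% r < j) then
    E e (p %% r) (x %% r)
  else if ((x %/ r, p %/ r) == edge el e) && (x %% r * r + p %% r < j) then
    E e (x %% r) (p %% r)
  else S e p x.

(** The effect of [matrix_entry]: the new score pair is written in both orientations, which cannot
    coincide because the endpoints are increasing. *)
Lemma partial_matrixS e a c p x : e < m -> a < r -> c < r ->
  partial_matrix e (a * r + c).+1 p x =
  if (p == (edge el e).2 * r + c) && (x == (edge el e).1 * r + a) then E e a c
  else if (p == (edge el e).1 * r + a) && (x == (edge el e).2 * r + c) then E e a c
  else partial_matrix e (a * r + c) p x.
Proof.
move=> em ar cr; have elt : (edge el e).1 < (edge el e).2.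
  by apply: edge_lt => //; rewrite size_el.
rewrite /partial_matrix !lit_eq // !ltnS (leq_eqVlt (p %% r * r + _)) (leq_eqVlt (x %% r * r + _)).
rewrite !pair_inj ?ltn_mod // [edge el e]surjective_pairing !xpair_eqE /=.
move: (S e p x) (p %/ r) (p %% r) (x %/ r) (x %% r) elt => z pv pa xv xa.
move: (edge el e).1 (edge el e).2 => u v uv.
case: (eqVneq pv u) => [->|pu]; case: (eqVneq xv v) => [->|xv'] /=.
- rewrite (gtn_eqF uv) (ltn_eqF uv) /=.
  by case: eqP => [->|]; case: eqP => [->|].
- by rewrite (ltn_eqF uv) /= !andbF.
- by rewrite (gtn_eqF uv) /= !andbF.
- case: (eqVneq pv v) => _ /=; last by rewrite !andbF.
  case: (eqVneq xv u) => _ /=; last by rewrite !andbF.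
  by case: (eqVneq pa c) => [->|]; case: (eqVneq xa a) => [->|].
Qed.

Record matrix_inv e j s : Prop := MatrixInv {
  matrix_p : iv s v_p = n * r + 1 + e * (r * r) + j;
  matrix_mat : forall p x, p < D -> x < D ->
    ra s MAT (p * D + x) = partial_matrix e j p x }.

Lemma matrix_entry_ok e s : env2 s -> e < m ->
  iv s v_u = (edge el e).1 -> iv s v_v = (edge el e).2 ->
  iv s v_a < r -> iv s v_b < r ->
  matrix_inv e (iv s v_a * r + iv s v_b) s ->
  matrix_inv e (iv s v_a * r + iv s v_b).+1 (eval matrix_entry s).
Proof.
move=> H em hu hv ha hb [I1 I2].
have [elt eln] : (edge el e).1 < (edge el e).2 /\ (edge el e).2 < n.
  by split; [apply: edge_lt => //|apply/el_n/mem_nth]; rewrite size_el.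
have raw1 : minn (iv s v_p) (iv s v_base).-1 = iv s v_p.
  rewrite -[LHS]/(cell (iv s v_base) a_raw (iv s v_p)); apply: (cell_raw H).
  by rewrite I1 b_def /D; nia.
have raw2 : ra s a_raw (iv s v_p) = E e (iv s v_a) (iv s v_b).
  by rewrite (env_rawr H) I1 /E /edge_score.
have uD := @lit_lt (edge el e).1 (iv s v_a) _ ha.
have vD := @lit_lt (edge el e).2 (iv s v_b) _ hb.
rewrite /matrix_entry /= raw1 raw2 hu hv.
rewrite !(env_mulr H) ?vtx_lt //; try lia.
rewrite !(env_mulD H) ?uD ?vD //; try lia.
split=> /=; first by rewrite /upd /= I1; lia.
move=> p x pD xD; rewrite partial_matrixS // !pair_inj //; [|lia..].
by rewrite -I2.
Qed.

Definition adjn (u v : nat) := ((u, v) \in el) || ((v, u) \in el).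

Record env3 s : Prop := Env3 {
  env32 :> env2 s;
  env_mat : forall p x, p < D -> x < D -> ra s MAT (p * D + x) = S m p x;
  env_adj : forall u v, u < n -> v < n -> ia s ADJ (u * D + v) = adjn u v }.

(** Zero memory is the matrix of no edges. The two inner loops lead from [S e] to [S e.+1] through
    [partial_matrix], which is complete after r^2 pairs. *)
Lemma matrix_ok s : env2 s -> (forall x, ra s MAT x = 0%R) ->
  (forall x, ia s ADJ x = 0) ->
  env3 (eval matrix s).
Proof.
move=> H H1 H2; have H' : env2 (eval matrix s) by exact: (env2_frame (eval_frame matrix s) isT H).
rewrite /matrix eval_seq in H' *; set s1 := eval (ISet v_p _) s in H' *.
have K1 : env2 s1 by exact: env2_set.
set body := (ISet v_u _ ;; _).
pose Inv e s' := [/\ iv s' v_p = n * r + 1 + e * (r * r),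
  forall p x, p < D -> x < D -> ra s' MAT (p * D + x) = S e p x &
  forall u v, u < n -> v < n -> ia s' ADJ (u * D + v)
    = ((u, v) \in take e el) || ((v, u) \in take e el)].
suff : Inv (iv s1 v_m) (eval (For v_e v_m body) s1).
  rewrite (env_m K1) => -[I1 I2 I3]; split=> // u v un vn.
  by rewrite I3 // /adjn take_oversize ?size_el.
apply: for_rule.
  split=> [|p x _ _|u v _ _].
  - by rewrite /= (env_n H) (env_mulr H) ?vtx_lt //; lia.
  - exact: H1.
  - by rewrite take0 /= H2.
move=> e s'; rewrite (env_m K1) => em F [I1 I2 I3].
have K2 : env2 s' by apply: env2_frame F isT K1.
have [elt eln] : (edge el e).1 < (edge el e).2 /\ (edge el e).2 < n.
  by split; [apply: edge_lt => //|apply/el_n/mem_nth]; rewrite size_el.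
rewrite /body !eval_seq; set s2 := eval (ISet v_v _) _.
have hu : iv s2 v_u = (edge el e).1.
  rewrite /s2 /= (env_rawi K2) -raw_i1 //; congr raw_i.
  by apply: (cell_raw K2); rewrite b_def; lia.
have hv : iv s2 v_v = (edge el e).2.
  rewrite /s2 /= (env_rawi K2) -raw_i2 //; congr raw_i.
  by apply: (cell_raw K2); rewrite b_def; lia.
have K3 : env2 s2 by apply: env2_set => //; apply: env2_set => //; apply: env2_set.
have [J1 J2 J3] : [/\ iv s2 v_p = iv s' v_p, ia s2 ADJ = ia s' ADJ &
  ra s2 MAT = ra s' MAT] by [].
move: s2 hu hv K3 J1 J2 J3 => s2 hu hv K3 J1 J2 J3; set s4 := eval (IPut ADJ _ _) _.
have K4 : env2 s4.
  apply: (env2_frame (eval_frame _ _)) => //.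
  by apply: (env2_frame (eval_frame _ _)).
have A4 u v : u < n -> v < n -> ia s4 ADJ (u * D + v)
    = ((u, v) \in take e.+1 el) || ((v, u) \in take e.+1 el).
  move=> un vn; rewrite /s4 /= hu hv !(env_mulD K3) ?vtx_lt //; try lia.
  rewrite !pair_inj ?vtx_lt //; try lia.
  rewrite (take_nth (0, 0)) ?size_el // !mem_rcons !inE -/(edge el e).
  have XE x y : ((x, y) == edge el e) = (x == (edge el e).1) && (y == (edge el e).2).
    by case: (edge el e).
  rewrite !XE.
  rewrite J2 I3 // (andbC (v == _)).
  by case: (_ && _) => //; case: (_ && _); rewrite ?orbT.
set loop := For v_a v_r _.
have loopF := eval_frame loop s4.
have : matrix_inv e (iv s4 v_r * r) (eval loop s4).
  apply: (@for_rule _ (fun a s' => matrix_inv e (a * r) s')).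
    split; first by rewrite /= J1 I1; lia.
    move=> p x pD xD; rewrite /partial_matrix !ltn0 !andbF /= J3; exact: I2.
  move=> a s5; rewrite (env_r K4) => ar Fa Ia.
  have Ka : env2 s5 by apply: env2_frame Fa isT K4.
  have -> : a.+1 * r = a * r + iv (set_iv s5 v_a a) v_r.
    by rewrite [iv _ _]/= (env_r Ka); lia.
  apply: (@for_rule _ (fun c s' => matrix_inv e (a * r + c) s')).
    by rewrite addn0; case: Ia => G1 G2; split.
  move=> c s6; rewrite [iv _ _]/= (env_r Ka) => cr Fc Ic.
  have Kc : env2 s6 by apply: (env2_frame Fc) => //; apply: env2_set.
  have hc1 : iv s6 v_u = (edge el e).1.
    by rewrite (frame_iv Fc) // [iv _ _]/= (frame_iv Fa).
  have hc2 : iv s6 v_v = (edge el e).2.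
    by rewrite (frame_iv Fc) // [iv _ _]/= (frame_iv Fa).
  have hc3 : iv s6 v_a = a by rewrite (frame_iv Fc).
  have := @matrix_entry_ok e (set_iv s6 v_b c).
  rewrite [iv _ v_u]/= [iv _ v_v]/= [iv _ v_a]/= [iv _ v_b]/= hc3 hc1 hc2 addnS.
  apply=> //; first exact: env2_set.
  by case: Ic => G1 G2; split.
rewrite (env_r K4) => -[G1 G2]; split.
- by rewrite G1; lia.
- move=> p x pD xD; rewrite G2 // /partial_matrix.
  have lt c c' : c %% r * r + c' %% r < r * r.
    have := ltn_pmod c r_gt0; have := ltn_pmod c' r_gt0; nia.
  by rewrite !lt !andbT.
- by move=> u v un vn; rewrite (frame_ia loopF) // A4.
Qed.
Lemma env3_frame c s s' :
  frame c s s' ->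
  [&& [&& all [predC wiv c] [:: v_base; v_n; v_r; v_m; v_D], a_raw \notin wia c
    & a_raw \notin wra c] && all [predC wia c] [:: MUL_r; MUL_D],
   ADJ \notin wia c & MAT \notin wra c] ->
  env3 s -> env3 s'.
Proof.
move=> F /and3P[h1 h2 h3] [e1 e2 e3]; split; first exact: env2_frame F h1 e1.
  by rewrite (frame_ra F).
by rewrite (frame_ia F).
Qed.

Lemma env3_set s x k : x \notin [:: v_base; v_n; v_r; v_m; v_D] ->
  env3 s -> env3 (set_iv s x k).
Proof. by move=> xP [e1 e2 e3]; split=> //; exact: env2_set. Qed.

Lemma root_table_ok s : env2 s -> let s' := eval root_table s in
  (forall x, x < n * r -> ra s' TAB x = raw_r x.+1) /\ ra s' TAB (n * r) = raw_r 0.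
Proof.
move=> H; rewrite /root_table !eval_seq.
set loop := For v_x v_D _.
have F := eval_frame loop s.
have K : env2 (eval loop s) := env2_frame F isT H.
have : forall x, x < n * r -> x < iv s v_D -> ra (eval loop s) TAB x = raw_r x.+1.
  apply: (@for_rule _ (fun k s' => forall x, x < n * r -> x < k ->
    ra s' TAB x = raw_r x.+1)) => //.
  move=> k s'; rewrite (env_D H) => kn Fk I x xn.
  have Kk := env2_frame Fk isT H.
  rewrite ltnS /=; case: eqP => [xk _|xk xk']; last by apply: I; lia.
  rewrite (env_rawr Kk) (env_b Kk) -xk addn1; congr raw_r.
  by apply/minn_idPl; move: D_gt; rewrite b_def; lia.
rewrite (env_D H) => I; split=> [x xn|] /=; rewrite (env_n K) (env_mulr K) ?vtx_lt //.
  by case: eqP => [?|_]; [lia|apply: I => //; exact: ltn_trans D_gt].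
by rewrite eqxx (env_rawr K) min0n.
Qed.

Lemma adjn_sym : symmetric adjn.
Proof. by move=> u v; rewrite /adjn orbC. Qed.

Lemma adjn_irr : irreflexive adjn.
Proof.
by move=> u; rewrite /adjn orbb; apply/negP => /el_lt; rewrite ltnn.
Qed.

Definition alive s := [seq v <- iota 0 n | ia s DEAD v == 0].

Lemma mem_alive s v : (v \in alive s) = (ia s DEAD v == 0) && (v < n).
Proof. by rewrite mem_filter mem_iota. Qed.

Lemma vertex_degree_ok s : env3 s -> iv s v_v < n ->
  iv (eval vertex_degree s) v_deg = degree adjn (alive s) (iv s v_v).
Proof.
move=> H vn; rewrite /vertex_degree eval_seq; set s1 := eval (ISet _ _) s.
have K : env3 s1 by exact: env3_set.
have : iv (eval (For v_u v_n (ISet v_deg ('v_deg .+ (ADJ ! (MUL_D ! 'v_v .+ 'v_u) .- DEAD ! 'v_u)))) s1) v_deg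
  = count (fun u => adjn (iv s v_v) u && (ia s DEAD u == 0)) (iota 0 (iv s1 v_n)).
  apply: (@for_rule _ (fun k s' => iv s' v_deg = count _ (iota 0 k))) => // k s'.
  rewrite (env_n K) => kn F I; have K' := env3_frame F isT K.
  rewrite -[k.+1]addn1 iotaD count_cat -I /= addn0 add0n; congr addn.
  rewrite (frame_iv F) // [iv s1 _]/= (env_mulD K') ?vtx_lt 1?ltnW //.
  rewrite (env_adj K') // (frame_ia F) //= -/(adjn _ _).
  by case: (adjn _ _); case: (ia s 5 k).
rewrite (env_n K) => ->; rewrite /degree /alive count_filter.
by apply: eq_count => u.
Qed.

Lemma scan_ok s s' (deg := degree adjn (alive s)) :
  env3 s -> alive s != [::] -> s' = eval scan s ->
  if iv s' v_lo < n then iv s' v_lo \in alive s /\ deg (iv s' v_lo) <= 1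
  else iv s' v_hi \in alive s /\
    {in alive s, forall u, 2 <= deg u <= deg (iv s' v_hi)}.
Proof.
move=> H ne ->; rewrite /scan !eval_seq; set s1 := eval (ISet v_max _) _.
have K : env3 s1 by do 3 (apply: env3_set => //).
set loop := For v_v v_n _.
(* The last clause has two cases because [v_hi] designates a living vertex only once one has been
   scanned; until then [v_max] is 0, below any degree. *)
pose Inv k s2 := [/\ (iv s2 v_lo < n -> iv s2 v_lo \in alive s /\ deg (iv s2 v_lo) <= 1),
  (n <= iv s2 v_lo -> forall u, u < k -> u \in alive s -> 2 <= deg u),
  (forall u, u < k -> u \in alive s -> deg u <= iv s2 v_max) &
  (iv s2 v_hi \in alive s /\ iv s2 v_max = deg (iv s2 v_hi)) \/
  (iv s2 v_max = 0 /\ forall u, u < k -> u \notin alive s)].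
suff : Inv (iv s1 v_n) (eval loop s1).
  move: (eval loop s1) => s2; rewrite (env_n K) => -[I1 I2 I3 I4]; case: ltnP => [/I1//|/I2 lo].
  have aln u : u \in alive s -> u < n by rewrite mem_alive => /andP[].
  case: I4 => [[hi1 hi2]|[_ no]].
    split=> // u ua; rewrite -hi2 lo ?I3 //; exact: aln.
  case: (alive s) ne aln no => // u l _ /(_ u (mem_head _ _)) un /(_ u un).
  by rewrite mem_head.
apply: (@for_rule _ Inv); first by split=> //=; [rewrite (env_n H); lia|right].
move=> k s2; rewrite (env_n K) => kn F [I1 I2 I3 I4].
have K2 : env3 s2 by exact: env3_frame F isT K.
have D2 : ia s2 DEAD = ia s DEAD by rewrite (frame_ia F).
set s3 := set_iv s2 v_v k; have K3 : env3 s3 by exact: env3_set.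
have A3 : alive s3 = alive s by rewrite /alive /= D2.
have kin : (k \in alive s) = (ia s DEAD k == 0) by rewrite mem_alive kn andbT.
rewrite eval_ifi [ieval #0 _]/= leqn0.
have -> : (ieval (DEAD ! 'v_v) s3 == 0) = (k \in alive s) by rewrite /= D2.
case: ifP => ka; last first.
  rewrite /nop; split=> //= [h u|u|].
  - by rewrite ltnS leq_eqVlt => /orP[/eqP->|]; [rewrite ka|exact: I2].
  - by rewrite ltnS leq_eqVlt => /orP[/eqP->|]; [rewrite ka|exact: I3].
  - case: I4 => [?|[? I4]]; [by left|right; split=> // u].
    by rewrite ltnS leq_eqVlt => /orP[/eqP->|/I4]; rewrite ?ka.
rewrite (eval_seq vertex_degree) (eval_seq (IfI _ _ _ _)); set s4 := eval vertex_degree s3.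
have dk : iv s4 v_deg = deg k by rewrite /s4 vertex_degree_ok // /deg A3.
have vk : iv s4 v_v = k by rewrite /s4 eval_iv.
have lo4 : iv s4 v_lo = iv s2 v_lo by rewrite /s4 eval_iv.
have hi4 : iv s4 v_hi = iv s2 v_hi by rewrite /s4 eval_iv.
have mx4 : iv s4 v_max = iv s2 v_max by rewrite /s4 eval_iv.
move: s4 dk vk lo4 hi4 mx4 => s4 dk vk lo4 hi4 mx4.
set s5 := eval (IfI _ #1 _ _) s4.
have [lo5 hi5 mx5 dk5] : [/\ iv s5 v_lo = if deg k <= 1 then k else iv s2 v_lo,
    iv s5 v_hi = iv s2 v_hi, iv s5 v_max = iv s2 v_max & iv s5 v_deg = deg k /\ iv s5 v_v = k].
  by rewrite /s5 eval_ifi /nop /= dk; case: ifP => _ /=; rewrite ?vk ?hi4 ?mx4 ?lo4 ?dk.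
move: s5 lo5 hi5 mx5 dk5 => s5 lo5 hi5 mx5 [dk5 vk5].
rewrite eval_ifi; set s6 := if _ then _ else _.
have [lo6 hi6 mx6] : [/\ iv s6 v_lo = if deg k <= 1 then k else iv s2 v_lo,
    iv s6 v_hi = if iv s2 v_max <= deg k then k else iv s2 v_hi &
    iv s6 v_max = if iv s2 v_max <= deg k then deg k else iv s2 v_max].
  by rewrite /s6 /nop /= mx5 dk5; case: ifP => _ /=; rewrite ?vk5 ?hi5 ?mx5 ?lo5 ?dk5.
rewrite /Inv lo6 hi6 mx6; split.
- by case: ifP => [dk1 _|_ /I1].
- case: ifP => [_|dk1 h u]; first lia.
  by rewrite ltnS leq_eqVlt => /orP[/eqP->|]; [rewrite ltnNge dk1|exact: I2].
- move=> u; rewrite ltnS leq_eqVlt => /orP[/eqP-> _|uk ua]; first by case: (leqP (iv s2 _)) => // /ltnW.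
  by have := I3 u uk ua; case: (leqP (iv s2 _)) => // h1 h2; exact: leq_trans h1.
- case: (leqP (iv s2 _)) => h; first by left.
  by left; case: I4 => [//|[mx0 _]]; rewrite mx0 in h.
Qed.
(** The size clause guarantees that each of the n rounds finds a living vertex and that none remains
    afterwards. *)
Record greedy_state t bs fs s : Prop := GreedyState {
  gs_k : iv s v_k = size bs;
  gs_l : iv s v_l = size fs;
  gs_bra : forall i, i < size bs -> ia s BRA i = nth 0 bs i;
  gs_for : forall j, j < size fs -> ia s FOR j = nth 0 fs j;
  gs_rank : forall j, j < size fs -> ia s RANK (nth 0 fs j) = j.+1;
  gs_rank0 : forall v, v \notin fs -> ia s RANK v = 0;
  gs_inv : greedy_inv R adjn (iota 0 n) bs fs (alive s);
  gs_size : size (alive s) = n - t }.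

Lemma greedy_state_uniq t bs fs s : greedy_state t bs fs s ->
  uniq (bs ++ fs ++ alive s).
Proof. by case=> _ _ _ _ _ _ [h _ _] _; rewrite -(perm_uniq h) iota_uniq. Qed.

Lemma kill_alive s s' v : v \in alive s ->
  ia s' DEAD = upd (ia s DEAD) v 1 ->
  perm_eq (alive s) (v :: alive s') /\ size (alive s') = (size (alive s)).-1.
Proof.
move=> va hD; have -> : alive s' = rem v (alive s).
  rewrite rem_filter ?filter_uniq ?iota_uniq // /alive -filter_predI hD.
  by apply: eq_filter => u /=; case: (u == v).
by rewrite perm_to_rem // size_rem.
Qed.

Lemma greedy_ok s : env3 s -> (forall v, ia s DEAD v = 0) ->
  (forall v, ia s RANK v = 0) ->
  exists bs fs, greedy_state n bs fs (eval greedy s).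
Proof.
move=> H H1 H2; rewrite /greedy !eval_seq; set s1 := eval (ISet v_l _) _.
have K : env3 s1 by do 2 (apply: env3_set => //).
rewrite -[X in greedy_state X](env_n K).
set loop := For v_t v_n _.
apply: (@for_rule _ (fun t s' => exists bs fs, greedy_state t bs fs s')).
  exists [::], [::].
  have A : alive s1 = iota 0 n.
    by rewrite /alive /= (eq_filter (a2 := predT)) ?filter_predT // => v; rewrite H1.
  split=> //; [by move=> v _; exact: H2| |by rewrite A size_iota subn0].
  by rewrite A; split=> //; rewrite add0r.
move=> t s2; rewrite (env_n K) => tn F [bs [fs G]].
have K2 := env3_frame F isT K.
set s3 := set_iv s2 v_t t; rewrite eval_seq; set s4 := eval scan s3.
have K3 : env3 s3 by exact: env3_set.
have F4 := eval_frame scan s3.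
have A3 : alive s3 = alive s2 by [].
have ne : alive s3 != [::].
  by apply/eqP => h; have := gs_size G; rewrite -A3 h /=; lia.
have := scan_ok K3 ne (erefl s4).
have K4 : env3 s4 := env3_frame F4 isT K3.
have fr := (frame_ia F4, frame_iv F4).
have bra4 : ia s4 BRA = ia s2 BRA by rewrite fr.
have for4 : ia s4 FOR = ia s2 FOR by rewrite fr.
have rank4 : ia s4 RANK = ia s2 RANK by rewrite fr.
have dead4 : ia s4 DEAD = ia s2 DEAD by rewrite fr.
have k4 : iv s4 v_k = size bs by rewrite fr //= (gs_k G).
have l4 : iv s4 v_l = size fs by rewrite fr //= (gs_l G).
have A4 : alive s4 = alive s2 by rewrite /alive dead4.
rewrite A3 -A4; move: s4 K4 bra4 for4 rank4 dead4 k4 l4 A4 {F4 fr}.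
move=> s4 K4 bra4 for4 rank4 dead4 k4 l4 A4.
rewrite eval_ifi [ieval _ _]/= [ieval _ _]/= (env_n K4) (leqNgt n (iv s4 v_lo)) if_neg.
case: ifP => lo [va dv]; set s5 := eval _ _.
- have [p5 z5] := @kill_alive s4 s5 _ va erefl.
  have vfs : iv s4 v_lo \notin fs.
    have := greedy_state_uniq G; rewrite !cat_uniq => /and3P[_ _ /and3P[_ /hasPn h _]].
    by apply: h; rewrite -A4.
  exists bs, (rcons fs (iv s4 v_lo)); split.
  + by rewrite /s5 /= k4.
  + by rewrite /s5 /= l4 size_rcons addn1.
  + by move=> i ih; rewrite /s5 /= bra4 (gs_bra G).
  + move=> j; rewrite size_rcons ltnS nth_rcons /s5 /= l4 for4.
    by case: (ltngtP j (size fs)) => // h _; rewrite (gs_for G).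
  + move=> j; rewrite size_rcons ltnS nth_rcons /s5 /= l4 rank4 addn1.
    case: (ltngtP j (size fs)) => // [h _|-> _]; last by rewrite eqxx.
    case: eqP => [e|_]; last by rewrite (gs_rank G).
    by move: vfs; rewrite -e mem_nth.
  + move=> v; rewrite mem_rcons inE negb_or => /andP[v1 v2].
    by rewrite /s5 /= (negPf v1) rank4 (gs_rank0 G).
  + by apply: greedy_low p5 dv; [exact: adjn_irr|rewrite A4; exact: gs_inv G].
  + by rewrite z5 A4 (gs_size G); lia.
- have [p5 z5] := @kill_alive s4 s5 _ va erefl.
  exists (rcons bs (iv s4 v_hi)), fs; split.
  + by rewrite /s5 /= k4 size_rcons addn1.
  + by rewrite /s5 /= l4.
  + move=> i; rewrite size_rcons ltnS nth_rcons /s5 /= k4 bra4.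
    by case: (ltngtP i (size bs)) => // h _; rewrite (gs_bra G).
  + by move=> j jh; rewrite /s5 /= for4 (gs_for G).
  + by move=> j jh; rewrite /s5 /= rank4 (gs_rank G).
  + by move=> v vh; rewrite /s5 /= rank4 (gs_rank0 G).
  + by apply: greedy_high p5 dv; [exact: adjn_sym|exact: adjn_irr|rewrite A4; exact: gs_inv G].
  + by rewrite z5 A4 (gs_size G); lia.
Qed.

(* Parent [n] is the dummy vertex: no neighbour is left in the forest. *)
Definition parent_spec (fs : seq nat) j w :=
  (w = n \/ exists2 j', j < j' < size fs & w = nth 0 fs j') /\
  forall j', j < j' < size fs -> adjn (nth 0 fs j) (nth 0 fs j') -> w = nth 0 fs j'.

Lemma count_le1_inj (T : eqType) (p : pred T) (L : seq T) x y :
  count p L <= 1 -> x \in L -> y \in L -> p x -> p y -> x = y.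
Proof.
move=> h xL yL px py.
have : x \in filter p L by rewrite mem_filter px.
have : y \in filter p L by rewrite mem_filter py.
rewrite -size_filter in h; case: (filter p L) h => // z [|//] _.
by rewrite !inE => /eqP-> /eqP->.
Qed.

(** By [greedy_inv] a forest vertex has at most one later neighbour in the forest, so the one that
    the loop finds is the only one. *)
Lemma parents_ok s bs fs : env3 s -> greedy_state n bs fs s ->
  forall j, j < size fs -> parent_spec fs j (ia (eval parents s) PAR j).
Proof.
move=> H G; have [hp hpot hcount] := gs_inv G.
have A0 : alive s = [::] by apply/size0nil; rewrite (gs_size G) subnn.
rewrite A0 in hp hcount; rewrite cats0 in hp.
have fs_lt v : v \in fs -> v < n.
  by move=> vf; have := perm_mem hp v; rewrite mem_cat vf orbT mem_iota.
rewrite /parents -[size fs](gs_l G).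
apply: (@for_rule _ (fun k s' => forall j, j < k -> parent_spec fs j (ia s' PAR j))) => //.
move=> j s1; rewrite (gs_l G) => jf F I.
have K1 := env3_frame F isT H.
have vn : nth 0 fs j < n by apply/fs_lt/mem_nth.
set s2 := set_iv s1 v_j j; rewrite !eval_seq; set s3 := eval (ISet v_w _) _.
have K3 : env3 s3 by do 3 (apply: env3_set => //).
have v3 : iv s3 v_v = nth 0 fs j by rewrite /= (frame_ia F) // (gs_for G).
have j3 : iv s3 v_j = j by [].
have w3 : iv s3 v_w = n by rewrite /= (env_n K1).
have rank3 : ia s3 RANK = ia s RANK by rewrite /= (frame_ia F).
have par3 : ia s3 PAR = ia s1 PAR by [].
move: s3 K3 v3 j3 w3 rank3 par3 => s3 K3 v3 j3 w3 rank3 par3.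
set loop := For v_u v_n _; have F3 := eval_frame loop s3.
pose good u := (j.+2 <= ia s RANK u) && adjn (nth 0 fs j) u.
have goodP u : good u -> exists2 j', j < j' < size fs & u = nth 0 fs j'.
  case/andP=> ru _; have uf : u \in fs.
    by apply: contraTT ru => uf; rewrite (gs_rank0 G).
  exists (index u fs); last by rewrite nth_index.
  by move: ru; rewrite -{1}(nth_index 0 uf) (gs_rank G) index_mem uf ?andbT.
have good_uniq u u' : good u -> good u' -> u = u'.
  move=> gu gu'; have [j1 /andP[h1 h1'] e1] := goodP u gu.
  have [j2 /andP[h2 h2'] e2] := goodP u' gu'.
  have inD i : j < i -> i < size fs -> nth 0 fs i \in drop j.+1 fs ++ [::].
    move=> ji ifs; rewrite cats0 -[i](subnKC ji) -nth_drop mem_nth //.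
    by rewrite size_drop ltn_sub2r //; exact: leq_ltn_trans ifs.
  apply: (count_le1_inj (hcount j jf)); rewrite ?e1 ?e2 ?inD //.
  - by case/andP: gu; rewrite e1.
  - by case/andP: gu'; rewrite e2.
have : (iv (eval loop s3) v_w = n /\ forall u, u < iv s3 v_n -> ~~ good u) \/
    (iv (eval loop s3) v_w < n /\ good (iv (eval loop s3) v_w)).
  apply: (@for_rule _ (fun k s' => (iv s' v_w = n /\ forall u, u < k -> ~~ good u) \/
    (iv s' v_w < n /\ good (iv s' v_w)))); first by left.
  move=> k s4; rewrite (env_n K3) => kn F4 I4.
  have K4 := env3_frame F4 isT K3.
  have r4 : ia s4 RANK k = ia s RANK k by rewrite (frame_ia F4) // rank3.
  have v4 : iv s4 v_v = nth 0 fs j by rewrite (frame_iv F4).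
  have j4 : iv s4 v_j = j by rewrite (frame_iv F4).
  set s5 := eval _ _; have w5 : iv s5 v_w = if good k then k else iv s4 v_w.
    have vD := vtx_lt (ltnW vn).
    rewrite /s5 /nop /= v4 j4 r4 (env_mulD K4) // (env_adj K4) // addn2 /good; case: ltnP => _ //=.
    by case: (adjn _ _).
  rewrite w5; case: ifP => gk; first by right.
  case: I4 => [[w4 no]|]; last by right.
  left; split=> // u; rewrite ltnS leq_eqVlt => /orP[/eqP->|]; last exact: no.
  by rewrite gk.
set s4 := eval loop s3 => W.
have par4 : ia s4 PAR = ia s1 PAR by rewrite (frame_ia F3).
have j4 : iv s4 v_j = j by rewrite (frame_iv F3).
move=> j' /=; rewrite j4 ltnS; case: eqP => [-> _|jj h]; last first.
  by rewrite par4; apply: I; lia.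
move: W; rewrite (env_n K3) => -[[w4 no]|[w4 gw]]; split.
- by left.
- move=> i /andP[h1 h2] ad; have := no (nth 0 fs i).
  by rewrite fs_lt ?mem_nth // /good (gs_rank G) // ltnS h1 ad => /(_ isT).
- by right; exact: goodP.
- move=> i /andP[h1 h2] ad; apply: good_uniq => //.
  by rewrite /good (gs_rank G) // ltnS h1 ad.
Qed.
Lemma heap_size_ok s k : iv s v_r = r -> iv s v_k = k -> let s' := eval heap_size s in
  [/\ iv s' v_Q = level r k, iv s' v_QT = level r k.+1 & iv s' v_NL = r ^ k].
Proof.
move=> hr hk; rewrite /heap_size !eval_seq.
set s1 := eval (ISet v_Q _) s; set loop := For v_t v_k _.
have F := eval_frame loop s1.
have : iv (eval loop s1) v_Q = level r (iv s1 v_k).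
  apply: (@for_rule _ (fun t s' => iv s' v_Q = level r t)) => // t s2 _ F2 I.
  rewrite !eval_seq; set s3 := eval (For _ _ _) _.
  have h3 : iv s3 v_y = r * level r t by rewrite /s3 sum_loop //= (frame_iv F2) //= hr I.
  by rewrite /= h3 /=; lia.
set s2 := eval loop s1 => h2.
have r2 : iv s2 v_r = r by rewrite (frame_iv F).
set s3 := eval (For _ _ _) _.
have h3 : iv s3 v_y = r * level r k by rewrite /s3 sum_loop //= h2 r2 /= hk.
have q3 : iv s3 v_Q = level r k by rewrite /s3 eval_iv //= h2 /= hk.
have QE : r * level r k + 1 = level r k.+1 by rewrite addn1 mulnC.
by split; [exact: q3|rewrite /= h3 QE|rewrite [LHS]/= h3 q3 QE (levelS r_gt0) addKn].
Qed.

Lemma offsets_ok s : iv s v_D = D -> forall q, q < iv s v_QT ->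
  ia (eval offsets s) OFF q = q * D.
Proof.
move=> hD; rewrite /offsets !eval_seq; set s1 := eval (ISet v_z _) s.
set loop := For v_q v_QT _.
have : iv (eval loop s1) v_z = iv s1 v_QT * D /\
    forall q, q < iv s1 v_QT -> ia (eval loop s1) OFF q = q * D.
  apply: (@for_rule _ (fun k s' => iv s' v_z = k * D /\
    forall q, q < k -> ia s' OFF q = q * D)) => // k s2 _ F [I1 I2] /=; rewrite (frame_iv F (x := v_D)) //= I1 hD.
  split=> [|q]; first lia.
  by rewrite ltnS; case: eqP => [-> //|qk qk']; apply: I2; lia.
by case.
Qed.

(** * The search tree and the forests at its leaves *)

Section Search.
Variables bs fs : seq nat.
Hypothesis vtx_perm : perm_eq (iota 0 n) (bs ++ fs).
Let k := size bs.
Let l := size fs.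

Let vtx_uniq : uniq (bs ++ fs).
Proof. by rewrite -(perm_uniq vtx_perm) iota_uniq. Qed.

Let mem_vtx v : (v \in bs ++ fs) = (v < n).
Proof. by rewrite -(perm_mem vtx_perm) mem_iota. Qed.

Definition total (phi : nat -> nat) : R :=
  (raw_r 0 + \sum_(v <- iota 0 n) raw_r (v * r + phi v).+1
   + \sum_(i < m) E i (phi (edge el i).1) (phi (edge el i).2))%R.

Let csp_energy := energy r (S m).
Let valid := valid r n.

Lemma S_sym p x : S m p x = S m x p.
Proof. by apply: score_matrix_sym => //; rewrite size_el. Qed.

Lemma S_diag v a c : a < r -> c < r -> S m (v * r + a) (v * r + c) = 0%R.
Proof.
move=> ar cr; rewrite /S score_matrix0 ?size_el // !divn_lit //.
  by apply/negP => /mem_take /el_lt; rewrite ltnn.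
by apply/negP => /mem_take /el_lt; rewrite ltnn.
Qed.

Lemma S_nonadj u v a c : a < r -> c < r -> ~~ adjn u v ->
  S m (u * r + a) (v * r + c) = 0%R.
Proof.
move=> ar cr; rewrite negb_or => /andP[h1 h2].
by rewrite /S score_matrix0 ?size_el // !divn_lit // take_oversize ?size_el.
Qed.

Lemma energy_ext T T' L phi : {in L, forall u, T (u * r + phi u) = T' (u * r + phi u)} ->
  csp_energy T L phi = csp_energy T' L phi.
Proof.
by move=> h; rewrite /csp_energy /energy (eq_big_seq _ h).
Qed.

Lemma tail_uniq i : uniq (drop i bs ++ fs ++ [:: n]).
Proof.
rewrite catA cat_uniq /= andbT orbF; apply/andP; split.
  by apply: subseq_uniq vtx_uniq; rewrite cat_subseq ?drop_subseq.
apply/negP; rewrite mem_cat => nL; have := mem_vtx n; rewrite ltnn mem_cat.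
by case/orP: nL => [/mem_drop|] ->; rewrite ?orbT.
Qed.

Lemma tail_lt i u : u \in drop i bs ++ fs ++ [:: n] -> u <= n.
Proof.
rewrite !mem_cat inE => /or3P[/mem_drop ub|uf|/eqP-> //].
  by apply: ltnW; rewrite -mem_vtx mem_cat ub.
by apply: ltnW; rewrite -mem_vtx mem_cat uf orbT.
Qed.

(* [w] lists the values given to the first [size w] branching vertices; [T] is the
   score table conditioned on them. *)
Record node_ok (w : seq nat) (lev : nat) (phi : nat -> nat) (T : nat -> R) : Prop :=
  NodeOk {
  node_lev : lev = size w;
  node_bra : forall i, i < size w -> phi (nth 0 bs i) = nth 0 w i;
  node_lt : forall v, v <= n -> phi v < r;
  node_dummy : phi n = 0;
  node_total : forall f, valid f ->
    (forall i, i < size w -> f (nth 0 bs i) = nth 0 w i) ->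
    total f = csp_energy T (drop (size w) bs ++ fs ++ [:: n]) f }.

Lemma node_ok_ext w lev lev' phi phi' T T' : lev = lev' ->
  (forall x, x < D -> phi x = phi' x) -> (forall x, x < D -> T x = T' x) ->
  node_ok w lev phi T -> node_ok w lev' phi' T'.
Proof.
move=> -> hphi hT [h1 h2 h3 h4 h5].
have bs_lt i : nth 0 bs i < D.
  have [ib|ib] := ltnP i (size bs); last by rewrite nth_default // /D muln_gt0 r_gt0.
  by apply/vtx_lt/ltnW; rewrite -mem_vtx mem_cat mem_nth.
split=> //.
- by move=> i iw; rewrite -hphi // h2.
- by move=> v vn; rewrite -hphi ?h3 ?vtx_lt.
- by rewrite -hphi ?vtx_lt.
- move=> f hf hw; rewrite h5 //; apply: energy_ext => u uL; apply: hT.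
  apply: lit_lt; last by case: hf.
  exact: tail_lt uL.
Qed.

Lemma root_ok phi T : (forall v, v <= n -> phi v = 0) ->
  (forall x, x < n * r -> T x = raw_r x.+1) -> T (n * r) = raw_r 0 ->
  node_ok [::] 0 phi T.
Proof.
move=> hphi hT hT0; split=> //; [by move=> v /hphi ->|exact: hphi|].
move=> f [hf fn] _; rewrite drop0 catA /csp_energy.
have hp : perm_eq ((bs ++ fs) ++ [:: n]) (iota 0 n ++ [:: n]).
  by rewrite perm_cat2r perm_sym.
rewrite (energy_perm _ _ _ _ hp) /energy.
rewrite /S score_matrix_sum ?size_el //; last first.
- move=> e eel; have h1 := el_lt eel; have h2 := el_n eel.
  by rewrite !mem_cat !mem_iota !add0n h2 (ltn_trans h1 h2).
- by rewrite cat_uniq iota_uniq /= mem_iota ltnn andbF.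
rewrite mulrA mulVf ?pnatr_eq0 // mul1r /total; congr (_ + _)%R.
rewrite big_cat big_seq1 fn addn0 hT0 addrC /=; congr (_ + _)%R.
apply: eq_big_seq => v; rewrite mem_iota add0n => /andP[_ vn]; rewrite hT //.
by have := hf v; nia.
Qed.

Lemma child_node_ok w lev phi T a lev' phi' T' (v := nth 0 bs (size w)) :
  node_ok w lev phi T -> size w < k -> a < r -> lev' = lev.+1 ->
  (forall u, u <= n -> phi' u = if u == v then a else phi u) ->
  (forall x, x < n * r -> T' x = (T x + S m (v * r + a) x)%R) ->
  T' (n * r) = (T (n * r) + S m (v * r + a) (n * r) + T (v * r + a))%R ->
  node_ok (rcons w a) lev' phi' T'.
Proof.
case=> h1 h2 h3 h4 h5 wk ar -> hphi hT hTn.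
have vn : v < n by rewrite -mem_vtx mem_cat mem_nth.
have bs_lt i : i < size bs -> nth 0 bs i < n.
  by move=> ib; rewrite -mem_vtx mem_cat mem_nth.
have bs_uniq : uniq bs by move: vtx_uniq; rewrite cat_uniq => /andP[].
split.
- by rewrite size_rcons h1.
- move=> i; rewrite size_rcons ltnS => iw; rewrite hphi; last first.
    by apply/ltnW/bs_lt/(leq_ltn_trans iw).
  rewrite nth_rcons nth_uniq //; last exact: leq_ltn_trans wk.
  case: (ltngtP i (size w)) iw => // iw _; exact: h2.
- by move=> u un; rewrite hphi //; case: ifP => // _; exact: h3.
- by rewrite hphi // h4 gtn_eqF.
move=> f hf hw; rewrite h5 //; last first.
  move=> i iw; have := hw i; rewrite size_rcons nth_rcons iw; apply; exact: ltnW.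
have fv : f v = a.
  by have := hw (size w); rewrite size_rcons nth_rcons ltnn eqxx; apply.
rewrite size_rcons (drop_nth 0 wk) cat_cons -/v /csp_energy.
apply: energy_branch; rewrite ?fv //.
- exact: S_sym.
- exact: S_diag.
- exact: hf.
- exact: tail_uniq.
- by rewrite !mem_cat inE eqxx !orbT.
- exact: tail_lt.
- by move=> u c un cr; rewrite hT //; nia.
- exact: hTn.
Qed.
Record env4 s : Prop := Env4 {
  env43 :> env3 s;
  env_k : iv s v_k = k;
  env_l : iv s v_l = l;
  env_Q : iv s v_Q = level r k;
  env_QT : iv s v_QT = level r k.+1;
  env_NL : iv s v_NL = r ^ k;
  env_bra : forall i, i < k -> ia s BRA i = nth 0 bs i;
  env_for : forall j, j < l -> ia s FOR j = nth 0 fs j;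
  env_par : forall j, j < l -> parent_spec fs j (ia s PAR j);
  env_off : forall q, q < level r k.+1 -> ia s OFF q = q * D }.

Lemma env4_frame c s s' :
  frame c s s' ->
  [&& [&& all [predC wiv c] [:: v_base; v_n; v_r; v_m; v_D], a_raw \notin wia c
    & a_raw \notin wra c] && all [predC wia c] [:: MUL_r; MUL_D],
   ADJ \notin wia c & MAT \notin wra c] &&
  (all [predC wiv c] [:: v_k; v_l; v_Q; v_QT; v_NL] &&
  all [predC wia c] [:: BRA; FOR; PAR; OFF]) ->
  env4 s -> env4 s'.
Proof.
move=> F /andP[h1 /andP[/= /and5P[? ? ? ? /andP[? _]] /and5P[? ? ? ? _]]].
case=> e1 e2 e3 e4 e5 e6 e7 e8 e9 e10; split.
- exact: env3_frame F h1 e1.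
all: by rewrite ?(frame_iv F) ?(frame_ia F).
Qed.

Lemma env4_eval c s :
  [&& [&& all [predC wiv c] [:: v_base; v_n; v_r; v_m; v_D], a_raw \notin wia c
    & a_raw \notin wra c] && all [predC wia c] [:: MUL_r; MUL_D],
   ADJ \notin wia c & MAT \notin wra c] &&
  (all [predC wiv c] [:: v_k; v_l; v_Q; v_QT; v_NL] &&
  all [predC wia c] [:: BRA; FOR; PAR; OFF]) ->
  env4 s -> env4 (eval c s).
Proof. exact: env4_frame (eval_frame c s). Qed.

Lemma env4_set s x v : x \notin [:: v_base; v_n; v_r; v_m; v_D] ->
  x \notin [:: v_k; v_l; v_Q; v_QT; v_NL] -> env4 s -> env4 (set_iv s x v).
Proof.
move=> h1; rewrite !inE !negb_or => /and5P[? ? ? ? ?].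
case=> e1 e2 e3 e4 e5 e6 e7 e8 e9 e10; split=> //; first exact: env3_set.
all: by rewrite /= ifN // eq_sym.
Qed.

Definition table s q x := ra s TAB (q * D + x).
Definition values s q x := ia s PHI (q * D + x).

Definition heap_ok c s := forall w, all (gtn r) w -> size w <= k ->
  node r w <= c ->
  node_ok w (ia s LEV (node r w)) (values s (node r w)) (table s (node r w)).

Lemma node_lt_QT w : all (gtn r) w -> size w <= k -> node r w < level r k.+1.
Proof.
move=> hw wk; have /andP[_ h] := node_range hw.
by apply: (leq_trans h); apply: level_mono.
Qed.

(** The condition on [v_c] says that the last node filled directly precedes child [a] of [q] in the
    numbering. *)
Lemma child_ok s : env4 s -> iv s v_q < level r k -> iv s v_a < r ->
  iv s v_c = iv s v_q * r + iv s v_a -> heap_ok (iv s v_c) s ->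
  iv (eval child s) v_c = (iv s v_c).+1 /\ heap_ok (iv s v_c).+1 (eval child s).
Proof.
move=> H; set q := iv s v_q; set a := iv s v_a => qQ ar hc hp.
have [w hw wq] := node_surj r_gt0 q.
have wk : size w < k.
  rewrite ltnNge; apply/negP => kw; have /andP[h _] := node_range hw.
  by have := leq_trans (level_mono r_gt0 kw) h; rewrite wq leqNgt qQ.
have qc : q <= iv s v_c by rewrite hc; nia.
have Nq : node_ok w (ia s LEV q) (values s q) (table s q).
  by rewrite -wq; apply: hp; rewrite ?wq // ltnW.
set c := (iv s v_c).+1.
have hw' : all (gtn r) (rcons w a) by rewrite all_rcons /= ar.
have wc : node r (rcons w a) = c by rewrite node_rcons wq /c hc addnS.
have cQT : c < level r k.+1 by rewrite -wc node_lt_QT // size_rcons.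
have qQT : q < level r k.+1 by apply: leq_trans cQT; rewrite /c ltnS leqW.
set v := nth 0 bs (size w).
have vn : v < n by rewrite -mem_vtx mem_cat mem_nth.
rewrite /child !eval_seq; set s1 := eval (ISet v_x _) _.
have K1 : env4 s1.
  apply: env4_set => //; apply: (env4_frame (eval_frame _ _)) => //.
  by apply: env4_set => //; apply: env4_set.
have [c1 q1 a1 v1 x1] : [/\ iv s1 v_c = c, iv s1 v_q = q, iv s1 v_a = a,
    iv s1 v_v = v & iv s1 v_x = (v * r + a) * D].
  have vE : ia s BRA (ia s LEV q) = v by rewrite (node_lev Nq) (env_bra H).
  split; rewrite //= ?addn1 // -/q -/a ?vE //.
  by rewrite (env_mulr H) ?vtx_lt 1?ltnW // (env_mulD H) // lit_lt // ltnW.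
have [L1 P1 T1] : [/\ forall q', ia s1 LEV q' = if q' == c then (size w).+1 else ia s LEV q',
    ia s1 PHI = ia s PHI & ra s1 TAB = ra s TAB].
  by split=> // q'; rewrite /= addn1 -/q -/c (node_lev Nq) addn1.
move: s1 K1 c1 q1 a1 v1 x1 L1 P1 T1 => s1 K1 c1 q1 a1 v1 x1 L1 P1 T1.
set loop1 := For v_y _ _; set s2 := eval loop1 s1.
have F2 := eval_frame loop1 s1; have K2 : env4 s2 := env4_frame F2 isT K1.
(* Parent and child occupy different blocks, so the parent stays intact while it is being copied. *)
have cq : (q == c) = false by apply/eqP; lia.
have : forall q' x, x < D -> table s2 q' x =
    if (q' == c) && (x < iv s1 v_D) then (table s q x + S m (v * r + a) x)%R
    else table s q' x.
  apply: (@for_rule _ (fun i s' => forall q' x, x < D -> table s' q' x =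
    if (q' == c) && (x < i) then (table s q x + S m (v * r + a) x)%R
    else table s q' x)).
    by move=> q' x xD; rewrite andbF /table T1.
  move=> i s3; rewrite (env_D K1) => iD F I q' x xD.
  have K3 := env4_frame F isT K1.
  have iv3 y : y \notin [:: v_y] -> iv s3 y = iv s1 y.
    by move=> yP; rewrite (frame_iv F) //= inE; move: yP; rewrite inE orbb.
  rewrite /table /= !iv3 // c1 q1 x1 !(env_off K3) // pair_inj // -/(table s3 q i).
  rewrite I // cq /= (env_mat K3) //; last exact: lit_lt (ltnW vn) ar.
  rewrite ltnS -/(table s3 q' x) I //.
  case: (eqVneq q' c) => //= _; case: (ltngtP x i) => // -> //.
rewrite (env_D K1) => T2.
have iv2 y : y \notin [:: v_y] -> iv s2 y = iv s1 y.
  by move=> yP; rewrite (frame_iv F2) //= inE; move: yP; rewrite inE orbb.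
have P2 : ia s2 PHI = ia s PHI by rewrite (frame_ia F2).
have L2 : ia s2 LEV = ia s1 LEV by rewrite (frame_ia F2).
move: s2 K2 T2 iv2 P2 L2 {F2} => s2 K2 T2 iv2 P2 L2.
set s3 := eval (RPut TAB _ _) s2.
have K3 : env4 s3 by apply: (env4_eval _ K2).
have nD : n * r < D := D_gt.
have vD : v < D := vtx_lt (ltnW vn).
have vaD : v * r + a < D by exact: lit_lt (ltnW vn) ar.
have T3 q' x : x < D -> table s3 q' x = if q' == c then
    (if x == n * r then table s q x + S m (v * r + a) x + table s q (v * r + a)
     else table s q x + S m (v * r + a) x)%R else table s q' x.
  move=> xD; rewrite /table /= !iv2 // c1 q1 v1 a1 !(env_off K2) //.
  rewrite (env_n K1) !(env_mulr K2) ?vtx_lt ?(ltnW vn) // pair_inj //.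
  rewrite -addnA -/(table s2 c (n * r)) -/(table s2 q (v * r + a)) -/(table s2 q' x).
  rewrite !T2 // eqxx cq nD xD andbT /=.
  by case: eqP => //= _; case: eqP => // ->.
have P3 : ia s3 PHI = ia s PHI by [].
have L3 : ia s3 LEV = ia s1 LEV by [].
have iv3 y : y \notin [:: v_y] -> iv s3 y = iv s1 y by exact: iv2.
move: s3 K3 T3 P3 L3 iv3 => s3 K3 T3 P3 L3 iv3.
set loop2 := For v_u _ _; set s4 := eval loop2 s3.
have F4 := eval_frame loop2 s3; have K4 : env4 s4 := env4_frame F4 isT K3.
have : forall q' x, x < D -> values s4 q' x =
    if (q' == c) && (x < iv s3 v_D) then values s q x else values s q' x.
  apply: (@for_rule _ (fun i s' => forall q' x, x < D -> values s' q' x =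
    if (q' == c) && (x < i) then values s q x else values s q' x)).
    by move=> q' x xD; rewrite andbF /values P3.
  move=> i s5; rewrite (env_D K3) => iD F I q' x xD.
  have K5 := env4_frame F isT K3.
  rewrite /values /= !(frame_iv F) // !iv3 // c1 q1 !(env_off K5) // pair_inj //.
  rewrite -/(values s5 q i) -/(values s5 q' x) !I // cq /= ltnS.
  case: (eqVneq q' c) => //= _; case: (ltngtP x i) => // -> //.
rewrite (env_D K3) => P4.
have T4 : ra s4 TAB = ra s3 TAB by rewrite (frame_ra F4).
have L4 : ia s4 LEV = ia s1 LEV by rewrite (frame_ia F4).
have iv4 y : y \notin [:: v_u; v_y] -> iv s4 y = iv s1 y.
  rewrite !inE negb_or => /andP[yu yy]; rewrite (frame_iv F4) ?iv3 ?inE ?(negPf yu) //.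
move: s4 K4 P4 T4 L4 iv4 {F4} => s4 K4 P4 T4 L4 iv4.
set s5 := eval _ s4.
have c5 : iv s5 v_c = c by rewrite /= iv4.
split=> // w' hw'1 w'k; rewrite leq_eqVlt => /orP[/eqP w'c|w'c].
  have -> : w' = rcons w a by apply: (node_inj r_gt0); rewrite ?wc.
  rewrite wc; apply: (@child_node_ok w (ia s LEV q) (values s q) (table s q)) => //.
  - by rewrite /= L4 L1 eqxx (node_lev Nq).
  - move=> u un; have uD := vtx_lt un.
    rewrite /values /= !iv4 // c1 v1 a1 (env_off K4) // pair_inj //.
    by rewrite eqxx /= -/(values s4 c u) P4 // eqxx uD.
  - move=> x xn; have xD := ltn_trans xn D_gt.
    rewrite /table /= T4 -/(table s3 c x) T3 // eqxx -/v.
    by case: eqP => // ?; lia.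
  - by rewrite /table /= T4 -/(table s3 c (n * r)) T3 // !eqxx.
have w'c2 : (node r w' == c) = false by apply/eqP; lia.
apply: node_ok_ext (hp w' hw'1 w'k _); last by move: w'c; rewrite /c ltnS.
- by rewrite /= L4 L1 w'c2.
- move=> x xD; rewrite [RHS]/values /= !iv4 // c1 v1 (env_off K4) //.
  rewrite pair_inj // w'c2 /= -/(values s4 (node r w') x).
  by rewrite P4 // w'c2.
- by move=> x xD; rewrite [RHS]/table /= T4 -/(table s3 _ x) T3 // w'c2.
Qed.
Lemma heap_ok0 s : ia s LEV 0 = 0 -> (forall x, ia s PHI x = 0) ->
  (forall x, x < n * r -> ra s TAB x = raw_r x.+1) -> ra s TAB (n * r) = raw_r 0 ->
  heap_ok 0 s.
Proof.
move=> h1 h2 h3 h4 w hw wk; rewrite leqn0 => /eqP w0.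
have -> : w = [::] by apply: (node_inj r_gt0).
rewrite /= h1; apply: root_ok => [v _|x xn|]; rewrite /values /table mul0n add0n //.
exact: h3.
Qed.

(** [level r k * r] is the last node of depth k, since its successor is [level r k.+1]. *)
Lemma branch_ok s : env4 s -> heap_ok 0 s ->
  heap_ok (level r k * r) (eval branch s).
Proof.
move=> H hp; rewrite /branch eval_seq; set s1 := eval (ISet v_c _) s.
have K1 : env4 s1 by exact: env4_set.
set loop := For v_q v_Q _.
suff : iv (eval loop s1) v_c = iv s1 v_Q * r /\
    heap_ok (iv s1 v_Q * r) (eval loop s1) by rewrite (env_Q K1) => -[].
apply: (@for_rule _ (fun q s' => iv s' v_c = q * r /\ heap_ok (q * r) s')) => //.
move=> q s2; rewrite (env_Q K1) => qQ F [cq hq].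
have K2 : env4 s2 := env4_frame F isT K1.
set s3 := set_iv s2 v_q q; have K3 : env4 s3 by exact: env4_set.
rewrite mulSn addnC -[X in q * r + X](env_r K3).
apply: (@for_rule _ (fun a s' => iv s' v_c = q * r + a /\ heap_ok (q * r + a) s')).
  by rewrite addn0.
move=> a s4; rewrite (env_r K3) => ar F4 [ca ha].
have K4 : env4 s4 := env4_frame F4 isT K3.
have q4 : iv s4 v_q = q by rewrite (frame_iv F4).
have := @child_ok (set_iv s4 v_a a); rewrite [iv _ v_q]/= [iv _ v_a]/= [iv _ v_c]/= q4 ca.
by rewrite addnS; apply=> //; exact: env4_set.
Qed.

(** The part of the energy that depends on the value of a forest vertex [v] once the value [c] of
    its parent [u] is given. *)
Definition choice (T : nat -> R) v u a c := (T (v * r + a)%N + S m (v * r + a) (u * r + c))%R.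

Definition is_best T v u c a :=
  a < r /\ forall a', a' < r -> (choice T v u a' c <= choice T v u a c)%R.

Lemma best_value_ok s q : env4 s -> iv s v_v <= n -> iv s v_u <= n -> iv s v_b < r ->
  iv s v_z = q * D ->
  let s' := eval best_value s in
  is_best (table s q) (iv s v_v) (iv s v_u) (iv s v_b) (iv s' v_arg) /\
  rv s' 0 = choice (table s q) (iv s v_v) (iv s v_u) (iv s' v_arg) (iv s v_b).
Proof.
move=> H vn un br hz; rewrite /best_value !eval_seq.
set s1 := eval (RSet 0 _) _; set v := iv s v_v in vn *; set u := iv s v_u in un *.
set c := iv s v_b in br *; set T := table s q.
have vD := vtx_lt vn; have uD := vtx_lt un; have ucD := lit_lt un br.
have K1 : env4 s1 by apply: env4_eval => //; exact: env4_set.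
have b1 : rv s1 0 = choice T v u 0 c.
  have v0D := lit_lt vn r_gt0; rewrite addn0 in v0D.
  rewrite /= -/v -/u -/c hz !(env_mulr H) // (env_mulD H) // -addnA.
  by rewrite /choice (env_mat H) // addn0.
set loop := For v_a v_r _.
have : (0 < iv s1 v_r -> is_best T v u c (iv (eval loop s1) v_arg)) /\
    rv (eval loop s1) 0 = choice T v u (iv (eval loop s1) v_arg) c.
  suff : [/\ iv (eval loop s1) v_arg < r, forall a', a' < iv s1 v_r ->
      (choice T v u a' c <= choice T v u (iv (eval loop s1) v_arg) c)%R &
      rv (eval loop s1) 0 = choice T v u (iv (eval loop s1) v_arg) c].
    by rewrite (env_r K1) => -[].
  apply: (@for_rule _ (fun i s' => [/\ iv s' v_arg < r, forall a', a' < i ->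
      (choice T v u a' c <= choice T v u (iv s' v_arg) c)%R &
      rv s' 0 = choice T v u (iv s' v_arg) c])) => //.
  move=> a s2; rewrite (env_r K1) => ar F [I1 I2 I3].
  have K2 : env4 s2 := env4_frame F isT K1.
  have vaD := lit_lt vn ar.
  rewrite eval_seq; set s3 := eval (RSet 1 _) _.
  have r3 : rv s3 1 = choice T v u a c.
    rewrite /= !(frame_iv F) //= -/v -/u -/c hz !(env_mulr K2) // (env_mulD K2) // -!addnA.
    by rewrite (frame_ra F) //= (env_mat K2).
  have r30 : rv s3 0 = rv s2 0 by [].
  have a3 : iv s3 v_arg = iv s2 v_arg by [].
  have a3' : iv s3 v_a = a by [].
  move: s3 r3 r30 a3 a3' => s3 r3 r30 a3 a3'.
  rewrite /nop [eval _ _]/= r3 r30 I3; case: lerP => h; rewrite /= ?a3 ?a3'.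
    split=> //; last by rewrite r30.
    by move=> a'; rewrite ltnS leq_eqVlt => /orP[/eqP->|/I2].
  split=> // a'; rewrite ltnS leq_eqVlt => /orP[/eqP->//|/I2 h'].
  exact: le_trans h' (ltW h).
by rewrite (env_r K1) => -[/(_ r_gt0)].
Qed.

Definition agree (w : seq nat) (f : nat -> nat) :=
  valid f /\ forall i, i < k -> f (nth 0 bs i) = nth 0 w i.

(* [arg] records, for each literal "forest vertex v, value c of its parent", a best
   value of v. *)
Record elim_ok w j (par arg : nat -> nat) (T : nat -> R) : Prop := ElimOk {
  elim_arg : forall i c, i < j -> c < r -> arg (nth 0 fs i * r + c) < r;
  elim_le : forall f, agree w f -> (total f <= csp_energy T (drop j fs ++ [:: n]) f)%R;
  elim_eq : forall f, agree w f ->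
    (forall i, i < j -> f (nth 0 fs i) = arg (nth 0 fs i * r + f (par i))) ->
    total f = csp_energy T (drop j fs ++ [:: n]) f }.

Lemma fs_nth_lt i : i < l -> nth 0 fs i < n.
Proof. by move=> il; rewrite -mem_vtx mem_cat mem_nth ?orbT. Qed.

Lemma fs_uniq : uniq fs.
Proof. by move: vtx_uniq; rewrite cat_uniq => /and3P[]. Qed.

Lemma parent_lt j w : parent_spec fs j w -> w <= n.
Proof. by case=> [[->//|[j' /andP[_ jl] ->]] _]; apply/ltnW/fs_nth_lt. Qed.

Lemma parent_neq j w : j < l -> parent_spec fs j w -> w != nth 0 fs j.
Proof.
move=> jl [[->|[j' /andP[jj' jl'] ->]] _]; first by rewrite gtn_eqF // fs_nth_lt.
by rewrite nth_uniq ?fs_uniq // gtn_eqF.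
Qed.

(** [energy_forest] with M the best choice. The bound persists because no value of [v] beats M, and
    equality persists when [v] takes the recorded value, as the two choice terms then cancel. *)
Lemma elim_step w j par arg arg' T T' (v := nth 0 fs j) : j < l ->
  parent_spec fs j (par j) -> elim_ok w j par arg T ->
  (forall c, c < r -> is_best T v (par j) c (arg' (v * r + c))) ->
  (forall i c, i < j -> c < r ->
    arg' (nth 0 fs i * r + c) = arg (nth 0 fs i * r + c)) ->
  (forall u c, u <= n -> c < r -> T' (u * r + c) = (T (u * r + c)%N
    + if u == par j then choice T v (par j) (arg' (v * r + c)) c else 0)%R) ->
  elim_ok w j.+1 par arg' T'.
Proof.
move=> jl hp [h1 h2 h3] hbest harg hT.
have vn : v < n := fs_nth_lt jl.
set L := drop j.+1 fs ++ [:: n].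
have LE : drop j fs ++ [:: n] = v :: L by rewrite (drop_nth 0 jl).
have tl := @tail_lt (size bs); rewrite drop_size cat0s in tl.
have Ln u : u \in L -> u <= n.
  by rewrite mem_cat => uL; apply: tl; rewrite mem_cat; case/orP: uL => [/mem_drop|] ->; rewrite ?orbT.
have Luniq : uniq L.
  have := tail_uniq (size bs); rewrite drop_size cat0s; apply: subseq_uniq.
  by rewrite cat_subseq ?drop_subseq.
have pL : par j \in L.
  rewrite mem_cat inE; case: hp => [[->|[j' /andP[jj' jl'] ->]] _]; first by rewrite eqxx orbT.
  by rewrite -[j'](subnKC jj') -nth_drop mem_nth // size_drop ltn_sub2r // (leq_trans _ jl').
(* The dummy is the endpoint of no edge, and a later forest vertex adjacent to [v] is the parent by
   [parent_spec]. *)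
have S0 f : valid f -> {in L, forall u, u != par j ->
    S m (v * r + f v) (u * r + f u) = 0%R}.
  case=> hf fn u uL up.
  have [un|un] := eqVneq u n.
    rewrite un /S score_matrix0 ?size_el // !divn_lit //; apply/negP => /mem_take ue.
      by have := el_n ue; rewrite /= ltnn.
    by have := ltn_trans (el_lt ue) (el_n ue); rewrite /= ltnn.
  apply: S_nonadj => //; apply/negP => ad; case/eqP: up.
  move: uL; rewrite mem_cat inE (negPf un) orbF => ud.
  have [_ hu] := hp; have iu := nth_index 0 ud.
  have: index u (drop j.+1 fs) < size fs - j.+1 by rewrite -size_drop index_mem.
  move: (index u _) iu => i; rewrite nth_drop => iu il; rewrite -iu in ad *.
  by rewrite (hu _ _ ad) //; lia.
have key f : valid f -> (csp_energy T (v :: L) f + choice T v (par j) (arg' (v * r + f (par j))) (f (par j))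
    = csp_energy T' L f + choice T v (par j) (f v) (f (par j)))%R.
  move=> vf; apply: energy_forest => //.
  - exact: S_sym.
  - exact: S_diag.
  - exact: vf.
  - exact: S0.
  - move=> u uL; rewrite hT ?Ln //; last by case: vf.
    by case: eqP => [->|].
split.
- move=> i c; rewrite ltnS leq_eqVlt => /orP[/eqP->|ij] cr.
    by case: (hbest c cr).
  by rewrite harg // h1.
- move=> f hf; have [vf _] := hf; have [hfr _] := vf.
  apply: le_trans (h2 f hf) _; rewrite LE.
  have [_ /(_ _ (hfr v)) hb] := hbest _ (hfr (par j)).
  by have := key f vf; lra.
- move=> f hf htr; have [vf _] := hf; rewrite h3 //; last first.
    by move=> i ij; have [hfr _] := vf; rewrite htr ?harg //; exact: ltnW.
  rewrite LE; have := key f vf; rewrite -htr // => /eqP.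
  by rewrite (inj_eq (addIr _)) => /eqP.
Qed.
Lemma choice_ext T T' v u a c : a < r -> (forall a', a' < r -> T (v * r + a') = T' (v * r + a')) ->
  choice T v u a c = choice T' v u a c.
Proof. by move=> ar h; rewrite /choice h. Qed.

Lemma is_best_ext T T' v u c a : (forall a', a' < r -> T (v * r + a') = T' (v * r + a')) ->
  is_best T v u c a -> is_best T' v u c a.
Proof.
move=> h [ar hb]; split=> // a' ar'.
by rewrite -!(choice_ext _ _ _ h) // hb.
Qed.

Lemma eliminate_ok s w q : env4 s -> iv s v_j < l -> iv s v_z = q * D ->
  elim_ok w (iv s v_j) (ia s PAR) (ia s ARG) (table s q) ->
  let s' := eval eliminate s in
  elim_ok w (iv s v_j).+1 (ia s PAR) (ia s' ARG) (table s' q) /\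
  forall q' x, x < D -> q' != q -> table s' q' x = table s q' x.
Proof.
move=> H; set j := iv s v_j => jl hz he; rewrite /eliminate !eval_seq.
have hp := env_par H jl; set v := nth 0 fs j; set u := ia s PAR j.
have vn : v < n := fs_nth_lt jl.
have un : u <= n := parent_lt hp.
have uv : u != v := parent_neq jl hp.
set s1 := eval (ISet v_u _) _.
have K1 : env4 s1 by do 2 (apply: env4_set => //).
have v1 : iv s1 v_v = v by rewrite /= -/j (env_for H).
have u1 : iv s1 v_u = u by [].
have z1 : iv s1 v_z = q * D by [].
have A1 : ia s1 ARG = ia s ARG by [].
have T1 : ra s1 TAB = ra s TAB by [].
move: s1 K1 v1 u1 z1 A1 T1 => s1 K1 v1 u1 z1 A1 T1.
set T := table s q; set loop := For v_b v_r _.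
suff [G1 G2 G3] : [/\ forall c, c < iv s1 v_r ->
    is_best T v u c (ia (eval loop s1) ARG (v * r + c)),
  forall i c, c < r -> i != v -> ia (eval loop s1) ARG (i * r + c) = ia s ARG (i * r + c) &
  forall q' x, x < D -> table (eval loop s1) q' x = (table s q' x +
    if [&& q' == q, x %/ r == u & x %% r < iv s1 v_r]%N then
      choice T v u (ia (eval loop s1) ARG (v * r + x %% r)%N) (x %% r)%N else 0)%R].
  rewrite (env_r K1) in G1 G3; split; last first.
    by move=> q' x xD qq; rewrite G3 // (negPf qq) addr0.
  apply: (elim_step jl hp he G1).
    move=> i c ij cr; apply: G2 => //.
    by rewrite nth_uniq ?fs_uniq ?ltn_eqF // (ltn_trans ij).
  move=> u' c un' cr; rewrite G3 ?lit_lt // eqxx divn_lit // modn_lit // cr andbT /=.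
  by [].
apply: (@for_rule _ (fun bk s2 => [/\ forall c, c < bk ->
    is_best T v u c (ia s2 ARG (v * r + c)),
  forall i c, c < r -> i != v -> ia s2 ARG (i * r + c) = ia s ARG (i * r + c) &
  forall q' x, x < D -> table s2 q' x = (table s q' x +
    if [&& q' == q, x %/ r == u & x %% r < bk]%N then
      choice T v u (ia s2 ARG (v * r + x %% r)%N) (x %% r)%N else 0)%R])).
  split=> // [i c _ _|q' x xD]; first by rewrite A1.
  by rewrite ltn0 !andbF addr0 /table T1.
move=> c s2; rewrite (env_r K1) => cr F [I1 I2 I3].
have K2 : env4 s2 := env4_frame F isT K1.
have v2 : iv s2 v_v = v by rewrite (frame_iv F).
have u2 : iv s2 v_u = u by rewrite (frame_iv F).
have z2 : iv s2 v_z = q * D by rewrite (frame_iv F).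
(* The loop writes only to the row of the parent, which differs from [v]; so every maximum is taken
   over the original row of [v]. *)
have T2 a : a < r -> table s2 q (v * r + a) = T (v * r + a).
  move=> ar; rewrite I3; last exact: lit_lt (ltnW vn) ar.
  rewrite divn_lit // (eq_sym v) (negPf uv) andbF.
  by rewrite addr0.
set s3 := set_iv s2 v_b c; have K3 : env4 s3 by exact: env4_set.
rewrite (eval_seq best_value) (eval_seq (IPut _ _ _)).
have := @best_value_ok s3 q K3; rewrite [iv s3 v_v]/= [iv s3 v_u]/= [iv s3 v_b]/= [iv s3 v_z]/=.
rewrite v2 u2 => /(_ (ltnW vn) un cr z2).
have F4 := eval_frame best_value s3; have K4 := env4_frame F4 isT K3.
move: (eval best_value s3) F4 K4 => s4 F4 K4 [B1 B2].
have B3 : is_best T v u c (iv s4 v_arg) by apply: is_best_ext B1.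
have ar4 : iv s4 v_arg < r by case: B3.
have {}B2 : rv s4 0 = choice T v u (iv s4 v_arg) c.
  by rewrite B2; apply: choice_ext.
have v4 : iv s4 v_v = v by rewrite (frame_iv F4).
have u4 : iv s4 v_u = u by rewrite (frame_iv F4).
have b4 : iv s4 v_b = c by rewrite (frame_iv F4).
have z4 : iv s4 v_z = q * D by rewrite (frame_iv F4).
have T4 : ra s4 TAB = ra s2 TAB by rewrite (frame_ra F4).
have A4 : ia s4 ARG = ia s2 ARG by rewrite (frame_ia F4).
have vD := vtx_lt (ltnW vn); have uD := vtx_lt un.
have ucD : u * r + c < D by exact: lit_lt.
set s6 := eval _ _.
have A6 x : ia s6 ARG x = if x == v * r + c then iv s4 v_arg else ia s2 ARG x.
  by rewrite /= v4 (env_mulr K4) // b4 A4.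
have T6 q' x : x < D -> table s6 q' x = if (q' == q) && (x == u * r + c) then
    (table s2 q (u * r + c) + choice T v u (iv s4 v_arg) c)%R else table s2 q' x.
  move=> xD; rewrite /table /= u4 (env_mulr K4) // b4 z4 T4 B2 -addnA.
  by rewrite pair_inj.
split.
- move=> c'; rewrite ltnS leq_eqVlt A6 => /orP[/eqP->|c'c]; first by rewrite eqxx.
  rewrite pair_inj ?(ltn_trans c'c) // eqxx (ltn_eqF c'c); exact: I1.
- by move=> i c' cr' iv'; rewrite A6 pair_inj // (negPf iv') I2.
- move=> q' x xD; rewrite T6 // !I3 // divn_lit // modn_lit // ltnn !andbF addr0.
  rewrite lit_eq // A6 pair_inj ?ltn_mod // eqxx /=.
  case: (eqVneq q' q) => [->|] //=; case: (eqVneq (x %/ r) u) => [xu|] //=.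
  rewrite ltnS; case: (ltngtP (x %% r) c) => // xc.
  by rewrite {1}(divn_eq x r) xu xc.
Qed.

Lemma traceback_ok s q : env4 s -> iv s v_z = q * D ->
  (forall i c, i < l -> c < r -> ia s ARG (nth 0 fs i * r + c) < r) ->
  (forall v, v <= n -> values s q v < r) ->
  let s' := eval traceback s in
  [/\ forall i, i < l -> values s' q (nth 0 fs i)
        = ia s ARG (nth 0 fs i * r + values s' q (ia s PAR i)),
      forall v, v <= n -> values s' q v < r,
      forall v, v <= n -> v \notin fs -> values s' q v = values s q v &
      forall q' x, x < D -> q' != q -> values s' q' x = values s q' x].
Proof.
move=> H hz harg hlt; rewrite /traceback.
set loop := For v_j v_l _.
(* After j rounds the last j forest vertices obey the traceback rule. They continue to do so: the
   vertex assigned next precedes them in the forest order, while their parents come after them or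
   are the dummy. *)
suff : [/\ forall i, l - iv s v_l <= i < l -> values (eval loop s) q (nth 0 fs i)
        = ia s ARG (nth 0 fs i * r + values (eval loop s) q (ia s PAR i)),
      forall v, v <= n -> values (eval loop s) q v < r,
      forall v, v <= n -> v \notin fs -> values (eval loop s) q v = values s q v &
      forall q' x, x < D -> q' != q -> values (eval loop s) q' x = values s q' x].
  by rewrite (env_l H) subnn => -[h1 h2 h3 h4]; split.
apply: (@for_rule _ (fun j s' => [/\ forall i, l - j <= i < l -> values s' q (nth 0 fs i)
        = ia s ARG (nth 0 fs i * r + values s' q (ia s PAR i)),
      forall v, v <= n -> values s' q v < r,
      forall v, v <= n -> v \notin fs -> values s' q v = values s q v &
      forall q' x, x < D -> q' != q -> values s' q' x = values s q' x])).
  by split=> // i; rewrite subn0; lia.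
move=> j s1; rewrite (env_l H) => jl F [I1 I2 I3 I4].
have K1 : env4 s1 := env4_frame F isT H.
set x := l - j.+1; have xl : x < l by rewrite /x; lia.
set s2 := eval _ _.
have vn := fs_nth_lt xl; have vD := vtx_lt (ltnW vn).
have hp := env_par H xl; have pn := parent_lt hp; have pD := vtx_lt pn.
set new := ia s ARG (nth 0 fs x * r + values s1 q (ia s PAR x)).
have V2 q' y : y < D -> values s2 q' y =
    if (q' == q) && (y == nth 0 fs x) then new else values s1 q' y.
  move=> yD; rewrite /values /= !(frame_iv F (x := v_z)) // hz (frame_iv F (x := v_l)) //.
  rewrite (env_l H) addn1 -/x (env_for K1) // (env_mulr K1) // pair_inj //.
  by rewrite !(frame_ia F (j := ARG)) // !(frame_ia F (j := PAR)).
have new_lt : new < r by apply: harg => //; exact: I2.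
split.
- move=> i /andP[h1 h2]; have il : nth 0 fs i < n := fs_nth_lt h2.
  have hpi := env_par H h2; have pin := parent_lt hpi.
  rewrite !V2 ?vtx_lt ?(ltnW il) // eqxx /= nth_uniq ?fs_uniq //.
  have [ix|ix] := eqVneq i x.
    rewrite ix (negPf (parent_neq xl hp)) //.
  have xi : x < i by move: h1 ix; rewrite -/x; lia.
  have -> : (ia s PAR i == nth 0 fs x) = false.
    have [[->|[j' /andP[j1 j2] ->]] _] := hpi; first by rewrite gtn_eqF.
    by rewrite nth_uniq ?fs_uniq //; apply/eqP; lia.
  by apply: I1; rewrite h2 andbT; move: xi; rewrite /x; lia.
- by move=> v vn'; rewrite V2 ?vtx_lt //; case: ifP => // _; exact: I2.
- move=> v vn' vf; rewrite V2 ?vtx_lt // eqxx /=; case: eqP => [vx|_]; last exact: I3.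
  by move: vf; rewrite vx mem_nth.
- by move=> q' y yD qq; rewrite V2 // (negPf qq) I4.
Qed.
(** Being in [Prop], the record is an existential statement about a word and an assignment: the
    stored assignment attains the optimum over all completions of the word. *)
Record leaf_done s q : Prop := LeafDone {
  leaf_w : seq nat;
  leaf_f : nat -> nat;
  leaf_all : all (gtn r) leaf_w;
  leaf_size : size leaf_w = k;
  leaf_node : node r leaf_w = q;
  leaf_valid : valid leaf_f;
  leaf_values : forall v, v <= n -> values s q v = leaf_f v;
  leaf_total : total leaf_f = table s q (n * r);
  leaf_max : forall g, agree leaf_w g -> (total g <= table s q (n * r))%R }.

Definition same_nodes (P : pred nat) s s' := forall q x, P q -> x < D ->
  table s' q x = table s q x /\ values s' q x = values s q x.

Lemma leaf_done_same P s s' q : same_nodes P s s' -> P q -> leaf_done s q -> leaf_done s' q.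
Proof.
move=> h Pq [w f h1 h2 h3 h4 h5 h6 h7].
have hT : table s' q (n * r) = table s q (n * r) by case: (h q (n * r) Pq D_gt).
exists w f => //; rewrite ?hT //.
by move=> v vn; rewrite -h5 //; case: (h q v Pq (vtx_lt vn)).
Qed.

Lemma energy_dummy T f : valid f -> csp_energy T [:: n] f = T (n * r).
Proof.
case=> hf fn; rewrite /csp_energy /energy !big_seq1 S_diag // mulr0 addr0 fn addn0 //.
Qed.

Lemma leaf_ok s w q lev : env4 s -> all (gtn r) w -> size w = k -> node r w = q ->
  iv s v_z = q * D -> node_ok w lev (values s q) (table s q) ->
  let s' := eval traceback (eval (For v_j v_l eliminate) s) in
  leaf_done s' q /\ same_nodes (predC1 q) s s'.
Proof.
move=> H hw wk wq hz hN; set loop := For v_j v_l eliminate; set s1 := eval loop s.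
have F1 := eval_frame loop s; have K1 : env4 s1 := env4_frame F1 isT H.
have P1 : ia s1 PAR = ia s PAR by rewrite (frame_ia F1).
have [E1 E2] : elim_ok w (iv s v_l) (ia s PAR) (ia s1 ARG) (table s1 q) /\
    forall q' x, x < D -> q' != q -> table s1 q' x = table s q' x.
  apply: (@for_rule _ (fun j s' => elim_ok w j (ia s PAR) (ia s' ARG) (table s' q) /\
    forall q' x, x < D -> q' != q -> table s' q' x = table s q' x)).
    split=> //; split=> // f [vf hf].
      by rewrite (node_total hN) ?wk // drop_oversize ?drop0 // /k.
    by move=> _; rewrite (node_total hN) ?wk // drop_oversize ?drop0.
  move=> j s2; rewrite (env_l H) => jl F [I1 I2].
  have K2 : env4 s2 := env4_frame F isT H.
  have P2 : ia s2 PAR = ia s PAR by rewrite (frame_ia F).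
  have z2 : iv s2 v_z = q * D by rewrite (frame_iv F).
  have := @eliminate_ok (set_iv s2 v_j j) w q; rewrite [iv _ v_j]/= [ia _ _]/= [ia _ _]/= P2.
  case=> //; first exact: env4_set.
  move=> J1 J2; split=> // q' x xD qq; rewrite J2 //.
  exact: I2.
rewrite (env_l H) in E1.
have z1 : iv s1 v_z = q * D by rewrite (frame_iv F1).
have V1 : ia s1 PHI = ia s PHI by rewrite (frame_ia F1).
have V1q : values s1 =2 values s by move=> q' x; rewrite /values V1.
have [|v vn|T1 T2 T3 T4] := @traceback_ok s1 q K1 z1.
- by move=> i c il cr; apply: (elim_arg E1).
- by rewrite V1q; exact: (node_lt hN).
set s2 := eval traceback s1 in T1 T2 T3 T4 *.
have TT : ra s2 TAB = ra s1 TAB by rewrite /s2 eval_ra.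
have nfs : n \notin fs by apply/negP => nf; have := mem_vtx n; rewrite mem_cat nf orbT ltnn.
(* [valid] speaks of all natural numbers, whereas the memory beyond vertex n belongs to something
   else; hence the cut-off. *)
pose f v := if v <= n then values s2 q v else 0.
have fE v : v <= n -> values s2 q v = f v by rewrite /f => ->.
have fn : f n = 0 by rewrite -fE // T3 // V1q (node_dummy hN).
have vf : valid f.
  by split=> // v; rewrite /f; case: ifP => // /T2.
have bs_lt i : i < k -> nth 0 bs i < n.
  by move=> ik; rewrite -mem_vtx mem_cat mem_nth.
have af : agree w f.
  split=> // i ik; have bn := ltnW (bs_lt i ik); rewrite -fE // T3 // ?V1q ?(node_bra hN) ?wk //.
  apply/negP => bf; move: vtx_uniq; rewrite cat_uniq => /and3P[_ /hasP[]].
  by exists (nth 0 bs i) => //=; rewrite mem_nth.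
split; last first.
  move=> q' x /= qq xD; split; first by rewrite /table TT -/(table s1 q' x) E2.
  by rewrite T4 // V1q.
have dl : drop l fs ++ [:: n] = [:: n] by rewrite drop_size.
exists w f => //.
- rewrite (elim_eq E1 af) ?dl ?energy_dummy // /table ?TT // => i il.
  have il' := fs_nth_lt il; rewrite -fE 1?ltnW // T1 // P1 fE //.
  exact: parent_lt (env_par H il).
- move=> g ag; have := elim_le E1 ag; rewrite dl energy_dummy //; last by case: ag.
  by rewrite /table TT.
Qed.

Lemma leaves_ok s : env4 s -> heap_ok (level r k * r) s ->
  let s' := eval leaves s in
  exists f, [/\ valid f, iv s' v_best < level r k.+1,
    forall v, v <= n -> values s' (iv s' v_best) v = f v,
    total f = table s' (iv s' v_best) (n * r) &
    forall g, valid g -> (total g <= total f)%R].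
Proof.
move=> H hp; rewrite /leaves eval_seq; set s1 := eval (ISet v_best _) s.
have K1 : env4 s1 by exact: env4_set.
set loop := For v_t v_NL _; set Q := level r k.
have QTE : level r k.+1 = Q + r ^ k by rewrite (levelS r_gt0).
have raw w s2 t : all (gtn r) w -> size w = k -> node r w = Q + t ->
    same_nodes [pred q | Q + t <= q] s1 s2 ->
    node_ok w k (values s2 (Q + t)) (table s2 (Q + t)).
  move=> hw wk wq hs; have := hp w hw; rewrite wk leqnn wq.
  have -> : Q + t <= level r k * r.
    by have := node_lt_QT hw; rewrite wk wq /= ltnS; apply.
  move=> /(_ isT isT) N; apply: (node_ok_ext _ _ _ N).
  - by rewrite (node_lev N).
  - by move=> x xD; have [_ ->] := hs (Q + t) x (leqnn _) xD.
  - by move=> x xD; have [-> _] := hs (Q + t) x (leqnn _) xD.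
(* For t = 0 no leaf is done yet and [v_best] points to the first one, so that the first comparison
   is of this leaf with itself. *)
pose Inv t s2 := [/\ same_nodes [pred q | Q + t <= q] s1 s2,
  (if t is 0 then iv s2 v_best = Q else Q <= iv s2 v_best < Q + t),
  forall t', t' < t -> leaf_done s2 (Q + t') &
  forall t', t' < t -> (table s2 (Q + t') (n * r) <= table s2 (iv s2 v_best) (n * r))%R].
have : Inv (iv s1 v_NL) (eval loop s1).
  apply: (@for_rule _ Inv); first by split=> //=; exact: (env_Q H).
  move=> t s2; rewrite (env_NL K1) => tN F [I1 I2 I3 I4].
  have K2 : env4 s2 := env4_frame F isT K1.
  have tQT : Q + t < level r k.+1 by rewrite QTE ltn_add2l.
  rewrite !eval_seq; set s3 := eval (ISet v_z _) _.
  have K3 : env4 s3 by do 3 (apply: env4_set => //).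
  have q3 : iv s3 v_q = Q + t by rewrite /= (env_Q K2).
  have z3 : iv s3 v_z = (Q + t) * D by rewrite /= (env_Q K2) (env_off K2).
  have b3 : iv s3 v_best = iv s2 v_best by [].
  have T3 : ra s3 TAB = ra s2 TAB by [].
  have V3 : ia s3 PHI = ia s2 PHI by [].
  move: s3 K3 q3 z3 b3 T3 V3 => s3 K3 q3 z3 b3 T3 V3.
  have [w hw wq] := node_surj r_gt0 (Q + t).
  have wk : size w = k.
    have /andP[h1 h2] := node_range hw; rewrite wq in h1 h2.
    apply/eqP; rewrite eqn_leq; apply/andP; split; rewrite leqNgt; apply/negP => h.
      have := leq_trans (level_mono r_gt0 h) h1; rewrite leqNgt => /negP; apply.
      by [].
    have := level_mono r_gt0 h; rewrite -/Q; lia.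
  have N : node_ok w k (values s3 (Q + t)) (table s3 (Q + t)).
    by have := raw w s2 t hw wk wq I1; apply: node_ok_ext => // x _; rewrite /values /table ?V3 ?T3.
  have [D1 D2] := leaf_ok K3 hw wk wq z3 N.
  set s4 := eval (For v_j v_l eliminate) s3; set s5 := eval traceback s4 in D1 D2 *.
  rewrite -/s4 -/s5 in D1 D2.
  have fr5 x : x \in [:: v_q; v_z; v_best] -> iv s5 x = iv s3 x.
    by rewrite !inE => /or3P[] /eqP ->; rewrite /s5 eval_iv // /s4 eval_iv.
  have K5 : env4 s5 by apply: env4_eval => //; exact: env4_eval.
  have q5 : iv s5 v_q = Q + t by rewrite fr5.
  have z5 : iv s5 v_z = (Q + t) * D by rewrite fr5.
  have b5 : iv s5 v_best = iv s2 v_best by rewrite fr5.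
  have D3 : same_nodes (predC1 (Q + t)) s2 s5.
    by move=> q x qq xD; have [-> ->] := D2 q x qq xD; rewrite /table /values T3 V3.
  move: s5 D1 K5 q5 z5 b5 D3 {fr5 D2} => s5 D1 K5 q5 z5 b5 D3.
  set s6 := eval _ s5.
  have bestQT : iv s2 v_best < level r k.+1.
    by case: (t) I2 tN => [->|t' /andP[_ h] h']; rewrite QTE; lia.
  have T6 : ra s6 TAB = ra s5 TAB by rewrite /s6 /nop /=; case: ifP.
  have V6 : ia s6 PHI = ia s5 PHI by rewrite /s6 /nop /=; case: ifP.
  have b6 : iv s6 v_best = if (table s5 (iv s2 v_best) (n * r) <= table s5 (Q + t) (n * r))%R
      then Q + t else iv s2 v_best.
    rewrite /s6 /nop /= b5 z5 (env_off K5) // (env_n K5) (env_mulr K5) ?vtx_lt //.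
    by rewrite -!/(table s5 _ _); case: ifP => _ /=; rewrite ?q5 ?b5.
  have D6 : same_nodes (predC1 (Q + t)) s2 s6.
    by move=> q x qq xD; have [<- <-] := D3 q x qq xD; rewrite /table /values T6 V6.
  have lt_ne t' : t' < t -> (Q + t' != Q + t) by move=> ?; rewrite eqn_add2l ltn_eqF.
  split.
  - move=> q x /= qq xD; have [|-> ->] := D6 q x _ xD; first by rewrite /=; apply/eqP; lia.
    by apply: I1 => //=; lia.
  - by rewrite b6; case: ifP => _; [lia|case: (t) I2 => [->|t']; lia].
  - move=> t'; rewrite ltnS leq_eqVlt => /orP[/eqP->|tt].
      by apply: (@leaf_done_same predT s5) D1 => // q x _ _; rewrite /table /values T6 V6.
    by apply: leaf_done_same D6 _ (I3 _ tt); exact: lt_ne.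
  - have TE q : table s6 q = table s5 q by rewrite /table T6.
    move=> t'; rewrite b6 !TE ltnS leq_eqVlt => /orP[/eqP->|tt].
      by case: (lerP (table s5 (iv s2 v_best) (n * r)) (table s5 (Q + t) (n * r))) => // /ltW.
    have [-> _] := D3 (Q + t') (n * r) (lt_ne _ tt) D_gt.
    apply: le_trans (I4 _ tt) _.
    have -> : table s2 (iv s2 v_best) (n * r) = table s5 (iv s2 v_best) (n * r).
      case: (D3 (iv s2 v_best) (n * r) _ D_gt) => //=.
      by apply/eqP; case: (t) I2 tt => [//|t'' /andP[_ h]] _; lia.
    by case: (lerP (table s5 (iv s2 v_best) (n * r)) (table s5 (Q + t) (n * r))).
rewrite (env_NL K1); set s2 := eval loop s1 => -[_ I2 I3 I4].
have rk : 0 < r ^ k by rewrite expn_gt0 r_gt0.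
case: (r ^ k) I2 I3 I4 QTE rk => // N /andP[b1 b2] I3 I4 QTE _.
have [w f h1 h2 h3 h4 h5 h6 h7] := I3 (iv s2 v_best - Q) ltac:(lia).
rewrite subnKC // in h3 h5 h6 h7.
exists f; split=> //; first by rewrite QTE.
(* Any assignment is a completion of the leaf spelled by its values on the branching vertices. *)
move=> g vg; pose w' := map g bs.
have hw' : all (gtn r) w' by rewrite all_map; apply/allP => v _ /=; case: vg.
have wk' : size w' = k by rewrite size_map.
have /andP[n1 n2] := node_range hw'; rewrite wk' in n1 n2.
have [w2 f2 g1 g2 g3 g4 g5 g6 g7] := I3 (node r w' - Q) ltac:(lia).
rewrite subnKC // in g3 g5 g6 g7.
have ww : w2 = w' by apply: (node_inj r_gt0).
rewrite h6; apply: le_trans (g7 g _) _.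
  by rewrite ww; split=> // i ik; rewrite (nth_map 0).
by have := I4 (node r w' - Q) ltac:(lia); rewrite subnKC.
Qed.
Lemma output_ok s : env4 s -> iv s v_best < level r k.+1 ->
  let s' := eval output s in
  (forall v, v < n -> ia s' a_raw v = values s (iv s v_best) v) /\
  ra s' a_raw 0 = table s (iv s v_best) (n * r).
Proof.
move=> H; set q := iv s v_best => qQT; rewrite /output !eval_seq.
set s1 := eval (ISet v_z _) _; have K1 : env4 s1 by exact: env4_set.
have z1 : iv s1 v_z = q * D by rewrite /= (env_off H).
set loop := For v_v v_n _; have F := eval_frame loop s1.
have G : forall v, v < iv s1 v_n -> ia (eval loop s1) a_raw v = values s q v.
  apply: (@for_rule _ (fun j s' => forall v, v < j -> ia s' a_raw v = values s q v)) => //.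
  move=> j s2; rewrite (env_n K1) => jn F2 I v.
  rewrite ltnS /= !(frame_iv F2) // z1 (frame_ia F2) // (env_b K1).
  have -> : minn j b.-1 = j by apply/minn_idPl; move: D_gt; rewrite b_def; nia.
  by case: eqP => [->|vj vj'] //; apply: I; lia.
rewrite (env_n K1) in G; split; first by move=> v vn; rewrite [LHS]/= G.
rewrite /= min0n eqxx !(frame_iv F) // z1 (env_n K1) (frame_ia F) // (env_mulr K1) ?vtx_lt //.
by rewrite (frame_ra F).
Qed.

End Search.

Theorem solver_ok s : m <= n * n -> env1 s ->
  (forall j x, 0 < j -> ia s j x = 0) -> (forall j x, 0 < j -> ra s j x = 0%R) ->
  let s' := eval solver s in
  exists bs fs f, [/\ greedy_inv R adjn (iota 0 n) bs fs [::], valid r n f,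
    (forall v, v < n -> ia s' a_raw v = f v), ra s' a_raw 0 = total f &
    (forall g, valid r n g -> (total g <= total f)%R)] /\
    (cost solver s <= 12 * 1000 * (r ^ 2 * (n * r ^ size bs + n.+1 ^ 3)))%N.
Proof.
move=> m_le H0 zi zr.
have cost_seq c1 c2 s1 : cost (c1 ;; c2) s1 = cost c1 s1 + cost c2 (eval c1 s1) by [].
rewrite /solver 9!eval_seq 9!cost_seq.
set s1 := eval tables s; set s2 := eval matrix s1; set s3 := eval root_table s2.
set s4 := eval greedy s3; set s5 := eval parents s4; set s6 := eval heap_size s5.
set s7 := eval offsets s6; set s8 := eval branch s7; set s9 := eval leaves s8.
have H1 : env2 s1 by exact: tables_ok.
have H2 : env3 s2.
  by apply: matrix_ok => // x; [rewrite /s1 eval_ra // zr|rewrite /s1 eval_ia // zi].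
have H3 : env3 s3 := env3_frame (eval_frame root_table s2) isT H2.
have [R1 R2] := root_table_ok H2; rewrite -/s3 in R1 R2.
have zero3 j x : j \in [:: DEAD; RANK; LEV; PHI] -> ia s3 j x = 0.
  by rewrite !inE => /or4P[]/eqP->; rewrite /s3 eval_ia // /s2 eval_ia // /s1 eval_ia // zi.
have [||bs [fs G]] := greedy_ok H3; [by move=> v; apply: zero3|by move=> v; apply: zero3|].
rewrite -/s4 in G.
have H4 : env3 s4 := env3_frame (eval_frame greedy s3) isT H3.
have P5 := parents_ok H4 G; rewrite -/s5 in P5.
have H5 : env3 s5 := env3_frame (eval_frame parents s4) isT H4.
have k5 : iv s5 v_k = size bs by rewrite /s5 eval_iv // (gs_k G).
have l5 : iv s5 v_l = size fs by rewrite /s5 eval_iv // (gs_l G).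
have [Q6 QT6 NL6] := heap_size_ok (env_r H5) k5; rewrite -/s6 in Q6 QT6 NL6.
have H6 : env3 s6 := env3_frame (eval_frame heap_size s5) isT H5.
have O7 := offsets_ok (env_D H6); rewrite -/s7 QT6 in O7.
have H7 : env3 s7 := env3_frame (eval_frame offsets s6) isT H6.
have A0 : alive s4 = [::] by apply/size0nil; rewrite (gs_size G) subnn.
have GI := gs_inv G; rewrite A0 in GI.
have hp : perm_eq (iota 0 n) (bs ++ fs) by case: GI; rewrite cats0.
have K7 : env4 bs fs s7.
  split=> //.
  - by rewrite /s7 eval_iv // /s6 eval_iv.
  - by rewrite /s7 eval_iv // /s6 eval_iv.
  - by rewrite /s7 eval_iv.
  - by rewrite /s7 eval_iv.
  - by rewrite /s7 eval_iv.
  - by move=> i ik; rewrite /s7 eval_ia // /s6 eval_ia // /s5 eval_ia // (gs_bra G).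
  - by move=> j jl; rewrite /s7 eval_ia // /s6 eval_ia // /s5 eval_ia // (gs_for G).
  - by move=> j jl; rewrite /s7 eval_ia // /s6 eval_ia //; exact: P5.
have HP0 : heap_ok bs fs 0 s7.
  have Z j x : j \in [:: LEV; PHI] -> ia s7 j x = 0.
    move=> jP; rewrite -(zero3 j x); last by move: jP; rewrite !inE => /orP[]/eqP->.
    move: jP; rewrite !inE => /orP[]/eqP->.
      by rewrite /s7 eval_ia // /s6 eval_ia // /s5 eval_ia // /s4 eval_ia.
    by rewrite /s7 eval_ia // /s6 eval_ia // /s5 eval_ia // /s4 eval_ia.
  have T7 : ra s7 TAB = ra s3 TAB.
    by rewrite /s7 eval_ra // /s6 eval_ra // /s5 eval_ra // /s4 eval_ra.
  by apply: heap_ok0 => // [|x|x|]; rewrite ?T7 ?Z //; exact: R1.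
have HP8 := branch_ok hp K7 HP0; rewrite -/s8 in HP8.
have K8 : env4 bs fs s8 by exact: env4_eval K7.
have [f [vf bQ vals tf mx]] := leaves_ok hp K8 HP8; rewrite -/s9 in bQ vals tf.
have K9 : env4 bs fs s9 by exact: env4_eval K8.
have [O1 O2] := output_ok hp K9 bQ.
exists bs, fs, f; split.
  split=> //; last by rewrite O2 -tf.
  by move=> v vn; rewrite O1 // vals // ltnW.
set k := size bs.
have kn : size bs + size fs = n.
  by have := perm_size hp; rewrite size_iota size_cat => <-.
(* After [offsets] all loop bounds that outlive a phase are known, and each earlier phase already
   uses the same values; so one environment serves the static cost of all phases. *)
pose V := iv s7.
have V1 s' : env1 s' -> [/\ iv s' v_n = V v_n, iv s' v_r = V v_r, iv s' v_m = V v_m & iv s' v_D = V v_D].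
  by move=> e; rewrite /V (env_n e) (env_r e) (env_m e) (env_D e) (env_n K7) (env_r K7) (env_m K7) (env_D K7).
have VV s' : env4 bs fs s' -> [/\ iv s' v_Q = V v_Q, iv s' v_NL = V v_NL & iv s' v_l = V v_l].
  by move=> e; rewrite /V (env_Q e) (env_NL e) (env_l e) (env_Q K7) (env_NL K7) (env_l K7).
have bnd c s' : ~~ has (mem (wiv c)) (bounds c) -> {in bounds c, iv s' =1 V} ->
    cost c s' <= scost c V by move=> h1 h2; exact: cost_scost_gen.
(* As r >= 2, the induction step is level i + r^i <= 2 r^i <= r^(i+1). *)
have levelK : level r k <= r ^ k.
  rewrite /k; elim: (size bs) => // i IH; rewrite (levelS r_gt0) expnS.
  by apply: leq_trans (leq_add IH (leqnn _)) _; rewrite addnn -mul2n leq_mul2r r_gt1 orbT.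
have kn' : k <= n by rewrite -kn leq_addr.
have ln : V v_l <= n by rewrite /V (env_l K7) -kn leq_addl.
have QK : V v_Q <= r ^ k by rewrite /V (env_Q K7).
have QTK : V v_QT <= r ^ k * r * 2.
  rewrite /V (env_QT K7) /=; have : 0 < r ^ k by rewrite expn_gt0 r_gt0.
  by move: levelK; rewrite -/k; nia.
have C := phases_cost n_gt0 r_gt1 m_le kn' (env_n K7) (env_r K7) (env_m K7) (env_D K7)
  (env_k K7) ln QK (env_NL K7) QTK.
rewrite !big_cons big_nil addn0 -/V in C.
apply: leq_trans C.
have [a1 a2 a3 a4] := V1 _ H0; have [b1 b2 b3 b4] := V1 _ H1.
have [c1 c2 c3 c4] := V1 _ H2; have [d1 d2 d3 d4] := V1 _ H3.
have [e1 e2 e3 e4] := V1 _ H4; have [f1 f2 f3 f4] := V1 _ H5.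
have [g1 g2 g3 g4] := V1 _ H6; have [i1 i2 i3 i4] := V1 _ K7.
have [j1 j2 j3 j4] := V1 _ K8; have [k1 k2 k3 k4] := V1 _ K9.
have [o1 o2 o3] := VV _ K7; have [p1 p2 p3] := VV _ K8.
have kV : iv s5 v_k = V v_k by rewrite k5 /V (env_k K7).
have lV : iv s4 v_l = V v_l by rewrite (gs_l G) /V (env_l K7).
have qV : iv s6 v_QT = V v_QT by rewrite QT6 /V (env_QT K7).
clear - bnd a1 a2 a3 a4 b1 b2 b3 b4 c1 c2 c3 c4 d1 d2 d3 d4 e1 e2 e3 e4 f1 f2 f3 f4
  g1 g2 g3 g4 i1 i2 i3 i4 j1 j2 j3 j4 k1 k2 k3 k4 o1 o2 o3 p1 p2 p3 kV lV qV.
clearbody V s9 s8 s7 s6 s5 s4 s3 s2 s1.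
do 9 (apply: leq_add; [apply: bnd => // x; rewrite /= !inE; do ?case/orP;
  by move/eqP=> -> |]).
by apply: bnd => // x; rewrite /= !inE => /eqP->.
Qed.

End Solver.

Lemma nth_flatten_const (T : Type) (x0 : T) (ss : seq (seq T)) d i j :
  all (fun s => size s == d) ss -> i < size ss -> j < d ->
  nth x0 (flatten ss) (i * d + j) = nth x0 (nth [::] ss i) j.
Proof.
move=> + + jd; elim: ss i => [//|s ss IH] [|i] /= /andP[/eqP sd hd] il.
  by rewrite nth_cat sd mul0n add0n jd.
by rewrite nth_cat sd mulSn -addnA ltnNge leq_addr addKn /= IH.
Qed.

Lemma size_flatten_const (T : Type) (ss : seq (seq T)) d :
  all (fun s => size s == d) ss -> size (flatten ss) = size ss * d.
Proof.
by elim: ss => //= s ss IH /andP[/eqP sd /IH h]; rewrite size_cat sd h mulSn.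
Qed.

Lemma nth_allpairs (S T U : Type) (x0 : U) (y0 : S) (z0 : T) (f : S -> T -> U) s t i j :
  i < size s -> j < size t ->
  nth x0 [seq f x y | x <- s, y <- t] (i * size t + j) = f (nth y0 s i) (nth z0 t j).
Proof.
move=> il jl; rewrite nth_flatten_const ?size_map //; last first.
  by rewrite all_map (eq_all (a2 := predT)) ?all_predT // => x /=; rewrite size_map eqxx.
by rewrite (nth_map y0) // (nth_map z0).
Qed.

(** * Instances as machine inputs *)

Section Instance.
Variables (R : realType) (r n : nat) (I : csp R r n).
Hypotheses (r_gt1 : 1 < r) (n_gt0 : 0 < n).

Let m := #|edges I|.
Let r_gt0 : 0 < r. Proof. exact: ltnW. Qed.

Definition edge_list : seq (nat * nat) :=
  [seq (val e.1, val e.2) | e <- enum (edges I)].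

Definition raw_int := nth 0 (int_input I).
Definition raw_real := nth 0%R (real_input I).

Lemma size_edge_list : size edge_list = m.
Proof. by rewrite size_map -cardE. Qed.

Lemma edge_list_uniq : uniq edge_list.
Proof.
by rewrite map_inj_uniq ?enum_uniq // => -[a b] [c d] [/val_inj -> /val_inj ->].
Qed.

Lemma edge_list_lt : {in edge_list, forall e, e.1 < e.2}.
Proof. by move=> _ /mapP[e + ->]; rewrite mem_enum inE => /andP[]. Qed.

Lemma edge_list_n : {in edge_list, forall e, e.2 < n}.
Proof. by move=> _ /mapP[e _ ->]; exact: ltn_ord. Qed.

Let ord_r : 'I_r := Ordinal r_gt0.
Let ord_n : 'I_n := Ordinal n_gt0.
Let e0 := (ord_n, ord_n).
Let nth_edge i := nth e0 (enum (edges I)) i.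

Lemma edge_nth i : i < m -> edge edge_list i = (val (nth_edge i).1, val (nth_edge i).2).
Proof. by move=> im; rewrite /edge (nth_map e0) // -cardE. Qed.

Lemma nth_pair i j : i < m -> j < 2 ->
  raw_int (i + i + 3 + j) = nth 0 [:: val (nth_edge i).1; val (nth_edge i).2] j.
Proof.
move=> im j2; rewrite /raw_int /int_input.
have -> : i + i + 3 + j = (i * 2 + j).+3 by lia.
rewrite /= nth_flatten_const ?size_map -?cardE //; last first.
  by rewrite all_map; apply/allP.
by rewrite (nth_map e0) // -cardE.
Qed.

Lemma raw_int1 i : i < m -> raw_int (i + i + 3) = (edge edge_list i).1.
Proof. by move=> im; rewrite -[_ + 3]addn0 nth_pair // edge_nth. Qed.

Lemma raw_int2 i : i < m -> raw_int (i + i + 4) = (edge edge_list i).2.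
Proof.
by move=> im; rewrite (_ : i + i + 4 = i + i + 3 + 1) ?nth_pair ?edge_nth //; lia.
Qed.

Lemma size_int_input : size (int_input I) = 3 + m * 2.
Proof.
rewrite /int_input /= (@size_flatten_const _ _ 2) ?size_map -?cardE //.
by rewrite all_map; apply/allP.
Qed.

Let vertex_block := [seq s_vertex I v a | v <- enum 'I_n, a <- enum 'I_r].
Let edge_block (e : 'I_n * 'I_n) := [seq s_edge I e.1 e.2 a b | a <- enum 'I_r, b <- enum 'I_r].

Lemma size_vertex_block : size vertex_block = n * r.
Proof. by rewrite size_allpairs !size_enum_ord. Qed.

Lemma edge_blocks_const : all (fun s => size s == r * r) [seq edge_block e | e <- enum (edges I)].
Proof. by rewrite all_map; apply/allP => e _ /=; rewrite size_allpairs !size_enum_ord. Qed.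

Lemma size_real_input : size (real_input I) = 1 + n * r + m * (r * r).
Proof.
rewrite /real_input /= size_cat -/vertex_block size_vertex_block.
by rewrite (size_flatten_const edge_blocks_const) size_map -cardE add1n addSn.
Qed.

Lemma raw_vertex (v : 'I_n) (a : 'I_r) : raw_real (v * r + a).+1 = s_vertex I v a.
Proof.
rewrite /raw_real /real_input /= nth_cat -/vertex_block size_vertex_block ifT; last first.
  by have := ltn_ord v; have := ltn_ord a; nia.
have -> : v * r + a = v * size (enum 'I_r) + a by rewrite size_enum_ord.
by rewrite (nth_allpairs _ ord_n ord_r) ?size_enum_ord // !nth_ord_enum.
Qed.

Lemma raw_edge k (a c : 'I_r) : k < m ->
  edge_score n r raw_real k a c = s_edge I (nth_edge k).1 (nth_edge k).2 a c.
Proof.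
move=> km; rewrite /edge_score /raw_real /real_input.
have -> : n * r + 1 + k * (r * r) + (a * r + c) = (n * r + (k * (r * r) + (a * r + c))).+1
  by rewrite addn1 !addSn -addnA.
rewrite /= nth_cat -/vertex_block size_vertex_block ltnNge leq_addr /= addKn.
rewrite (nth_flatten_const _ edge_blocks_const) ?size_map -?cardE //; last first.
  by have := ltn_ord a; have := ltn_ord c; nia.
rewrite (nth_map e0) -?cardE //.
have -> : a * r + c = a * size (enum 'I_r) + c by rewrite size_enum_ord.
by rewrite (nth_allpairs _ ord_r ord_r) ?size_enum_ord // !nth_ord_enum.
Qed.

Lemma total_score (f : nat -> nat) (phi : {ffun 'I_n -> 'I_r}) : (forall v : 'I_n, f v = phi v :> nat) ->
  total n r m edge_list raw_real f = score I phi.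
Proof.
move=> hf; rewrite /total /score; congr (_ + _ + _)%R.
  rewrite -[n in iota 0 n]subn0 -/(index_iota 0 n) big_mkord; apply: eq_bigr => v _.
  by rewrite hf raw_vertex.
rewrite -[RHS]big_enum /= (big_nth e0) -cardE big_mkord; apply: eq_bigr => i _.
by rewrite edge_nth // !hf raw_edge.
Qed.

(** The handshake count: adjacency is expanded into indicators of oriented edges, after which the
    sum over edges can be moved outside. *)
Lemma degree_sum : \sum_(v <- iota 0 n) degree (adjn edge_list) (iota 0 n) v = m * 2.
Proof.
pose ind (e : nat * nat) (u v : nat) := if u == e.1 then (if v == e.2 then 1 else 0) else 0.
have cnt u v : (u, v) \in edge_list = \sum_(e <- edge_list) ind e u v :> nat.
  rewrite -count_uniq_mem ?edge_list_uniq // -sum1_count big_mkcond /=.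
  apply: eq_bigr => e _; rewrite /ind eq_sym [e]surjective_pairing xpair_eqE /=.
  by case: eqP => _; case: eqP.
have adjE u v : adjn edge_list u v = \sum_(e <- edge_list) (ind e u v + ind e v u) :> nat.
  rewrite big_split /= -!cnt /adjn; case h1: (_ \in _); case h2: (_ \in _) => //.
  by have := ltn_trans (edge_list_lt h1) (edge_list_lt h2); rewrite /= ltnn.
have degE v : degree (adjn edge_list) (iota 0 n) v
    = \sum_(u <- iota 0 n) \sum_(e <- edge_list) (ind e v u + ind e u v).
  rewrite /degree -sum1_count big_mkcond /=; apply: eq_bigr => u _.
  by rewrite -adjE; case: (adjn _ _ _).
under eq_bigr => v _ do rewrite degE.
under eq_bigr => v _ do rewrite exchange_big.
rewrite exchange_big /=.
have sum1 e : e \in edge_list ->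
    \sum_(v <- iota 0 n) \sum_(u <- iota 0 n) (ind e v u + ind e u v) = 2.
  move=> he; have h2 := edge_list_n he; have h1 := ltn_trans (edge_list_lt he) h2.
  have aux : \sum_(v <- iota 0 n) \sum_(u <- iota 0 n) ind e v u = 1.
    rewrite -[RHS](@sum_if_eq nat (iota 0 n) e.1 (fun=> 1)) ?iota_uniq ?mem_iota //.
    apply: eq_bigr => v _; rewrite /ind; case: eqP => _; last by rewrite big1.
    by rewrite (@sum_if_eq nat (iota 0 n) e.2 (fun=> 1)) ?iota_uniq ?mem_iota.
  under eq_bigr => v _ do rewrite big_split.
  rewrite big_split /= aux.
  by rewrite exchange_big /= aux.
rewrite (eq_big_seq (fun=> 2)) //.
by rewrite big_const_seq count_predT size_edge_list iter_addn_0 mulnC.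
Qed.

Lemma edges_le : m <= n * n.
Proof. by rewrite /m (leq_trans (max_card _)) // card_prod card_ord. Qed.

(** The degree sum 2 m equals d n, so [greedy_branching] applies; the exponent need not be an
    integer, hence the passage to real powers, monotone for the base r >= 1. *)
Lemma branching_powR bs fs (d := avg_degree I) : (2 <= d)%R ->
  greedy_inv R (adjn edge_list) (iota 0 n) bs fs [::] ->
  (r%:R ^+ size bs <= r%:R `^ ((1 - 2 / (d + 1)) * n%:R) :> R)%R.
Proof.
move=> d2 g; have := greedy_branching g d2.
rewrite degree_sum size_iota => h.
rewrite -powR_mulrn ?ler0n //; apply: ler_powR; first by rewrite ler1n.
apply: h; rewrite /d /avg_degree -/m mulfVK ?pnatr_eq0 -?lt0n //.
by rewrite natrM mulrC.
Qed.

End Instance.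

(** * The machine program and its running time *)

Definition load_sizes : program :=
  [:: ILoad v_n 0; IConst 4 1; ILoad v_r 4; IConst 4 2; ILoad v_m 4].

Definition csp_program : program :=
  load_sizes ++ compile prologue nints 5
  ++ compile solver nints (5 + csize prologue).

Lemma prologue_cost (R : realType) (s : state R) n r m :
  iv s v_n = n -> iv s v_r = r -> iv s v_m = m -> 0 < n -> 0 < r -> m <= n * n ->
  cost prologue s <= 1000 * (r ^ 2 * n.+1 ^ 3).
Proof.
move=> hn hr hm n_gt0 r_gt0 m_le.
rewrite /prologue; set rest := (ISet v_rr _ ;; _); set s1 := eval (ISet v_n1 ('v_n .+ #1)) s.
change (cost (ISet v_n1 ('v_n .+ #1)) s + cost rest s1 <= 1000 * (r ^ 2 * n.+1 ^ 3)).
have := @cost_scost R rest s1 isT.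
have n1 : iv s1 v_n1 = n.+1 by rewrite /= hn addn1.
have r1 : iv s1 v_r = r by [].
have m1 : iv s1 v_m = m by [].
move: (iv s1) n1 r1 m1 => V n1 r1 m1.
rewrite /= n1 r1 m1; set Y := r ^ 2 * n.+1 ^ 3.
have h1 : r <= Y by rewrite /Y; nia.
have h2 : n.+1 <= Y by rewrite /Y; nia.
have h3 : m <= Y by rewrite /Y; nia.
by lia.
Qed.

Theorem csp_program_solves (R : realType) (r n : nat) (I : csp R r n) :
  1 < r -> 0 < n -> (2 <= avg_degree I)%R ->
  let d := avg_degree I in
  solves_in_time I csp_program
    ((20 * 1000)%:R * r%:R ^+ 2 *
     (n%:R * r%:R `^ ((1 - 2 / (d + 1)) * n%:R) + (('X + 1) ^+ 3).[n%:R]))%R.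
Proof.
move=> r_gt1 n_gt0 d2 d.
have r_gt0 : 0 < r by exact: ltnW.
set m := #|edges I|; have m_le : m <= n * n := edges_le I.
pose b := n.+1 * r + m * (r * r) + m + m + 4.
pose X0 := ireg (run (start I) load_sizes).
pose s0 := State X0 (fun=> 0%R) (fun j => if j is 0 then raw_int I else fun=> 0)
  (fun j => if j is 0 then raw_real I else fun=> 0%R).
have n0 : iv s0 v_n = n by [].
have r0 : iv s0 v_r = r by [].
have m0 : iv s0 v_m = m by [].
set P := csp_program.
have /code_at_cat[code0 /code_at_cat[code1]] : code_at P 0 csp_program.
  by have := code_at_self [::] csp_program [::]; rewrite cats0.
rewrite size_comp !add0n => code2.
have run0 : iter 5 (step P) (start I) = Config 5 X0 (fun=> 0%R) (raw_int I) (raw_real I).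
  by rewrite (@iter_run R P (start I) load_sizes).
have b_gt0 : 0 < b by rewrite /b addnS.
(* Both input lists end below [b], where the memory is 0 by default; this is what the zero arrays of
   [s0] represent. *)
have rep0 : rep b s0 X0 (fun=> 0%R) (raw_int I) (raw_real I).
  split=> //; split=> // j x _.
    by rewrite /raw_int nth_default // size_int_input /b -/m; lia.
  by rewrite /raw_real nth_default // size_real_input /b -/m; nia.
(* Variable 0 does not hold [b] yet; [comp_ok] applies because the prologue is array-free. *)
have [X1 [F1 [M1 [W1 [run1 rep1 _]]]]] :=
  comp_ok (c := prologue) isT isT (leqnn _) code1 b_gt0 rep0.
have [D1 _ b1] := prologue_ok n0 r0 m0.
set s1 := eval prologue s0 in rep1 D1 b1.
have [X2 [F2 [M2 [W2 [run2 [_ _ [M2E _] [W2E _]] _]]]]] :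
  exists X' F' M' W', [/\ iter (cost solver s1) (step P)
      (Config (5 + csize prologue) X1 F1 M1 W1)
      = Config (5 + csize prologue + csize solver) X' F' M' W',
    rep b (eval solver s1) X' F' M' W' & forall i, nints <= i < nints -> X' i = X1 i].
  by apply: comp_ok => //; rewrite b1 eqxx orbT.
have E1 : env1 n r m b (raw_int I) (raw_real I) s1.
  split=> //; rewrite /s1 ?eval_iv //.
  - by rewrite eval_ia.
  - by rewrite eval_ra.
have [] := @solver_ok R n r m b (edge_list I) (raw_int I) (raw_real I) r_gt1 n_gt0
  (size_edge_list I) (edge_list_uniq I) (@edge_list_lt R r n I) (@edge_list_n R r n I)
  (erefl _) (raw_int1 r_gt1 n_gt0) (raw_int2 r_gt1 n_gt0) s1 m_le E1.
- by move=> j x; rewrite /s1 eval_ia //; case: j.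
- by move=> j x; rewrite /s1 eval_ra //; case: j.
move=> bs [fs [f [[ginv [hf fn] out_v out_s mx] tm]]].
exists (cost solver s1 + (cost prologue s0 + 5)) => c.
have cE : c = Config (5 + csize prologue + csize solver) X2 F2 M2 W2.
  by rewrite /c iterD iterD run0 run1 run2.
rewrite cE; split.
- have tp := prologue_cost n0 r0 m0 n_gt0 r_gt0 m_le.
  set k := size bs in tm.
  (* 12000 for the solver, 1000 for the prologue and the 5 initial loads fit into 20000. *)
  have tN : cost solver s1 + (cost prologue s0 + 5)
      <= 20 * 1000 * (r ^ 2 * (n * r ^ k + n.+1 ^ 3)).
    set Y := r ^ 2 * (_ + _) in tm *.
    have h1 : r ^ 2 * n.+1 ^ 3 <= Y by rewrite /Y leq_mul2l leq_addl orbT.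
    have h2 : 0 < r ^ 2 * n.+1 ^ 3 by rewrite muln_gt0 !expn_gt0 r_gt0.
    by lia.
  apply: (@le_trans _ _ (20 * 1000 * (r ^ 2 * (n * r ^ k + n.+1 ^ 3)))%:R%R).
    by rewrite ler_nat.
  rewrite [X in (X <= _)%R]natrM -mulrA ler_wpM2l ?ler0n // natrM natrX.
  rewrite ler_wpM2l ?exprn_ge0 ?ler0n // natrD natrM !natrX !hornerE -natr1 lerD2r.
  by rewrite ler_wpM2l ?ler0n //; apply: branching_powR ginv.
- by rewrite /halted /P /csp_program 2!size_cat 2!size_comp addnA.
exists [ffun v : 'I_n => Ordinal (hf v)].
have fE (v : 'I_n) : f v = [ffun v : 'I_n => Ordinal (hf v)] v :> nat by rewrite ffunE.
have nb v : v < n -> v < b by rewrite /b; nia.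
split.
- by move=> v /=; rewrite M2E ?nb // out_v // fE.
- by rewrite /= W2E // out_s (total_score I r_gt1 n_gt0 fE).
(* The competitor is extended by 0 to all natural numbers, in particular to the dummy vertex n. *)
move=> psi; pose g v := if insub v is Some u then psi u : nat else 0.
have gE (v : 'I_n) : g v = psi v by rewrite /g valK.
rewrite -(total_score I r_gt1 n_gt0 fE) -(total_score I r_gt1 n_gt0 gE); apply: mx; split.
  by move=> v; rewrite /g; case: insub.
by rewrite /g insubF // ltnn.
Qed.

Local Open Scope ring_scope.

Theorem theorem13 (R : realType) :
  exists (P : program) (C : R) (p : {poly R}),
  forall (r n : nat) (I : csp R r n),
    (2 <= r)%N -> (1 <= n)%N -> 2 <= avg_degree I ->
    let d := avg_degree I in
    solves_in_time I P
      (C * r%:R ^+ 2 *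
       (n%:R * r%:R `^ ((1 - 2 / (d + 1)) * n%:R) + p.[n%:R])).
Proof.
exists csp_program, (20 * 1000)%:R, (('X + 1) ^+ 3) => r n I.
exact: csp_program_solves.
Qed.
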